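(* Let $(Z_n)_{n\in\mathbb N}$ be a real-valued stochastic process satisfying the moment conditions (M1), (M2), (M3) stated in the context, and for each $N\in\mathbb N$ let $\varphi_N$ be a filling such that the sequence $(\varphi_N)_N$ satisfies the filling condition (F) stated in the context. Let $X_N\in\mathbb R^{N\times N}$ be the symmetric random matrix generated by $(Z_n)_n$ and $\varphi_N$, and let $A_N(i,j):=\frac{1}{\sqrt N}X_N(i,j)$. Let $\lambda_1^{(N)}\le\dots\le\lambda_N^{(N)}$ be the eigenvalues of $A_N$ and $\mu_N=\frac1N\sum_{k=1}^N\delta_{\lambda_k^{(N)}}$ its empirical spectral distribution. Then $\mu_N$ converges weakly in probability, as $N\to\infty$, to the semicircle law $\nu$ given by $\nu(dx)=\frac{1}{2\pi}\sqrt{4-x^2}\,\mathbf 1_{|x|\le 2}\,dx$.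
   Context: Filling: for each $N$, a filling is a bijection $\varphi_N:\{1,\dots,N(N+1)/2\}\to\{(i,j)\in\{1,\dots,N\}^2: i\le j\}$. The symmetric matrix $X_N\in\mathbb R^{N\times N}$ generated by $(Z_n)_n$ and $\varphi_N$ has entries $X_N(i,j)=X_N(j,i)=Z_{\varphi_N^{-1}(i,j)}$ for $1\le i\le j\le N$. Distance: for $i\le j$, $i'\le j'$ set $\|(i,j)-(i',j')\|_{\varphi_N}:=|\varphi_N^{-1}(i,j)-\varphi_N^{-1}(i',j')|$; if $i>j$ (resp. $i'>j'$), replace $(i,j)$ by $(j,i)$ (resp. $(i',j')$ by $(j',i')$). Filling condition (F): for every integer $n\ge1$, $\#\{x\in\{1,\dots,N\}:\|(i,x)-(x,j)\|_{\varphi_N}=n\}=o(N)$ as $N\to\infty$, uniformly in $i,j\in\{1,\dots,N\}$. Moment conditions on $(Z_n)_n$ (all expectations that appear are assumed to exist; convention $0^0=1$): (M1) $\mathbb E(Z_i^2)=1$ for all $i\in\mathbb N$. (M2) For all odd $k$ and all $i_1,\dots,i_k\in\mathbb N$: $\mathbb E(Z_{i_1}Z_{i_2}\cdots Z_{i_k})=0$. (M3) For all even $k$ there are constants $C>0$ and $\beta\in[0,1)$ such that for all $i_1\le i_2\le\dots\le i_k$, with $n_j:=i_{j+1}-i_j$: (a) $|\mathbb E(Z_{i_1}\cdots Z_{i_k})|\le C\beta^{n_1+n_3+\dots+n_{k-1}}$; (b) for all $j_1\le\dots\le j_k$, with $d:=\min_{n,m\in\{1,\dots,k\}}|i_n-j_m|$: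 $|\mathbb E(Z_{i_1}\cdots Z_{i_k}Z_{j_1}\cdots Z_{j_k})-\mathbb E(Z_{i_1}\cdots Z_{i_k})\mathbb E(Z_{j_1}\cdots Z_{j_k})|\le C\beta^d$; (c) with $d':=\min_{j=1,3,5,\dots,k-3}(i_{j+2}-i_j)$: $|\mathbb E(Z_{i_1}^2Z_{i_3}^2\cdots Z_{i_{k-1}}^2)-1|\le C\beta^{d'}$ (for $k=2$ the minimum is empty and (c) is contained in (M1)). Weak convergence in probability means: for every bounded continuous $f:\mathbb R\to\mathbb R$, $\int f\,d\mu_N\to\int f\,d\nu$ in probability. *)

(* Defs.v *)
From HB Require Import structures.
From mathcomp Require Import all_boot all_order all_algebra.
From mathcomp Require Import polyrcf.
From mathcomp Require Import all_classical all_reals all_analysis measurable_realfun.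

Set Implicit Arguments.
Unset Strict Implicit.
Unset Printing Implicit Defensive.

Import Order.TTheory GRing.Theory Num.Theory.
Import numFieldNormedType.Exports.

Local Open Scope classical_set_scope.
Local Open Scope ring_scope.

(* All indices are shifted to start at 0: the process is (Z_n)_(n >= 0) and a
   filling is a bijection from {0, ..., N(N+1)/2 - 1} to the pairs i <= j in
   {0, ..., N-1}^2. All conditions below only involve differences of indices. *)

Definition upper (N : nat) := {p : 'I_N * 'I_N | (p.1 <= p.2)%N}.

Record filling (N : nat) := Filling {
  fill_fun :> 'I_((N * N.+1)./2) -> upper N;
  fill_inv : upper N -> 'I_((N * N.+1)./2);
  fill_funK : cancel fill_fun fill_inv;
  fill_invK : cancel fill_inv fill_fun }.

Definition sort_pair (N : nat) (i j : 'I_N) : 'I_N * 'I_N :=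
  if (i <= j)%N then (i, j) else (j, i).

Lemma sort_pair_le (N : nat) (i j : 'I_N) :
  ((sort_pair i j).1 <= (sort_pair i j).2)%N.
Proof. by rewrite /sort_pair; case: (leqP i j) => [|/ltnW]. Qed.

Definition upair (N : nat) (i j : 'I_N) : upper N :=
  exist _ (sort_pair i j) (sort_pair_le i j).

Definition fill_pos (N : nat) (phi : filling N) (i j : 'I_N) : nat :=
  fill_inv phi (upair i j).

Definition fill_dist (N : nat) (phi : filling N) (p q : 'I_N * 'I_N) : nat :=
  `|(fill_pos phi p.1 p.2)%:Z - (fill_pos phi q.1 q.2)%:Z|%N.

Definition filling_condition (R : realType) (phi : forall N, filling N) :=
  forall n : nat, (1 <= n)%N -> forall eps : R, 0 < eps ->
    \forall N \near \oo, forall i j : 'I_N,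
      #|[pred x : 'I_N | fill_dist (phi N) (i, x) (x, j) == n]|%:R
        <= eps * N%:R.

Section Moments.
Context (d : measure_display) (T : measurableType d) (R : realType).
Context (P : probability T R) (Z : nat -> {RV P >-> R}).

Definition prodZ (s : seq nat) : T -> R := fun w => \prod_(n <- s) Z n w.

Definition moments_exist :=
  forall s : seq nat, P.-integrable [set: T] (EFin \o prodZ s).

Definition M1 := forall n : nat, ('E_P[fun w => (Z n w ^+ 2)%R] = 1)%E.

Definition M2 := forall s : seq nat, odd (size s) -> ('E_P[prodZ s] = 0)%E.

(* Minimum of a sequence of naturals; only meaningful on nonempty sequences. *)
Definition seq_min (s : seq nat) : nat := foldr minn (head 0%N s) s.

(* n_1 + n_3 + ... + n_(k-1) *)
Definition odd_gaps (s : seq nat) : nat :=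
  (\sum_(l < (size s)./2) (nth 0 s l.*2.+1 - nth 0 s l.*2))%N.

Definition seq_dist (s t : seq nat) : nat :=
  seq_min [seq `|a%:Z - b%:Z|%N | a <- s, b <- t].

(* i_1, i_3, ..., i_(k-1) *)
Definition odd_entries (s : seq nat) : seq nat :=
  [seq nth 0%N s l.*2 | l <- iota 0 (size s)./2].

(* min of i_(j+2) - i_j over j = 1, 3, ..., k - 3 *)
Definition odd_min_gap (s : seq nat) : nat :=
  seq_min [seq (nth 0%N s l.*2.+2 - nth 0%N s l.*2)%N
          | l <- iota 0 (size s)./2.-1].

Definition M3a (k : nat) (C beta : R) :=
  forall s : seq nat, size s = k -> sorted leq s ->
    (`| 'E_P[prodZ s] | <= (C * beta ^+ odd_gaps s)%:E)%E.

Definition M3b (k : nat) (C beta : R) :=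
  forall s t : seq nat, size s = k -> size t = k ->
    sorted leq s -> sorted leq t ->
    (`| 'E_P[prodZ (s ++ t)] - 'E_P[prodZ s] * 'E_P[prodZ t] |
       <= (C * beta ^+ seq_dist s t)%:E)%E.

(* For k = 2 the minimum is over the empty set and the condition is part of
   M1, whence the guard. *)
Definition M3c (k : nat) (C beta : R) :=
  (2 < k)%N -> forall s : seq nat, size s = k -> sorted leq s ->
    (`| 'E_P[fun w => (\prod_(n <- odd_entries s) Z n w ^+ 2)%R] - 1 |
       <= (C * beta ^+ odd_min_gap s)%:E)%E.

Definition M3 :=
  forall k : nat, (0 < k)%N -> ~~ odd k ->
    exists C beta : R, [/\ 0 < C, 0 <= beta & beta < 1] /\
      [/\ M3a k C beta, M3b k C beta & M3c k C beta].

Definition gen_matrix (N : nat) (phi : filling N) (w : T) : 'M[R]_N :=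
  \matrix_(i, j) Z (fill_pos phi i j) w.

Definition scaled_matrix (N : nat) (phi : filling N) (w : T) : 'M[R]_N :=
  (Num.sqrt N%:R)^-1 *: gen_matrix phi w.

End Moments.

(* Real eigenvalues in nondecreasing order, each repeated according to its
   multiplicity as a root of the characteristic polynomial; rootsR lists the
   distinct real roots in increasing order. *)
Definition eigenvalues (R : realType) (N : nat) (A : 'M[R]_N) : seq R :=
  flatten [seq nseq (mup x (char_poly A)) x | x <- rootsR (char_poly A)].

Definition esd (R : realType) (N : nat) (A : 'M[R]_N) :
    {measure set (measurableTypeR R) -> \bar R} :=
  mscale (N%:R^-1)%:nng
    (msum (fun k => dirac ((eigenvalues A)`_k : measurableTypeR R)) N).

Definition semicircle_pdf (R : realType) (x : R) : R :=
  (2 * pi)^-1 * Num.sqrt (4 - x ^+ 2) * \1_[set y : R | `|y| <= 2] x.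

Definition semicircle (R : realType) (A : set (measurableTypeR R)) : \bar R :=
  (\int[lebesgue_measure]_(x in A) (semicircle_pdf x)%:E)%E.

Section SemicircleMeasure.
Context (R : realType).

Lemma semicircle_pdf_ge0 (x : R) : 0 <= semicircle_pdf x.
Proof.
by rewrite /semicircle_pdf !mulr_ge0 ?invr_ge0 ?mulr_ge0 ?pi_ge0 ?sqrtr_ge0.
Qed.

Lemma measurable_semicircle_pdf :
  measurable_fun [set: R] (@semicircle_pdf R).
Proof.
have csqrt : continuous (fun x : R => Num.sqrt (4 - x ^+ 2)).
  move=> x; apply: continuous_comp; last exact: sqrt_continuous.
  by apply: cvgB; [exact: cvg_cst | exact: exprn_continuous].
apply: measurable_funM.
  apply: measurable_funM; first exact: measurable_cst.
  exact: continuous_measurable_fun.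
apply: measurable_indic.
have -> : [set y : R | `|y| <= 2] = `[-2, 2]%classic.
  by apply/seteqP; split => y /=; rewrite in_itv /= ler_norml.
exact: measurable_itv.
Qed.

Let semicircle0 : semicircle (@set0 (measurableTypeR R)) = 0%E.
Proof. by rewrite /semicircle integral_set0. Qed.

Let semicircle_ge0 (A : set (measurableTypeR R)) : (0 <= semicircle A)%E.
Proof. by apply: integral_ge0 => x _; rewrite lee_fin semicircle_pdf_ge0. Qed.

Let semicircle_sigma_additive : semi_sigma_additive (@semicircle R).
Proof.
move=> /= A mA tA mUA.
rewrite /semicircle ge0_integral_bigcup//=; last first.
- by move=> x _; rewrite lee_fin semicircle_pdf_ge0.
- apply/measurable_EFinP; apply: measurable_funTS.
  exact: measurable_semicircle_pdf.
apply: is_cvg_ereal_nneg_natsum_cond => n _ _.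
by apply: integral_ge0 => x _; rewrite lee_fin semicircle_pdf_ge0.
Qed.

HB.instance Definition _ := isMeasure.Build _ _ _
  (@semicircle R) semicircle0 semicircle_ge0 semicircle_sigma_additive.

End SemicircleMeasure.

Definition weak_cvg_in_probability (d : measure_display) (T : measurableType d)
    (R : realType) (P : probability T R)
    (mu : nat -> T -> {measure set (measurableTypeR R) -> \bar R})
    (nu : {measure set (measurableTypeR R) -> \bar R}) :=
  forall f : R -> R, continuous f -> (exists M : R, forall x, `|f x| <= M) ->
  forall eps : R, 0 < eps ->
    P [set w | eps < `| \int[mu N w]_x f x - \int[nu]_x f x |] @[N --> \oo]
      --> 0%E.

(* Main.v *)
Require Import Defs.
From mathcomp Require Import all_boot all_order all_algebra.
From mathcomp Require Import all_classical all_reals all_analysis.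
From mathcomp Require Import measurable_realfun.
From mathcomp Require Import polyrcf complex spectral sesquilinear.
From mathcomp Require Import ring lra zify.

Set Implicit Arguments.
Unset Strict Implicit.
Unset Printing Implicit Defensive.

Import Order.TTheory GRing.Theory Num.Theory.
Import numFieldNormedType.Exports.

Local Open Scope ring_scope.
Local Open Scope classical_set_scope.

(** The proof is the moment method: the spectral moments converge in mean square
    to the moments of the semicircle law, and a bounded continuous test function
    is a polynomial up to an error that an even monomial controls.

    The [k]-th moment of the empirical spectral distribution is a normalised sum,
    over the closed walks of [k] steps in [{0, ..., N - 1}], of products of the
    variables at the positions that the filling gives to the arcs of the walk.
    The moment conditions enter through three estimates for lists of positions.
    - By [M3a] the expectation of such a product is at most a constant times a
      sum over pairings of the factors, where each pair of positions at distance
      [n] contributes a power of [b ^+ n] for some [b < 1]: one of these pairings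
      matches consecutive order statistics ([odd_gaps_le_words]). A pairing is
      encoded by a word in which every letter occurs twice.
    - By [M3c] the expectation of a product of squares differs from 1 by at most
      a sum of [b ^+ n] over the pairs of factors.
    - By [M3b] and [M3a] the covariance of two products is at most a constant
      times a sum over pairings multiplied by a link factor, namely a sum of
      [b ^+ n] over the pairs made of a position of each list. Both bounds hold
      separately, and their geometric mean keeps something of each
      ([moment_covariance_bound]).

    Sums over walks are estimated by averaging over one vertex label at a time.
    Two arcs with a common end and distinct other ends have distinct positions,
    so the sum of [b ^+ n] over the possible labels of a free end of an arc is
    at most a constant [K], and an arc whose letter has been met costs a factor
    [K / N] against the [N] labels available ([explore_path]).

    A walk is reducible when it collapses to a point by cancelling backtracks.
    For irreducible walks the exploration gains a small factor
    ([irreducible_wick_sum]). The word of the walk repeats some letter, with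
    distinct letters in between. If the two occurrences are adjacent, either the
    two arcs backtrack and can be removed, or their outer ends differ and the
    filling condition makes the sum over the middle vertex small. If they are
    not adjacent, an arc between them can be explored with both ends free, which
    gains a factor [1 / N]. Hence irreducible walks are negligible.

    A reducible walk meets every stored position twice, so that its expectation
    is nearly 1, and it remains to count reducible walks. Following a walk through
    the height of the stack of uncancelled arcs gives a recursion ([walk_count])
    which, divided by powers of the square root of [N], becomes the three-term
    recursion of the integrals of [x ^+ k * cheb h x] against the semicircle
    density; these polynomials are orthogonal to [cheb 0 = 1] for [h > 0]
    ([sc_int_cheb]). So the means of the spectral moments converge to the moments
    of the semicircle law ([walk_mean_cvg]).

    The variances vanish, since the link factor ties two walks together and costs
    one more factor [1 / N] ([walk_covariance_cvg]). Finally, Weierstrass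
    approximation, a monomial of high degree for the tails, and Markov's
    inequality turn the mean square convergence of the moments into convergence
    in probability of the integrals of test functions. *)

(** * Geometric sums *)

Definition ndist (p q : nat) : nat := ((p - q) + (q - p))%N.

Lemma ndistC p q : ndist p q = ndist q p.
Proof. by rewrite /ndist addnC. Qed.

Lemma ndistnn p : ndist p p = 0%N.
Proof. by rewrite /ndist subnn. Qed.

Lemma ndistE (p q : nat) : ndist p q = `|p%:Z - q%:Z|%N.
Proof. rewrite /ndist; lia. Qed.

Section GeometricSums.
Context (R : realFieldType) (b : R) (b0 : 0 <= b) (b1 : b < 1).

Lemma geo_sum_le M : \sum_(m < M) b ^+ m <= (1 - b)^-1.
Proof.
have h : 0 < 1 - b by rewrite subr_gt0.
rewrite -[leRHS]mulr1 ler_pdivlMl //.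
have -> : (1 - b) * \sum_(m < M) b ^+ m = 1 - b ^+ M.
  by rewrite -[1 - b]opprB mulNr -subrX1 opprB.
by rewrite gerBl exprn_ge0.
Qed.

Lemma geo_inj_sum_le (I : finType) (P : pred I) (g : I -> nat) :
  {in P &, injective g} -> \sum_(i | P i) b ^+ g i <= (1 - b)^-1.
Proof.
move=> injg; set M := (\max_i g i).+1.
have gM i : (g i < M)%N by rewrite ltnS leq_bigmax.
rewrite (partition_big (fun i => Ordinal (gM i)) predT) //=.
apply: le_trans (geo_sum_le M); apply: ler_sum => m _.
case: (pickP (fun i => P i && (Ordinal (gM i) == m))) => [i /andP[Pi /eqP im]|no].
  rewrite (bigD1 i) /=; last by rewrite Pi im eqxx.
  rewrite big1 ?addr0; last first.
    move=> j /andP[/andP[Pj /eqP jm] /eqP []]; apply: injg => //.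
    by have := congr1 val (etrans jm (esym im)).
  by have -> : g i = m by rewrite -im.
by rewrite big_pred0 ?exprn_ge0.
Qed.

(** Splitting at the centre [q] leaves two one-sided geometric series. *)
Lemma geo_ndist_sum_le (I : finType) (P : pred I) (f : I -> nat) (q : nat) :
  {in P &, injective f} ->
  \sum_(i | P i) b ^+ ndist (f i) q <= 2 / (1 - b).
Proof.
move=> injf; rewrite (bigID (fun i => q <= f i)%N) /= mulrDl !mul1r.
apply: lerD.
- apply: geo_inj_sum_le => i j /andP[Pi hi] /andP[Pj hj] e.
  by apply: injf => //; move: e hi hj; rewrite /ndist; lia.
- apply: geo_inj_sum_le => i j /andP[Pi hi] /andP[Pj hj] e.
  by apply: injf => //; move: e hi hj; rewrite /ndist; lia.
Qed.

End GeometricSums.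

(** * Averaging over one label *)

Section Resampling.
Context (R : realFieldType) (V : finType) (N : nat).
Implicit Types (v : {ffun V -> 'I_N}) (F G : {ffun V -> 'I_N} -> R).

Definition relabel v x y : {ffun V -> 'I_N} := [ffun z => if z == x then y else v z].

Definition free_of F (x : V) := forall v y, F (relabel v x y) = F v.

Lemma relabel_same v x y : relabel v x y x = y.
Proof. by rewrite ffunE eqxx. Qed.

Lemma relabel_other v x y z : z != x -> relabel v x y z = v z.
Proof. by move=> /negPf zx; rewrite ffunE zx. Qed.

Lemma relabelK v x y : relabel (relabel v x y) x (v x) = v.
Proof.
by apply/ffunP => z; rewrite !ffunE; case: eqP => // ->.
Qed.

(** Exchanging the old and the new value at [x] is an involution of the pairs
    (labelling, new value). *)
Lemma sum_resample F x : \sum_v \sum_y F (relabel v x y) = N%:R * \sum_v F v.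
Proof.
rewrite pair_bigA /=.
pose h (p : {ffun V -> 'I_N} * 'I_N) := (relabel p.1 x p.2, p.1 x).
have hK : involutive h by case=> v y; rewrite /h /= relabelK relabel_same.
rewrite (reindex_inj (inv_inj hK)) /=.
under eq_bigr do rewrite relabelK.
rewrite -(pair_bigA _ (fun v _ => F v)) /=.
under eq_bigr do rewrite sumr_const card_ord -mulr_natl.
by rewrite -mulr_sumr.
Qed.

Lemma sum_ffun0 F (x : V) : N = 0%N -> \sum_v F v = 0.
Proof.
move=> N0; rewrite big_pred0 // => v; exfalso.
by case: (v x) => m; rewrite N0.
Qed.

(** Averaging over the label of [x] alone, on which [G] does not depend, replaces
    [g] by a bound for its mean. *)
Lemma sum_peel G g x (K : R) : free_of G x -> (forall v, 0 <= G v) ->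
  (forall v, \sum_y g (relabel v x y) <= K) ->
  \sum_v G v * g v <= K / N%:R * \sum_v G v.
Proof.
move=> freeG G0 gK; have [N0|N0] := posnP N.
  by rewrite !(sum_ffun0 _ x N0) mulr0.
have NR0 : (0 : R) < N%:R by rewrite ltr0n.
rewrite mulrAC ler_pdivlMr // mulrC -(sum_resample _ x) mulr_sumr.
apply: ler_sum => v _; under eq_bigr do rewrite freeG.
by rewrite -mulr_sumr mulrC; apply: ler_wpM2r.
Qed.

(** Both labels are averaged at once: the bound concerns the double sum, which
    may be much smaller than what two single sums would give. *)
Lemma sum_peel2 G g x x' (K : R) : free_of G x -> free_of G x' ->
  (forall v, 0 <= G v) ->
  (forall v, \sum_y \sum_y' g (relabel (relabel v x' y') x y) <= K) ->
  \sum_v G v * g v <= K / N%:R ^+ 2 * \sum_v G v.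
Proof.
move=> freeG freeG' G0 gK.
pose g' v := \sum_y g (relabel v x y).
have [N0|N0] := posnP N.
  by rewrite !(sum_ffun0 _ x N0) mulr0.
have NR0 : (0 : R) < N%:R by rewrite ltr0n.
have -> : \sum_v G v * g v = N%:R^-1 * \sum_v G v * g' v.
  apply: (mulfI (lt0r_neq0 NR0)); rewrite mulrA divff ?gt_eqF // mul1r.
  rewrite -(sum_resample _ x); apply: eq_bigr => v _.
  by under eq_bigr do rewrite freeG; rewrite -mulr_sumr.
rewrite expr2 invfM !mulrA mulrC [leRHS]mulrAC ler_pdivlMr // mulfVK ?gt_eqF //.
apply: (@sum_peel _ _ x') => // v; rewrite /g'.
by rewrite exchange_big.
Qed.

End Resampling.

(** * Pairing weights of lettered positions *)

Section Wick.
Context (R : realFieldType) (b : R) (b0 : 0 <= b) (b1 : b < 1).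

(** Ordered pairs are used so that the weight is visibly symmetric: two positions
    with the same letter contribute the square of [b ^+ ndist p p'], and the
    diagonal contributes 1. *)
Definition wick (L : seq (nat * nat)) : R :=
  \prod_(x <- L) \prod_(y <- L | y.2 == x.2) b ^+ ndist x.1 y.1.

Lemma wfactor_ge0 n : 0 <= b ^+ n. Proof. exact: exprn_ge0. Qed.
Lemma wfactor_le1 n : b ^+ n <= 1. Proof. by rewrite exprn_ile1 // ltW. Qed.

Lemma wick_perm L L' : perm_eq L L' -> wick L = wick L'.
Proof.
move=> LL'; rewrite /wick (perm_big _ LL') /=.
by apply: eq_bigr => x _; apply: perm_big.
Qed.

Lemma wick_ge0 L : 0 <= wick L.
Proof. by do 2![apply: prodr_ge0 => ? _]; apply: wfactor_ge0. Qed.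

Lemma wick_cons e L : wick (e :: L) <= wick L.
Proof.
rewrite /wick big_cons -[leRHS]mul1r; apply: ler_pM.
- by apply: prodr_ge0 => ? _; apply: wfactor_ge0.
- by do 2![apply: prodr_ge0 => ? _]; apply: wfactor_ge0.
- by apply: prodr_ile1 => y _; rewrite wfactor_ge0 wfactor_le1.
apply: ler_prod => x _; apply/andP; split.
  by apply: prodr_ge0 => ? _; apply: wfactor_ge0.
rewrite big_cons; case: ifP => // _; rewrite -[leRHS]mul1r.
apply: ler_wpM2r; last exact: wfactor_le1.
by apply: prodr_ge0 => ? _; apply: wfactor_ge0.
Qed.

Lemma wick_cat L1 L2 : wick (L1 ++ L2) <= wick L2.
Proof. by elim: L1 => //= e L1 IH; apply: le_trans (wick_cons _ _) IH. Qed.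

Lemma wick_le1 L : wick L <= 1.
Proof. by rewrite -[L]cats0; apply: le_trans (wick_cat _ _) _; rewrite /wick big_nil. Qed.

(** Of the factors that involve the new entry, one with a prescribed partner is
    kept and the others are at most 1. *)
Lemma wick_match e e' L : e' \in L -> e'.2 = e.2 ->
  wick (e :: L) <= b ^+ ndist e.1 e'.1 * wick L.
Proof.
move=> e'L ee'; rewrite /wick big_cons; apply: ler_pM.
- by apply: prodr_ge0 => ? _; apply: wfactor_ge0.
- by do 2![apply: prodr_ge0 => ? _]; apply: wfactor_ge0.
- rewrite big_cons eqxx ndistnn mul1r (big_rem e') //= ee' eqxx -[leRHS]mulr1.
  apply: ler_wpM2l; first exact: wfactor_ge0.
  by apply: prodr_ile1 => y _; rewrite wfactor_ge0 wfactor_le1.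
apply: ler_prod => x _; apply/andP; split.
  by apply: prodr_ge0 => ? _; apply: wfactor_ge0.
rewrite big_cons; case: ifP => // _; rewrite -[leRHS]mul1r.
apply: ler_wpM2r; last exact: wfactor_le1.
by apply: prodr_ge0 => ? _; apply: wfactor_ge0.
Qed.

End Wick.

(** * Exploration of lettered paths *)

Section LetteredPaths.
Context (A : Type).

(** Each vertex of [u] carries the letter of the arc that leaves it, and [z] is
    the end of the path, so that joining paths is concatenation ([arcs_cat]). *)
Fixpoint arcs (u : seq (A * nat)) (z : A) : seq (A * A * nat) :=
  if u is (x, c) :: u' then ((x, head z (unzip1 u')), c) :: arcs u' z else [::].

Lemma arcs_cat u1 u2 z : arcs (u1 ++ u2) z = arcs u1 (head z (unzip1 u2)) ++ arcs u2 z.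
Proof.
elim: u1 => [|[x c] u1 IH] //=; rewrite IH; congr (_ :: _).
by case: u1 {IH} => //= -[].
Qed.

Lemma arcs_letters u z : unzip2 (arcs u z) = unzip2 u.
Proof. by elim: u => [|[x c] u IH] //=; congr (_ :: _). Qed.

Lemma size_arcs u z : size (arcs u z) = size u.
Proof. by elim: u => [|[x c] u IH] //=; rewrite IH. Qed.

End LetteredPaths.

Definition avoids (V : eqType) (x : V) (e : V * V * nat) :=
  (x != e.1.1) && (x != e.1.2).

Lemma arcs_avoid (V : eqType) (u : seq (V * nat)) (z x : V) :
  x != z -> x \notin unzip1 u -> all (avoids x) (arcs u z).
Proof.
move=> xz; elim: u => [|[y c] u IH] //=; rewrite inE negb_or => /andP[xy xu].
rewrite /avoids /= xy IH // andbT /=.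
by case: u xu {IH} => //= -[y' c'] u; rewrite inE negb_or => /andP[].
Qed.

Lemma size_undup_cat (T : eqType) (s1 s2 : seq T) :
  (size (undup (s1 ++ s2)) <= size s1 + size (undup s2))%N.
Proof.
by elim: s1 => //= x s1 IH; case: ifP => _ /=; rewrite ?ltnS ?addSn //; lia.
Qed.

Section Exploration.
Context (R : realFieldType) (V : finType) (N : nat) (pos : 'I_N -> 'I_N -> nat).
Context (posC : forall x y, pos x y = pos y x).
Context (posI : forall x y x' y', pos x y = pos x' y' ->
  (x = x' /\ y = y') \/ (x = y' /\ y = x')).
Context (b : R) (b0 : 0 <= b) (b1 : b < 1).

(** A bound for a sum of [b ^+ ndist p q] over distinct positions [p]. *)
Definition nbhd_mass : R := 2 / (1 - b).
Local Notation K := nbhd_mass.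

Definition arc_pos (v : {ffun V -> 'I_N}) (e : V * V) := pos (v e.1) (v e.2).
Definition lettered_pos (v : {ffun V -> 'I_N}) (e : V * V * nat) := (arc_pos v e.1, e.2).
Definition arcs_wick v L := wick b (map (lettered_pos v) L).

Lemma arcs_wick_ge0 v L : 0 <= arcs_wick v L. Proof. exact: wick_ge0. Qed.

Lemma lettered_pos_relabel v x y e : avoids x e -> lettered_pos (relabel v x y) e = lettered_pos v e.
Proof.
by case/andP=> x1 x2; rewrite /lettered_pos /arc_pos !relabel_other // eq_sym.
Qed.

Lemma arcs_wick_free x L : all (avoids x) L -> free_of (fun v => arcs_wick v L) x.
Proof.
move=> /allP xL v y; rewrite /arcs_wick; congr wick.
by apply/eq_in_map => e eL; apply/lettered_pos_relabel/xL.
Qed.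

Lemma pos_injr x : injective (pos x).
Proof. by move=> y y' /posI [[_ ->] // | [-> ->]]. Qed.

Lemma pos_row_sum x q : \sum_y b ^+ ndist (pos x y) q <= K.
Proof. by apply: geo_ndist_sum_le => // y y' _ _; apply: pos_injr. Qed.

(** Each unordered pair is met by two ordered ones, whence the factor 2. *)
Lemma pos_pair_sum q : \sum_x \sum_y b ^+ ndist (pos x y) q <= 2 * K.
Proof.
rewrite pair_bigA /= (bigID (fun p : 'I_N * 'I_N => p.1 <= p.2)%N) /= mulr_natl mulr2n.
apply: lerD.
- apply: (@geo_ndist_sum_le _ _ b0 b1 _ _ (fun p : 'I_N * 'I_N => pos p.1 p.2)).
  move=> [x y] [x' y']; rewrite /in_mem /= => h h' /posI [[-> ->] //|[e1 e2]].
  by subst; congr pair; apply/val_inj/eqP; rewrite eqn_leq ?h ?h'.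
- apply: (@geo_ndist_sum_le _ _ b0 b1 _ _ (fun p : 'I_N * 'I_N => pos p.1 p.2)).
  move=> [x y] [x' y']; rewrite /in_mem /= -!ltnNge => h h' /posI [[-> ->] //|[e1 e2]].
  by subst; have := ltn_trans h h'; rewrite ltnn.
Qed.

Lemma nbhd_mass_ge1 : 1 <= K.
Proof. by rewrite /nbhd_mass ler_pdivlMr ?subr_gt0 // mul1r lerBlDr ler_wpDr ?ler1n. Qed.

Lemma arc_pos_relabel_sum v x z q : z != x ->
  \sum_y b ^+ ndist (arc_pos (relabel v x y) (x, z)) q <= K.
Proof.
move=> zx; rewrite /arc_pos /=; under eq_bigr do rewrite relabel_same relabel_other // posC.
exact: pos_row_sum.
Qed.

Lemma arc_pos_relabel2_sum v x z q : z != x ->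
  \sum_y \sum_y' b ^+ ndist (arc_pos (relabel (relabel v z y') x y) (x, z)) q <= 2 * K.
Proof.
move=> zx; rewrite /arc_pos /=.
under eq_bigr do under eq_bigr do rewrite relabel_same relabel_other // relabel_same.
exact: pos_pair_sum.
Qed.

(** The proportion of the labels, in weight, for which an arc with a free end
    lies near a given position. *)
Definition arc_cost := K / N%:R.
Local Notation q := arc_cost.

Lemma arc_cost_ge0 : 0 <= q.
Proof. by rewrite divr_ge0 // (le_trans ler01 nbhd_mass_ge1). Qed.

Lemma arc_cost_sqr_ge : 2 * K / N%:R ^+ 2 <= 2 * q ^+ 2.
Proof.
rewrite -mulrA ler_wpM2l // /arc_cost expr_div_n.
apply: ler_wpM2r; first by rewrite invr_ge0 exprn_ge0.
by rewrite expr2 ler_peMl ?nbhd_mass_ge1 // (le_trans ler01) ?nbhd_mass_ge1.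
Qed.

(** Backward exploration of a path with fresh vertices: the tail of each arc is
    new, so that an arc whose letter was met before costs a factor [q]. The
    exponent is the number of these arcs. The factor [G] collects weights that
    do not see the fresh vertices. *)
Lemma explore_path (u : seq (V * nat)) (z : V) L0 G :
  uniq (z :: unzip1 u) ->
  (forall x, x \in unzip1 u -> all (avoids x) L0) ->
  (forall x, x \in unzip1 u -> free_of G x) ->
  (forall v, 0 <= G v) ->
  \sum_v G v * arcs_wick v (arcs u z ++ L0) <=
    q ^+ (size u + size (undup (unzip2 L0)) - size (undup (unzip2 u ++ unzip2 L0)))
    * \sum_v G v * arcs_wick v L0.
Proof.
move=> + + + G0; elim: u => [|[x c] u IH] /=.
  by rewrite add0n subnn expr0 mul1r.
rewrite inE negb_or -andbA => /and4P[zx zu xu uu] avo ind.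
have {}IH : \sum_v G v * arcs_wick v (arcs u z ++ L0) <=
    q ^+ (size u + size (undup (unzip2 L0)) - size (undup (unzip2 u ++ unzip2 L0)))
    * \sum_v G v * arcs_wick v L0.
  apply: IH; first by rewrite /= zu.
    by move=> y yu; apply: avo; rewrite inE yu orbT.
  by move=> y yu; apply: ind; rewrite inE yu orbT.
have ineq := size_undup_cat (unzip2 u) (unzip2 L0); rewrite size_map in ineq.
have Lx : all (avoids x) (arcs u z ++ L0).
  by rewrite all_cat arcs_avoid 1?eq_sym // avo // inE eqxx.
case: ifP => cin; last first.
  rewrite /= addSn subSS; apply: le_trans IH; apply: ler_sum => v _.
  by apply: ler_wpM2l => //; apply: wick_cons.
rewrite addSn subSn // exprS -mulrA; apply: le_trans (ler_wpM2l arc_cost_ge0 IH).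
have : c \in unzip2 (arcs u z ++ L0) by rewrite /unzip2 map_cat -/(unzip2 (arcs u z)) arcs_letters.
case/mapP => e' e'L ce'.
have hx : head z (unzip1 u) != x.
  case: (u) zu xu => [|[a ?] ?] /=; first by rewrite zx.
  by rewrite !inE !negb_or => _ /andP[]; rewrite eq_sym.
set h := head z (unzip1 u) in hx *.
(* Only the factor that links the new arc to an earlier one with its letter is
   kept; it is averaged over the label of [x]. *)
apply: (@le_trans _ _ (\sum_v (G v * arcs_wick v (arcs u z ++ L0)) *
    b ^+ ndist (arc_pos v (x, h)) (arc_pos v e'.1))).
  apply: ler_sum => v _; rewrite -mulrA; apply: ler_wpM2l => //.
  rewrite mulrC; apply: (@wick_match _ _ b0 b1 (lettered_pos v ((x, h), c)) (lettered_pos v e')).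
    exact: map_f.
  by rewrite /= ce'.
apply: (@sum_peel _ _ _ _ _ x) => [v y|v|v].
- by rewrite ind ?inE ?eqxx // arcs_wick_free.
- by rewrite mulr_ge0 // arcs_wick_ge0.
- have e'x : avoids x e' by move/allP: Lx; apply.
  under eq_bigr => y _.
    have /(congr1 fst) /= -> := lettered_pos_relabel v y e'x.
    over.
  exact: arc_pos_relabel_sum.
Qed.

End Exploration.

(** * Cancellation of backtracks *)

Section BacktrackReduction.
Context (T : eqType).
Implicit Types (st s : seq T).

(** A walk is followed while storing its backtrack-free reduction, latest vertex
    first: a step back to the previous vertex of the reduction cancels the last
    arc, any other step is stored. *)
Definition step st y :=
  if st is top :: par :: st' then
    if y == par then par :: st' else y :: st
  else y :: st.

Definition run st s := foldl step st s.

Definition reducible s :=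
  if s is x :: s' then run [:: x] (rcons s' x) == [:: x] else true.

Fixpoint reduced st :=
  if st is a :: st' then
    (if st' is _ :: c :: _ then a != c else true) && reduced st'
  else true.

Lemma reduced_step st y : reduced st -> reduced (step st y).
Proof.
case: st => [|a [|b st]] //= /andP[ac bst].
by case: eqP => // /eqP yb; rewrite /= yb /= ac.
Qed.

Lemma step_head st y : exists st', step st y = y :: st'.
Proof.
case: st => [|a [|b st]]; [by exists [::] | by exists [:: a] |].
by rewrite /step; case: eqP => [->|_]; [exists st | exists (a :: b :: st)].
Qed.

Lemma reduced_run st s : reduced st -> reduced (run st s).
Proof. by elim: s st => //= y s IH st rst; apply/IH/reduced_step. Qed.

(** On a reduced stack, going to [b] and back restores the stack, even when the
    step to [b] is itself a cancellation. *)
Lemma step_backtrack a st b : reduced (a :: st) -> step (step (a :: st) b) a = a :: st.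
Proof.
case: st => [|p st] /=; first by rewrite eqxx.
case/andP => ap pst; case: eqP => _; last by rewrite /= eqxx.
by case: st ap pst => //= z st az _; rewrite (negPf az).
Qed.

Lemma run_backtrack st a b s : reduced st ->
  run st [:: a, b, a & s] = run st (a :: s).
Proof.
move=> rst /=; have [st' e] := step_head st a.
by rewrite e step_backtrack // -e reduced_step.
Qed.

(** Used in contraposed form: removing a backtrack from an irreducible closed
    walk leaves it irreducible. *)
Lemma reducible_backtrack s1 a b s2 : a = head (head a s1) s2 ->
  reducible (s1 ++ s2) -> reducible (s1 ++ a :: b :: s2).
Proof.
case: s1 => [|x s1] /= ha.
  case: s2 ha => [_ _ |a' s2 /= <-]; first by rewrite /= eqxx eqxx.
  by rewrite /= !eqxx.
rewrite !rcons_cat /run !foldl_cat -!/(run _ _) /= => /eqP e.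
have rst : reduced (run [:: x] s1) by apply: reduced_run.
have := run_backtrack a b _ rst.
case: s2 ha e => [|a' s2] /= ha e.
  by move=> /(_ [::]) /=; rewrite ha => ->; rewrite e.
by move=> /(_ (rcons s2 x)) /=; rewrite -ha in e * => ->; rewrite e.
Qed.

End BacktrackReduction.

(** * Words with two occurrences of each letter *)

Section BalancedWords.
Context (T : eqType).
Implicit Types (s : seq T).

Definition balanced s := all (fun d => count_mem d s == 2) s.

Lemma perm_balanced s s' : perm_eq s s' -> balanced s = balanced s'.
Proof.
move=> ss'; rewrite /balanced (perm_all _ ss').
by apply: eq_all => d; rewrite (permP ss').
Qed.

Lemma balanced_size s : balanced s -> size s = (size (undup s)).*2.
Proof.
move=> /allP bs; rewrite -addnn -size_cat; apply: perm_size.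
apply/allP => d; rewrite !mem_cat mem_undup /= => /orP hd.
have ds : d \in s by case: hd => // /orP[].
by rewrite count_cat !(count_uniq_mem _ (undup_uniq s)) mem_undup ds (eqP (bs _ ds)).
Qed.

Lemma balanced_cons2 c s : balanced (c :: c :: s) -> balanced s /\ c \notin s.
Proof.
move=> /allP bs; have cs : c \notin s.
  have := bs c (mem_head _ _); rewrite /= eqxx /= !add1n !eqSS.
  by rewrite -has_pred1 has_count lt0n negbK.
split=> //; apply/allP => d ds; have := bs d; rewrite !inE ds !orbT /= => /(_ isT).
by have /negPf -> : c != d by apply: contraNneq cs => ->.
Qed.

End BalancedWords.

(** Taking the last vertex whose letter recurs later makes all the letters behind
    it distinct. *)
Lemma repeated_letter (A : eqType) (u : seq (A * nat)) : ~~ uniq (unzip2 u) ->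
  exists u1 x c u2 y u3,
    u = u1 ++ (x, c) :: u2 ++ (y, c) :: u3 /\ uniq (c :: unzip2 u2).
Proof.
elim: u => [|[x c] u IH] //=.
have [uu|nu _] := boolP (uniq (unzip2 u)); last first.
  have [u1 [x' [c' [u2 [y [u3 [-> h]]]]]]] := IH nu.
  by exists ((x, c) :: u1), x', c', u2, y, u3.
rewrite andbT negbK => /mapP[[y c'] yu /= cc']; subst c'.
case/splitPr: yu uu => u2 u3 uu; exists [::], x, c, u2, y, u3; split => //=.
by move: uu; rewrite /unzip2 map_cat cat_uniq /= negb_or => /and3P[-> /andP[-> _] _].
Qed.

(** * Irreducible walks *)

Definition closed_arcs (A : Type) (u : seq (A * nat)) : seq (A * A * nat) :=
  if u is (x, _) :: _ then arcs u x else [::].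

Section WickSums.
Context (R : realFieldType) (V : finType) (N : nat) (pos : 'I_N -> 'I_N -> nat).
Context (posC : forall x y, pos x y = pos y x).
Context (posI : forall x y x' y', pos x y = pos x' y' ->
  (x = x' /\ y = y') \/ (x = y' /\ y = x')).
Context (b : R) (b0 : 0 <= b) (b1 : b < 1).
Implicit Types (v : {ffun V -> 'I_N}) (u : seq (V * nat)).

Local Notation K := (nbhd_mass b).
Local Notation q := (arc_cost N b).
Local Notation wickE := (arcs_wick pos b).
Local Notation lpos := (lettered_pos pos).
Local Notation epos := (arc_pos pos).
Local Notation total := (#|{ffun V -> 'I_N}|%:R : R).

Lemma sumE_const (c : R) : \sum_(v : {ffun V -> 'I_N}) c = total * c.
Proof. by rewrite sumr_const mulr_natl. Qed.

Lemma arcs_wick_perm v L L' : perm_eq L L' -> wickE v L = wickE v L'.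
Proof. by move=> LL'; apply/wick_perm/perm_map. Qed.

Lemma arcs_wick_cons v e L : wickE v (e :: L) <= wickE v L.
Proof. exact: wick_cons. Qed.

Lemma explore_open u (z : V) : uniq (z :: unzip1 u) ->
  \sum_v wickE v (arcs u z) <= q ^+ (size u - size (undup (unzip2 u))) * total.
Proof.
move=> uz; have := @explore_path R V N pos posC posI b b0 b1 u z [::] (fun=> 1) uz.
rewrite /= !cats0 addn0 => h.
apply: le_trans (le_trans _ (h _ _ _)) _ => //.
  by apply: ler_sum => v _; rewrite mul1r.
rewrite -[total]mulr1 -sumE_const; apply: ler_wpM2l.
  by rewrite exprn_ge0 // arc_cost_ge0.
by apply: ler_sum => v _; rewrite mul1r wick_le1.
Qed.

Lemma lettered_pos_arcs_end v u x z : v x = v z ->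
  map (lpos v) (arcs u x) = map (lpos v) (arcs u z).
Proof.
move=> xz; elim: u => [|[y c] u IH] //=; rewrite IH; congr (_ :: _).
by rewrite /lettered_pos /arc_pos /=; case: u {IH} => //=; rewrite xz.
Qed.

(** When both ends of an arc are free, its position runs over all pairs of labels
    and is taken at most twice, so that prescribing it costs a factor of order
    [N ^- 2] instead of [N ^- 1]. *)
Lemma double_fresh_arc (x y : V) d (L : seq (V * V * nat)) G :
  x != y -> all (avoids x) L -> all (avoids y) L ->
  free_of G x -> free_of G y -> (forall v, 0 <= G v) ->
  d \in unzip2 L ->
  \sum_v G v * wickE v (((x, y), d) :: L) <= 2 * q ^+ 2 * \sum_v G v * wickE v L.
Proof.
move=> xy xL yL Gx Gy G0 /mapP[e' e'L de'].
apply: (@le_trans _ _ (\sum_v (G v * wickE v L) * b ^+ ndist (epos v (x, y)) (epos v e'.1))).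
  apply: ler_sum => v _; rewrite -mulrA; apply: ler_wpM2l => //.
  rewrite mulrC; apply: (@wick_match _ _ b0 b1 (lpos v ((x, y), d)) (lpos v e')).
    exact: map_f.
  by rewrite /= de'.
apply: (@le_trans _ _ (2 * K / N%:R ^+ 2 * \sum_v G v * wickE v L)).
  apply: (@sum_peel2 _ _ _ _ _ x y) => [v z|v z|v|v].
  - by rewrite Gx arcs_wick_free.
  - by rewrite Gy arcs_wick_free.
  - by rewrite mulr_ge0 // arcs_wick_ge0.
  have e'x : avoids x e' by move/allP: xL; apply.
  have e'y : avoids y e' by move/allP: yL; apply.
  under eq_bigr => z _. under eq_bigr => z' _.
    have /(congr1 fst) /= -> := lettered_pos_relabel pos (relabel v y z') z e'x.
    have /(congr1 fst) /= -> := lettered_pos_relabel pos v z' e'y.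
    over.
  over.
  by apply: arc_pos_relabel2_sum => //; rewrite eq_sym.
apply: ler_wpM2r.
  by apply: sumr_ge0 => v _; rewrite mulr_ge0 // arcs_wick_ge0.
exact: arc_cost_sqr_ge.
Qed.

Context (delta : R).
Context (qdelta : q <= delta).
Context (sparse : forall i j : 'I_N, i != j ->
  \sum_x b ^+ ndist (pos i x) (pos x j) <= delta * N%:R).

Let q0 : 0 <= q. Proof. exact: arc_cost_ge0. Qed.
Let delta0 : 0 <= delta. Proof. exact: le_trans q0 qdelta. Qed.

Definition irreducible_wick v u : R :=
  wickE v (closed_arcs u) * (~~ reducible (map v (unzip1 u)))%:R.

(** Two consecutive arcs from [x] to [y] and from [y] to [z] carry the same letter.
    If [x] and [z] have the same label, these arcs backtrack: they are removed,
    the rest of the walk is still irreducible, and the coincidence of the two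
    labels costs a factor [1 / N]. Otherwise the sum over the label of [y] is
    small by [sparse]. *)
Lemma irreducible_wick_adjacent n u1 x y c u2 :
  (forall u', uniq (unzip1 u') -> size u' = n.*2 -> balanced (unzip2 u') ->
    \sum_v irreducible_wick v u' <= (n.*2)%:R * delta * q ^+ n.-1 * total) ->
  let u := u1 ++ (x, c) :: (y, c) :: u2 in
  uniq (unzip1 u) -> size u = n.+1.*2 -> balanced (unzip2 u) ->
  \sum_v irreducible_wick v u <= (n.+1.*2)%:R * delta * q ^+ n * total.
Proof.
move=> IH u uu su bu.
have u12 : balanced (unzip2 (u2 ++ u1)).
  rewrite (@perm_balanced _ _ (c :: c :: unzip2 (u2 ++ u1))) in bu.
    by have [] := balanced_cons2 bu.
  by rewrite /u /unzip2 !map_cat /= perm_catC.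
have s12 : size (u2 ++ u1) = n.*2.
  by move: su; rewrite /u !size_cat /=; lia.
case: n => [|n] in IH su s12 *.
  case: u1 u2 @u s12 {uu bu u12 su IH} => [|? ?] [|? ?] //= _.
  rewrite big1 ?mulr_ge0 ?exprn_ge0 // => v _.
  by rewrite /irreducible_wick /= !eqxx mulr0.
have u1u2 : u1 ++ u2 != [::] by case: (u1) (u2) s12 => [|? ?] [|? ?].
pose h := head x (unzip1 u1).
pose z := head h (unzip1 u2).
have uE : closed_arcs u = arcs u1 x ++ ((x, y), c) :: ((y, z), c) :: arcs u2 h.
  rewrite /u /z /h; case: (u1) => [|[x' c'] u1'] //.
  exact: (arcs_cat ((x', c') :: u1') ((x, c) :: (y, c) :: u2) x').
have : uniq (x :: y :: unzip1 (u2 ++ u1)).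
  rewrite -(perm_uniq (s1 := unzip1 u)) // /u /unzip1 !map_cat /=.
  by rewrite perm_catC.
rewrite /= inE negb_or => /and3P[/andP[xy xu] yu u21].
have zin : z \in unzip1 (u2 ++ u1).
  rewrite /z /h; case: (u1) (u2) u1u2 => [|[? ?] ?] [|[? ?] ?] //= _; rewrite ?mem_cat ?inE ?eqxx ?orbT //.
have zx : z != x by apply: contraNneq xu => <-.
have zy : z != y by apply: contraNneq yu => <-.
have rest_perm : perm_eq (arcs u1 x ++ arcs u2 h) (arcs (u2 ++ u1) x).
  by rewrite arcs_cat perm_catC.
(* [A] and [B] are the weights of the two cases. *)
pose A v : R := (v x == v z)%:R.
pose B v : R := (v x != v z)%:R * b ^+ ndist (epos v (x, y)) (epos v (y, z)).
have merge v : v x = v z ->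
    map (lpos v) (arcs u1 x ++ arcs u2 h) = map (lpos v) (closed_arcs (u1 ++ u2)).
  rewrite /z /h; case: (u1) => [|[x' c'] u1'] vxz.
    by case: (u2) vxz => [|[z' c'] u2'] //= vxz; exact: (@lettered_pos_arcs_end v ((z', c') :: u2')).
  have -> : closed_arcs (((x', c') :: u1') ++ u2) =
      arcs ((x', c') :: u1') (head x' (unzip1 u2)) ++ arcs u2 x' by exact: arcs_cat.
  by rewrite !map_cat (lettered_pos_arcs_end _ vxz).
have bound v : irreducible_wick v u <=
    irreducible_wick v (u1 ++ u2) * A v + wickE v (arcs (u2 ++ u1) x) * B v.
  rewrite /A /B /irreducible_wick uE -(arcs_wick_perm _ rest_perm).
  have pE : perm_eq (arcs u1 x ++ ((x, y), c) :: ((y, z), c) :: arcs u2 h)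
     (((x, y), c) :: ((y, z), c) :: (arcs u1 x ++ arcs u2 h)).
    by rewrite perm_catC /= !perm_cons perm_catC.
  rewrite (arcs_wick_perm _ pE).
  have [vxz|vxz] := eqVneq (v x) (v z); last first.
    rewrite mulr0 add0r mul1r.
    set nr := (X in _ * X%:R <= _).
    apply: (@le_trans _ _ (wickE v (((x, y), c) :: ((y, z), c) :: arcs u1 x ++ arcs u2 h))).
      by rewrite ler_piMr ?arcs_wick_ge0 // lern1 leq_b1.
    apply: le_trans (@wick_match _ _ b0 b1 (lpos v ((x,y),c)) (lpos v ((y,z),c)) _ _ _) _ => //.
      by rewrite mem_head.
    rewrite mulrC; apply: ler_wpM2r; first exact: wfactor_ge0.
    exact: wick_cons.
  rewrite mul0r mulr0 addr0 mulr1; apply: ler_pM; rewrite ?arcs_wick_ge0 ?ler0n //.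
    apply: le_trans (arcs_wick_cons _ _ _) (le_trans (arcs_wick_cons _ _ _) _) => //.
    by rewrite /arcs_wick merge.
  have : reducible (map v (unzip1 (u1 ++ u2))) -> reducible (map v (unzip1 u)).
    rewrite /u /unzip1 !map_cat /=; apply: reducible_backtrack.
    rewrite vxz /z /h; case: (u1) (u2) => [|[? ?] ?] [|[? ?] ?] //=.
  by case: (reducible (map v (unzip1 u))); case: (reducible _) => // /(_ isT).
apply: (le_trans (ler_sum _ (fun v _ => bound v))).
rewrite big_split /=.
have -> : (n.+2.*2)%:R * delta * q ^+ n.+1 * total =
    q * ((n.+1.*2)%:R * delta * q ^+ n * total) + 2 * delta * q ^+ n.+1 * total.
  by rewrite doubleS -[(_.+2)%N]addn2 natrD exprS; ring.
apply: lerD.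
  have uu12 : uniq (unzip1 (u1 ++ u2)).
    by rewrite (perm_uniq (s2 := unzip1 (u2 ++ u1))) // perm_map // perm_catC.
  apply: (@le_trans _ _ (1 / N%:R * \sum_v irreducible_wick v (u1 ++ u2))).
    apply: (@sum_peel _ _ _ _ _ x) => [v y'|v|v].
    - have xu12 : x \notin unzip1 (u1 ++ u2).
        by move: xu; rewrite /unzip1 !map_cat !mem_cat orbC.
      rewrite /irreducible_wick arcs_wick_free; last first.
        case: (u1 ++ u2) xu12 => [|[x' c'] u'] // xu'.
        by apply: arcs_avoid => //; move: xu'; rewrite /= inE negb_or => /andP[].
      congr (_ * (~~ reducible _)%:R); apply/eq_in_map => z' z'u.
      by rewrite relabel_other //; apply: contraNneq xu12 => <-.
    - by rewrite mulr_ge0 ?arcs_wick_ge0.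
    - under eq_bigr do rewrite /A relabel_same relabel_other //.
      by rewrite (bigD1 (v z)) //= eqxx big1 ?addr0 // => y' /negPf ->.
  apply: ler_pM.
  - by rewrite divr_ge0.
  - by apply: sumr_ge0 => v _; rewrite mulr_ge0 ?arcs_wick_ge0.
  - by apply: ler_wpM2r; rewrite ?invr_ge0 // nbhd_mass_ge1.
  apply: IH => //; first by rewrite size_cat addnC -size_cat.
  by rewrite (@perm_balanced _ _ (unzip2 (u2 ++ u1))) // perm_map // perm_catC.
apply: (@le_trans _ _ (delta * \sum_v wickE v (arcs (u2 ++ u1) x))).
  have [N0|N0] := posnP N; first by rewrite !(sum_ffun0 _ x N0) mulr0.
  have NR0 : N%:R != 0 :> R by rewrite pnatr_eq0 -lt0n.
  rewrite -[delta](mulfK NR0); apply: (@sum_peel _ _ _ _ _ y) => [v y'|v|v].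
  - by rewrite arcs_wick_free // arcs_avoid // eq_sym.
  - exact: arcs_wick_ge0.
  under eq_bigr do rewrite /B /arc_pos /= relabel_same !relabel_other //.
  rewrite -mulr_sumr; case: eqVneq => [_|vxz].
    by rewrite mul0r mulr_ge0.
  by rewrite mul1r; exact: sparse.
rewrite -!mulrA mulrCA; apply: ler_wpM2l => //.
apply: le_trans (explore_open _) _ => /=.
  by rewrite xu.
have -> : (size (u2 ++ u1) - size (undup (unzip2 (u2 ++ u1))) = n.+1)%N.
  by have := balanced_size u12; rewrite size_map s12 => /double_inj <-; rewrite -addnn addnK.
by rewrite ler_peMl ?ler1n // mulr_ge0 ?exprn_ge0 ?ler0n.
Qed.

(** The inner path runs between the two vertices that carry [c]; its letters are
    distinct and all recur outside. The two arcs lettered [c] are discarded. Then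
    the inner path has no vertex in common with the outer one, and its last arc
    has both ends free, which gains one factor [q] over the exploration of a
    path with a known end. *)
Lemma irreducible_wick_separated n u1 x y c u2 u3 :
  let u := u1 ++ (x, c) :: u2 ++ (y, c) :: u3 in
  uniq (unzip1 u) -> size u = n.+1.*2 -> balanced (unzip2 u) ->
  u2 != [::] -> uniq (c :: unzip2 u2) ->
  \sum_v irreducible_wick v u <= (n.+1.*2)%:R * delta * q ^+ n * total.
Proof.
move=> u uu su bu u20 cu2.
pose out := u3 ++ u1.
have perm_u : perm_eq u ((x, c) :: (y, c) :: u2 ++ out).
  rewrite /u /out perm_catC /= perm_cons -catA /= -cat1s perm_catCA /= perm_cons.
  by rewrite catA.
have bw : balanced (c :: c :: unzip2 (u2 ++ out)).
  by rewrite -(perm_balanced (perm_map snd perm_u)).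
have [bw' cw] := balanced_cons2 bw.
have sw : size (u2 ++ out) = n.*2.
  by have := perm_size perm_u; rewrite su doubleS => -[].
have uw : uniq (x :: y :: unzip1 (u2 ++ out)).
  by rewrite -(perm_uniq (perm_map fst perm_u)).
(* The letters between the two occurrences of [c] all recur outside. *)
have mem_out : unzip2 (u2 ++ out) =i unzip2 out.
  move=> d; rewrite /unzip2 map_cat mem_cat; case: (boolP (d \in _)) => //= du2.
  have /allP /(_ d) := bw'; rewrite /unzip2 map_cat mem_cat du2 => /(_ isT).
  rewrite count_cat count_uniq_mem; last by case/andP: cu2.
  rewrite du2 /= add1n => /eqP[d1].
  by apply/esym; rewrite -has_pred1 has_count d1.
have size_letters : size (undup (unzip2 out)) = n.
  rewrite -(perm_size (perm_undup mem_out)); apply: double_inj.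
  by rewrite -(balanced_size bw') size_map.
pose h := head x (unzip1 u1).
have uE : perm_eq (closed_arcs u)
    (((x, head y (unzip1 u2)), c) :: ((y, head h (unzip1 u3)), c) :: arcs u2 y ++ arcs out x).
  have -> : closed_arcs u = arcs u1 x ++ ((x, head y (unzip1 u2)), c) ::
       arcs u2 y ++ ((y, head h (unzip1 u3)), c) :: arcs u3 h.
    rewrite /u /h; case: (u1) => [|[x' c'] u1'].
      rewrite /=; case: (u2) u20 => // -[y' c'] u2' _.
      by congr (_ :: _); exact: (arcs_cat ((y', c') :: u2')).
    rewrite [LHS](arcs_cat ((x', c') :: u1')) /=; congr (_ :: _ ++ _ :: _).
      by case: (u2).
    by rewrite arcs_cat.
  rewrite /out arcs_cat perm_catC /= perm_cons -catA /= -cat1s perm_catCA /= perm_cons.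
  by rewrite catA.
case: (lastP u2) => [//|u2' [x' d]] in cu2 mem_out sw uw uE perm_u bw' u20 *.
have {}uE v : wickE v (closed_arcs u) <= wickE v (arcs u2' x' ++ ((x', y), d) :: arcs out x).
  rewrite (arcs_wick_perm _ uE); apply: le_trans (arcs_wick_cons _ _ _) (le_trans (arcs_wick_cons _ _ _) _).
  by rewrite -cats1 arcs_cat -catA.
have : uniq (x :: y :: unzip1 u2' ++ x' :: unzip1 out).
  by move: uw; rewrite -cats1 /unzip1 !map_cat /= -catA.
rewrite /= inE mem_cat cat_uniq inE /= !negb_or mem_cat inE !negb_or -!andbA.
case/and5P=> xy xu2 xx' xo /and5P[yu2 yx' yo uu2 /and4P[x'u2 u2o x'o uo]].
have letters s' : s' =i unzip2 out -> size (undup s') = n.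
  by move=> e; rewrite (perm_size (perm_undup e)).
have d_out : d \in unzip2 out.
  by rewrite -mem_out /unzip2 map_cat map_rcons mem_cat mem_rcons mem_head.
pose L0 := ((x', y), d) :: arcs out x.
have mem_L0 : unzip2 L0 =i unzip2 out.
  move=> d'; rewrite /L0 /= -/(unzip2 _) arcs_letters inE.
  by case: eqP => // ->; rewrite d_out.
have mem_u2L0 : unzip2 u2' ++ unzip2 L0 =i unzip2 out.
  move=> d'; rewrite mem_cat mem_L0; case: (boolP (d' \in unzip2 out)) => d'o; rewrite ?orbT ?orbF //.
  apply: contraNF d'o => d'u; rewrite -mem_out /unzip2 map_cat map_rcons mem_cat.
  by rewrite mem_rcons inE d'u orbT.
apply: (@le_trans _ _ (\sum_v 1 * wickE v (arcs u2' x' ++ L0))).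
  apply: ler_sum => v _; rewrite mul1r; apply: le_trans (uE v).
  by rewrite ler_piMr ?arcs_wick_ge0 // lern1 leq_b1.
have := @explore_path R V N pos posC posI b b0 b1 u2' x' L0 (fun=> 1).
move/(_ _ _ (fun _ _ _ _ => erefl) (fun=> ler01)) => step1.
apply: le_trans (step1 _ _) _; first by rewrite /= x'u2.
  move=> t tu2; have tx' : t != x' by apply: contraNneq x'u2 => <-.
  have ty : t != y by apply: contraNneq yu2 => <-.
  have tx : t != x by apply: contraNneq xu2 => <-.
  rewrite /= {1}/avoids /= tx' ty arcs_avoid //.
  by apply: contraNN u2o => tout; apply/hasP; exists t.
rewrite (letters _ mem_L0) (letters _ mem_u2L0) addnK.
have step2 := @double_fresh_arc x' y d (arcs out x) (fun=> 1) _ _ _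
  (fun _ _ => erefl) (fun _ _ => erefl) (fun=> ler01) _.
apply: le_trans (ler_wpM2l (exprn_ge0 _ q0) (step2 _ _ _ _)) _.
- by rewrite eq_sym.
- by rewrite arcs_avoid // eq_sym.
- by rewrite arcs_avoid // eq_sym.
- by rewrite arcs_letters.
have step3 := @explore_open out x _.
rewrite (eq_bigr (fun v => wickE v (arcs out x))); last by move=> v _; rewrite mul1r.
apply: le_trans (ler_wpM2l (exprn_ge0 _ q0) (ler_wpM2l _ (step3 _))) _.
- by rewrite mulr_ge0 // exprn_ge0.
- by rewrite /= xo.
rewrite size_letters.
have sizes : (size u2' + 2 + (size out - n) = n.+1)%N.
  have nle : (n <= size out)%N by rewrite -size_letters -(size_map snd) size_undup.
  move: sw; rewrite size_cat size_rcons -addnn => sw.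
  apply/eqP; rewrite -(eqn_add2r n) -addnA subnK //; apply/eqP.
  by rewrite addnAC addn2 -addSn sw !addSn.
have -> : q ^+ size u2' * (2 * q ^+ 2 * (q ^+ (size out - n) * total)) =
    2 * q ^+ n.+1 * total.
  by rewrite -sizes !exprD; ring.
apply: ler_wpM2r; first exact: ler0n.
rewrite exprS mulrA; apply: ler_wpM2r; first exact: exprn_ge0.
by apply: ler_pM; rewrite ?ler0n // ler_nat.
Qed.

(** For closed walks in general, the exploration only gives the bound [q ^+ n.-1],
    without the factor [delta]. Pairs of adjacent equal letters are
    peeled off until a backtrack fails or a pair of equal letters is separated
    by distinct ones. *)
Lemma irreducible_wick_sum n u :
  uniq (unzip1 u) -> size u = n.*2 -> balanced (unzip2 u) ->
  \sum_v irreducible_wick v u <= (n.*2)%:R * delta * q ^+ n.-1 * total.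
Proof.
elim: n u => [|n IH] u uu su bu.
  rewrite (size0nil su) big1 ?mul0r // => v _.
  by rewrite /irreducible_wick /= mulr0.
have [ul|nul] := boolP (uniq (unzip2 u)).
  have := balanced_size bu; rewrite undup_id // size_map su => h.
  by exfalso; move: h; rewrite -addnn; lia.
have [u1 [x [c [u2 [y [u3 [uE cu2]]]]]]] := repeated_letter nul.
case: (eqVneq u2 [::]) => [u20|u20]; last first.
  by rewrite uE in uu su bu *; apply: irreducible_wick_separated.
rewrite uE u20 /= in uu su bu *.
exact: irreducible_wick_adjacent.
Qed.

End WickSums.

(** * Pairings of order statistics *)

Section WordsFromPairings.
Context (R : realFieldType) (b : R) (b0 : 0 <= b) (b1 : b < 1).

Lemma perm_map_lift (A B : eqType) (f : A -> B) (L : seq A) (s : seq B) :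
  perm_eq (map f L) s -> exists2 L', perm_eq L L' & map f L' = s.
Proof.
elim: s L => [|y s IH] L; first by case: L => [|? ?] /perm_size // _; exists [::].
move=> pLs; have : y \in map f L by rewrite (perm_mem pLs) mem_head.
case/mapP => x xL yx; have pL := perm_to_rem xL.
have : perm_eq (map f (rem x L)) s.
  by rewrite -(perm_cons y) yx -map_cons -yx; apply: perm_trans pLs; rewrite perm_sym perm_map.
case/IH => L' p' e'; exists (x :: L'); last by rewrite /= -yx e'.
by apply: perm_trans pL _; rewrite perm_cons.
Qed.

Lemma wick_pair p p' m L : m \notin unzip2 L ->
  wick b ((p, m) :: (p', m) :: L) = (b ^+ 2) ^+ ndist p p' * wick b L.
Proof.
move=> mL; have nil P : \prod_(y <- L | y.2 == m) (P y) = 1 :> R.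
  rewrite big_seq_cond big_pred0 // => y; apply/negP => /andP[yL /eqP ym].
  by case/negP: mL; rewrite -ym map_f.
rewrite /wick !big_cons /= eqxx !nil !mulr1 !ndistnn !mul1r (ndistC p' p) mulr1.
rewrite mulrA -exprMn -expr2; congr (_ * _).
rewrite big_seq [RHS]big_seq; apply: eq_bigr => -[x d] xL /=.
have /negPf md : m != d by apply: contraNneq mL => ->; apply: (map_f snd xL).
by rewrite !big_cons /= md.
Qed.

(** The letters of the pairing of consecutive order statistics; the first letter
    is a parameter for the sake of induction. *)
Fixpoint double_word (m n : nat) : seq nat :=
  if n is n'.+1 then m :: m :: double_word m.+1 n' else [::].

Lemma size_double_word m n : size (double_word m n) = n.*2.
Proof. by elim: n m => //= n IH m; rewrite IH. Qed.

Lemma mem_double_word m n d : (d \in double_word m n) = (m <= d < m + n)%N.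
Proof.
elim: n m => [|n IH] m /=; first by rewrite in_nil addn0; lia.
by rewrite !inE IH; lia.
Qed.

Lemma balanced_double_word m n : balanced (double_word m n).
Proof.
elim: n m => //= n IH m; have mn : m \notin double_word m.+1 n by rewrite mem_double_word ltnn.
rewrite /balanced /= eqxx /= !add1n (count_memPn mn) eqxx /=.
apply/allP => d dn; have /allP/(_ d dn)/= h := IH m.+1.
have /negPf -> : m != d by apply: contraNneq mn => {1}->.
exact: h.
Qed.

Lemma odd_gaps_cons2 p p' t : odd_gaps [:: p, p' & t] = ((p' - p) + odd_gaps t)%N.
Proof. by rewrite /odd_gaps /= big_ord_recl /=. Qed.

Lemma wick_double_word m n t : sorted leq t -> size t = n.*2 ->
  wick b (zip t (double_word m n)) = (b ^+ 2) ^+ odd_gaps t.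
Proof.
elim: n m t => [|n IH] m t.
  by move=> _ /size0nil ->; rewrite /wick big_nil /odd_gaps big_ord0 expr0.
case: t => [|p [|p' t]] // st; rewrite doubleS => -[st'].
rewrite /= wick_pair; last first.
  rewrite -/(unzip2 _) unzip2_zip ?size_double_word ?st' //.
  by rewrite mem_double_word ltnn.
rewrite IH //; last by move: st => /= /andP[_ /path_sorted].
rewrite odd_gaps_cons2 exprD; congr (_ ^+ _ * _).
by move: st => /= /andP[pp' _]; rewrite /ndist (eqP pp').
Qed.

(** The pairings of [k] positions, written as words. A pairing is listed once for
    each choice of its letters, which is harmless in upper bounds. *)
Definition words k : seq (seq nat) :=
  [seq map val (tval t) | t <- enum {: k.-tuple 'I_k} & balanced (map val (tval t))].

Lemma mem_words k cs :
  (cs \in words k) = [&& size cs == k, all (fun d => d < k)%N cs & balanced cs].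
Proof.
apply/mapP/and3P => [[t]|[/eqP scs acs bcs]].
  rewrite mem_filter => /andP[bt _] ->; split => //; first by rewrite size_map size_tuple.
  by apply/allP => d /mapP[i _ ->]; exact: ltn_ord.
case: k acs scs => [|k] acs scs.
  exists [tuple]; last by rewrite (size0nil scs).
  by rewrite mem_filter mem_enum andbT.
have st : size (map (@inord k) cs) == k.+1 by rewrite size_map scs.
have e : map val (map (@inord k) cs) = cs.
  rewrite -map_comp -[RHS]map_id; apply/eq_in_map => d dcs /=.
  by rewrite inordK //; apply: (allP acs).
exists (Tuple st); last by rewrite /= e.
by rewrite mem_filter mem_enum /= e bcs.
Qed.

(** The pairing of consecutive order statistics, carried back to the unsorted
    list, is one of the words. The base [b ^+ 2] appears because [wick] counts
    each pair in both orders. *)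
Lemma odd_gaps_le_words n s : size s = n.*2 ->
  (b ^+ 2) ^+ odd_gaps (sort leq s) <= \sum_(cs <- words n.*2) wick b (zip s cs).
Proof.
move=> ss; have sS : size (sort leq s) = n.*2 by rewrite size_sort.
rewrite -(@wick_double_word 0 n _ (sort_sorted leq_total s) sS).
have /perm_map_lift[L' pL e] : perm_eq (unzip1 (zip (sort leq s) (double_word 0 n))) s.
  by rewrite unzip1_zip ?size_double_word ?sS // perm_sort.
rewrite (wick_perm _ pL) -[L']zip_unzip -/(unzip1 _) -/(unzip2 _) [unzip1 _]e.
have pw : perm_eq (double_word 0 n) (unzip2 L').
  rewrite -(@unzip2_zip _ _ (sort leq s) (double_word 0 n)) ?size_double_word ?sS //.
  exact: perm_map.
have wL : unzip2 L' \in words n.*2.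
  rewrite mem_words -(perm_size pw) size_double_word eqxx -(perm_all _ pw).
  rewrite -(perm_balanced pw) balanced_double_word andbT /=; apply/allP => d.
  by rewrite mem_double_word add0n -addnn => /andP[_ /leq_trans]; apply; rewrite leq_addr.
rewrite (big_rem _ wL) /= lerDl; apply: sumr_ge0 => cs _; exact: wick_ge0.
Qed.

End WordsFromPairings.

(** * Positions along closed walks *)

Section TupleSums.
Context (R : nmodType) (T : finType).

Lemma sum_tuple_cons n (F : seq T -> R) :
  \sum_(t : n.+1.-tuple T) F t = \sum_y \sum_(t : n.-tuple T) F (y :: t).
Proof.
rewrite pair_bigA /=.
rewrite (reindex (fun p : T * n.-tuple T => [tuple of p.1 :: p.2])) //=.
exists (fun t : n.+1.-tuple T => (thead t, [tuple of behead t])) => [[y t] _|t _] /=.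
  by congr pair; apply: val_inj.
by rewrite -tuple_eta.
Qed.

Lemma sum_tuple_rcons n (F : seq T -> R) :
  \sum_(t : n.+1.-tuple T) F t = \sum_(t : n.-tuple T) \sum_y F (rcons t y).
Proof.
elim: n F => [|n IH] F.
  rewrite sum_tuple_cons exchange_big /=; apply: eq_bigr => t _.
  by apply: eq_bigr => y _; rewrite tuple0.
rewrite sum_tuple_cons; under eq_bigr do rewrite (IH (fun t => F (_ :: t))).
by rewrite (sum_tuple_cons _ (fun t => \sum_y F (rcons t y))).
Qed.

Lemma sum_tuple_ffun n (F : seq T -> R) :
  \sum_(t : n.-tuple T) F t = \sum_(v : {ffun 'I_n -> T}) F (map v (enum 'I_n)).
Proof.
rewrite (reindex (fun v : {ffun 'I_n -> T} => map_tuple v (ord_tuple n))) /=.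
  by apply: eq_bigr => v _; rewrite enumT.
exists (fun t : n.-tuple T => [ffun i => tnth t i]) => [v _|t _].
  by apply/ffunP => i; rewrite ffunE tnth_map tnth_ord_tuple.
by apply: eq_from_tnth => i; rewrite tnth_map tnth_ord_tuple ffunE.
Qed.

End TupleSums.

Section WalkPositions.
Context (N : nat) (pos : 'I_N -> 'I_N -> nat).

Fixpoint trail (x : 'I_N) (s : seq 'I_N) : seq nat :=
  if s is y :: s' then pos x y :: trail y s' else [::].

Definition closed_pos (s : seq 'I_N) : seq nat :=
  if s is x :: s' then trail x (rcons s' x) else [::].

Lemma size_trail x s : size (trail x s) = size s.
Proof. by elim: s x => //= y s IH x; rewrite IH. Qed.

Lemma size_closed_pos s : size (closed_pos s) = size s.
Proof. by case: s => //= x s; rewrite size_trail size_rcons. Qed.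

Lemma map_lettered_pos_arcs (V : finType) (v : {ffun V -> 'I_N}) (u : seq (V * nat)) x c z :
  map (lettered_pos pos v) (arcs ((x, c) :: u) z) =
    zip (trail (v x) (rcons (map v (unzip1 u)) (v z))) (c :: unzip2 u).
Proof.
elim: u x c => [|[y d] u IH] x c //=.
by congr (_ :: _); have := IH y d.
Qed.

Lemma map_lettered_pos_closed (V : finType) (v : {ffun V -> 'I_N}) (u : seq (V * nat)) :
  map (lettered_pos pos v) (closed_arcs u) = zip (closed_pos (map v (unzip1 u))) (unzip2 u).
Proof. by case: u => [|[x c] u] //; rewrite map_lettered_pos_arcs. Qed.

Definition pops (st : seq 'I_N) y := if st is _ :: par :: _ then y == par else false.

Fixpoint pushes (st s : seq 'I_N) : seq nat :=
  if s is y :: s' then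
    if pops st y then pushes (step st y) s'
    else pos (head y st) y :: pushes (step st y) s'
  else [::].

Fixpoint stack_pos (st : seq 'I_N) : seq nat :=
  if st is x :: st' then
    (if st' is y :: _ then [:: pos x y] else [::]) ++ stack_pos st'
  else [::].

Lemma step_pops st y : step st y = if pops st y then behead st else y :: st.
Proof. by case: st => [|a [|p st]] //=; case: eqP => // ->. Qed.

Context (posC : forall x y, pos x y = pos y x).

(** A step that stores an arc puts its position on the stack; a step that cancels
    an arc meets the position on top of the stack a second time. *)
Lemma trail_pushes x st s :
  perm_eq (trail x s ++ stack_pos (run (x :: st) s))
          (pushes (x :: st) s ++ pushes (x :: st) s ++ stack_pos (x :: st)).
Proof.
elim: s x st => [|y s IH] x st //=.
case: st => [|p st] /=.
  have /= := IH y [:: x]; rewrite (posC y x) => h.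
  rewrite perm_cons; apply: perm_trans h _.
  by rewrite cats0 perm_cat2l perm_catC.
case: eqP => [->|_].
  have /= h := IH p st.
  rewrite -(perm_cons (pos x p)) in h; apply: perm_trans h _.
  by apply/permP => a; rewrite /= !count_cat /= ?count_cat; lia.
have /= h := IH y (x :: p :: st); rewrite perm_cons; apply: perm_trans h _.
by rewrite (posC y x); apply/permP => a; rewrite !count_cat /= !count_cat /= !count_cat; lia.
Qed.

Lemma closed_pos_pushes x s : run [:: x] (rcons s x) == [:: x] ->
  perm_eq (closed_pos (x :: s)) (pushes [:: x] (rcons s x) ++ pushes [:: x] (rcons s x)).
Proof.
by move=> /eqP r; have := trail_pushes x [::] (rcons s x); rewrite r /= !cats0.
Qed.

End WalkPositions.

(** * Reducible walks *)

(** [walk_count N j h] is the number of ways to continue for [j] steps a walk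
    whose reduction has [h] arcs, so that everything cancels at the end. *)
Fixpoint walk_count (N j h : nat) : nat :=
  if j is j'.+1 then
    if h is h'.+1 then (N.-1 * walk_count N j' h.+1 + walk_count N j' h')%N
    else (N * walk_count N j' 1)%N
  else (h == 0)%N.

Section CountWalks.
Context (R : realFieldType) (N : nat) (pos : 'I_N -> 'I_N -> nat).
Context (posC : forall x y, pos x y = pos y x).
Context (posI : forall x y x' y', pos x y = pos x' y' ->
  (x = x' /\ y = y') \/ (x = y' /\ y = x')).
Context (b : R) (b0 : 0 <= b) (b1 : b < 1).
Implicit Types (st s : seq 'I_N) (x y : 'I_N).

Lemma run_head st y s : exists st', run (y :: st) s = last y s :: st'.
Proof.
elim: s y st => [|y' s IH] y st; first by exists st.
rewrite -[run _ _]/(run (step (y :: st) y') s).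
by have [st' ->] := step_head (y :: st) y'; apply: IH.
Qed.

(** One step of the recursions below: the parent is the only step that
    shortens the reduction. *)
Lemma sum_step (F : seq 'I_N -> R) x h st : size st = h.+1 -> last x st = x ->
  \sum_y F (step st y) =
    (if h is _.+1 then F (behead st) else 0) + \sum_(y | ~~ pops st y) F (y :: st).
Proof.
move=> sst lst; rewrite (bigID (pops st)) /=; congr (_ + _); last first.
  by apply: eq_bigr => y npop; rewrite step_pops (negPf npop).
case: h st sst lst => [|h] [|a [|p st]] //= _ _.
  by rewrite big_pred0.
by rewrite big_pred1_eq eqxx.
Qed.

Lemma card_not_pops st h : size st = h.+1 ->
  #|[pred y | ~~ pops st y]| = if h is _.+1 then N.-1 else N.
Proof.
case: h st => [|h] [|a [|p st]] //= _.
  by rewrite -[RHS]card_ord; apply: eq_card.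
by rewrite (cardC1 p) card_ord.
Qed.

Lemma sum_run_count j h st x : size st = h.+1 -> last x st = x ->
  \sum_(s : j.-tuple 'I_N) (run st s == [:: x])%:R = (walk_count N j h)%:R :> R.
Proof.
elim: j h st => [|j IH] h st sst lst.
  rewrite (eq_bigr (fun=> (h == 0%N)%:R)) => [|t _].
    by rewrite sumr_const card_tuple expn0.
  rewrite tuple0 /=; case: h st sst lst => [|h] [|a [|p st]] //=.
    by move=> _ ->; rewrite eqxx.
  by rewrite !eqseq_cons andbF.
rewrite (sum_tuple_cons _ (fun s => (run st s == [:: x])%:R)) /=.
rewrite (sum_step (fun st' => \sum_(t : j.-tuple 'I_N) (run st' t == [:: x])%:R) sst lst).
have -> : \sum_(y | ~~ pops st y) \sum_(t : j.-tuple 'I_N) (run (y :: st) t == [:: x])%:R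
    = (\sum_(y | ~~ pops st y) 1) * (walk_count N j h.+1)%:R :> R.
  rewrite mulr_suml; apply: eq_bigr => y _; rewrite mul1r.
  by apply: IH => /=; [rewrite sst | case: (st) sst lst].
rewrite sumr_const (card_not_pops sst).
case: h sst => [|h] sst; first by rewrite add0r -natrM.
rewrite (IH h) ?size_behead ?sst //; last by case: (st) sst lst => [|? [|? ?]].
by rewrite addrC -natrM -natrD.
Qed.

Fixpoint pair_weight (L : seq nat) : R :=
  if L is p :: L' then \sum_(q <- L') b ^+ ndist p q + pair_weight L' else 0.

Lemma pair_weight_ge0 L : 0 <= pair_weight L.
Proof.
by elim: L => //= p L IH; rewrite addr_ge0 // sumr_ge0 // => *; apply: exprn_ge0.
Qed.

(** The weights of the pairs with at least one position in [M], that is the part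
    of the pair weight of [L ++ M] which is not yet present in [L]. *)
Definition new_weight (L M : seq nat) : R :=
  \sum_(p <- L) \sum_(q <- M) b ^+ ndist q p + pair_weight M.

Lemma new_weight_cons L p M :
  new_weight L (p :: M) = \sum_(q <- L) b ^+ ndist p q + new_weight (p :: L) M.
Proof.
rewrite /new_weight /= !big_cons; under eq_bigr do rewrite big_cons.
rewrite big_split /= -!addrA; congr (_ + _); rewrite addrCA; congr (_ + _).
by congr (_ + _); apply: eq_bigr => q _; rewrite ndistC.
Qed.

Context (sq : R) (sq1 : 1 <= sq) (sqE : sq ^+ 2 = N%:R).

Let sq0 : 0 <= sq. Proof. exact: le_trans ler01 sq1. Qed.

(** Multiplied by the powers of [sq], the two terms of the recursion are of the
    same size; whence a factor 2 per step. *)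
Lemma walk_count_le j h : (walk_count N j h)%:R * sq ^+ h <= 2 ^+ j * sq ^+ j.
Proof.
elim: j h => [|j IH] h /=.
  by case: h => [|h]; rewrite !expr0 ?mul1r ?mul0r //= ?mulr1 ler01.
have up M : (M <= N)%N ->
    (M * walk_count N j h.+1)%:R * sq ^+ h <= 2 ^+ j * sq ^+ j.+1.
  move=> MN; apply: (@le_trans _ _ (N%:R * (walk_count N j h.+1)%:R * sq ^+ h)).
    by rewrite natrM; do 2![apply: ler_wpM2r; rewrite ?exprn_ge0 //]; rewrite ler_nat.
  rewrite -sqE expr2 [leLHS](_ : _ = sq * ((walk_count N j h.+1)%:R * sq ^+ h.+1)).
    by rewrite [sq ^+ j.+1]exprS [leRHS]mulrCA; apply: ler_wpM2l.
  by rewrite exprS; ring.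
have two : 2 ^+ j * sq ^+ j.+1 <= 2 ^+ j.+1 * sq ^+ j.+1.
  by apply: ler_wpM2r; rewrite ?exprn_ge0 // exprS ler_peMl ?exprn_ge0 // ler1n.
case: h up => [|h] up; first exact: le_trans (up N (leqnn N)) two.
have -> : 2 ^+ j.+1 * sq ^+ j.+1 = 2 ^+ j * sq ^+ j.+1 + sq * (2 ^+ j * sq ^+ j).
  by rewrite !exprS; ring.
rewrite natrD mulrDl; apply: lerD; first exact: up (leq_pred N).
by rewrite [sq ^+ h.+1]exprS [leLHS]mulrCA; apply: ler_wpM2l.
Qed.

(** The constant of [sum_run_weight], defined by the recursion of its proof. What
    matters is that it does not depend on [N]. *)
Fixpoint weight_bound (K : R) (j l : nat) : R :=
  if j is j'.+1 then
    l%:R * K * 2 ^+ j' + weight_bound K j' l.+1 + weight_bound K j' l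
  else 0.

Local Notation K := (nbhd_mass b).

Lemma weight_bound_ge0 j l : 0 <= weight_bound K j l.
Proof.
have K0 : 0 <= K by apply: le_trans ler01 (nbhd_mass_ge1 b0 b1).
elim: j l => // j IH l /=; rewrite !addr_ge0 //.
by apply: mulr_ge0; [apply: mulr_ge0 | apply: exprn_ge0].
Qed.

(** A newly stored position forms a pair with each of those in [L], and the sum of
    the weights of these pairs over the [N] possible new vertices is at most
    [size L * K]. This is why two more powers of [sq] appear on the left than in
    the count of the walks themselves. *)
Lemma sum_run_weight j h st x L : size st = h.+1 -> last x st = x ->
  (\sum_(s : j.-tuple 'I_N) (run st s == [:: x])%:R * new_weight L (pushes pos st s))
    * sq ^+ h.+2 <= weight_bound K j (size L) * sq ^+ j.
Proof.
elim: j h st L => [|j IH] h st L sst lst.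
  rewrite big1 ?mul0r // => t _; rewrite tuple0 /= /new_weight /=.
  by rewrite big1 ?addr0 ?mulr0 // => p _; rewrite big_nil.
rewrite (sum_tuple_cons _ (fun s => (run st s == [:: x])%:R * new_weight L (pushes pos st s))).
rewrite (bigID (pops st)) /= mulrDl [leRHS]mulrDl addrC; apply: lerD; last first.
  case: h st sst lst => [|h] [|a [|p st]] //= sst lst.
    by rewrite big_pred0 // mul0r mulr_ge0 ?weight_bound_ge0 ?exprn_ge0.
  rewrite big_pred1_eq /= !eqxx exprS [leLHS]mulrCA [sq ^+ j.+1]exprS [leRHS]mulrCA.
  apply: ler_wpM2l => //; have := IH h (p :: st) L; apply=> //.
  by case: sst => /= ->.
pose cnt st := \sum_(s : j.-tuple 'I_N) (run st s == [:: x])%:R : R.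
pose T st L := \sum_(s : j.-tuple 'I_N) (run st s == [:: x])%:R * new_weight L (pushes pos st s).
rewrite (eq_bigr (fun y => (\sum_(q <- L) b ^+ ndist (pos (head y st) y) q) * cnt (y :: st)
   + T (y :: st) (pos (head y st) y :: L))); last first.
  move=> y npop; rewrite /cnt /T mulr_sumr -big_split /=; apply: eq_bigr => t _.
  rewrite (negPf npop) step_pops (negPf npop) new_weight_cons mulrDr.
  by rewrite [_%:R * \sum_(_ <- _) _]mulrC.
rewrite big_split /= mulrDl [leRHS]mulrDl; apply: lerD.
  apply: (@le_trans _ _ ((size L)%:R * K * ((walk_count N j h.+1)%:R * sq ^+ h.+2))).
    rewrite mulrA; apply: ler_wpM2r; first exact: exprn_ge0.
    rewrite (eq_bigr (fun y => (\sum_(q <- L) b ^+ ndist (pos (head y st) y) q)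
       * (walk_count N j h.+1)%:R)); last first.
      move=> y _; congr (_ * _); apply: sum_run_count => /=; first by rewrite sst.
      by case: (st) sst lst.
    rewrite -mulr_suml; apply: ler_wpM2r => //.
    rewrite exchange_big /= mulr_natl -sum1_size -sumrMnr; apply: ler_sum => p _.
    rewrite mulr1n; case: st sst {lst} => [|a st] //= _.
    apply: le_trans (pos_row_sum posI b0 b1 a p).
    rewrite [leRHS](bigID (fun y => ~~ pops (a :: st) y)) /= lerDl.
    by apply: sumr_ge0 => *; apply: exprn_ge0.
  rewrite -[leRHS]mulrA; apply: ler_wpM2l.
    by rewrite mulr_ge0 // (le_trans ler01 (nbhd_mass_ge1 b0 b1)).
  rewrite exprS [leLHS]mulrCA [sq ^+ j.+1]exprS [leRHS]mulrCA; apply: ler_wpM2l => //.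
  exact: walk_count_le.
have sq_gt0 : 0 < sq := lt_le_trans ltr01 sq1.
rewrite -(ler_pM2r sq_gt0) -mulrA -exprSr -[leRHS]mulrA -exprSr.
apply: (@le_trans _ _ (\sum_(y : 'I_N) weight_bound K j (size L).+1 * sq ^+ j)).
  rewrite mulr_suml [leRHS](bigID (fun y => ~~ pops st y)) /= -[leLHS]addr0.
  apply: lerD; last first.
    by apply: sumr_ge0 => *; rewrite mulr_ge0 ?weight_bound_ge0 ?exprn_ge0.
  apply: ler_sum => y _; apply: (IH h.+1 (y :: st) (pos (head y st) y :: L)).
    by rewrite /= sst.
  by case: (st) sst lst.
rewrite sumr_const card_ord -mulr_natl -sqE mulrCA -exprD add2n.
exact: lexx.
Qed.

(** The vertex reached by a reducible walk after its last step is the one where it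
    started, so that the closing step may be summed over freely. *)
Lemma sum_reducible (F : seq 'I_N -> seq 'I_N -> R) k :
  \sum_(s : k.+1.-tuple 'I_N)
     (if tval s is x :: s' then (reducible s)%:R * F [:: x] (rcons s' x) else 0) =
  \sum_x \sum_(s : k.+1.-tuple 'I_N) (run [:: x] s == [:: x])%:R * F [:: x] s.
Proof.
rewrite (sum_tuple_cons _ (fun s : seq 'I_N =>
  if s is x :: s' then (reducible s)%:R * F [:: x] (rcons s' x) else 0)).
apply: eq_bigr => x _.
rewrite (sum_tuple_rcons _ (fun s => (run [:: x] s == [:: x])%:R * F [:: x] s)).
apply: eq_bigr => s _; rewrite (bigD1 x) //= [X in _ + X]big1 ?addr0 // => y yx.
have [st' ->] := run_head [::] x (rcons s y).
rewrite last_rcons (_ : (_ == _) = false) ?mul0r //.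
by apply: contraNF yx => /eqP[->].
Qed.

Lemma count_reducible k :
  \sum_(s : k.+1.-tuple 'I_N) (reducible s)%:R = N%:R * (walk_count N k.+1 0)%:R :> R.
Proof.
transitivity (\sum_x \sum_(s : k.+1.-tuple 'I_N) (run [:: x] s == [:: x])%:R * 1 : R).
  rewrite -(sum_reducible (fun _ _ => 1)); apply: eq_bigr => s _.
  by case: s => -[|x s] //= _; rewrite mulr1.
rewrite (eq_bigr (fun=> (walk_count N k.+1 0)%:R)) => [|x _].
  by rewrite sumr_const card_ord mulr_natl.
under eq_bigr do rewrite mulr1.
exact: sum_run_count.
Qed.

Definition walk_pushes (s : seq 'I_N) : seq nat :=
  if s is x :: s' then pushes pos [:: x] (rcons s' x) else [::].

Lemma sum_reducible_weight k :
  (\sum_(s : k.+1.-tuple 'I_N) (reducible s)%:R * pair_weight (walk_pushes s)) * sq ^+ 2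
    <= N%:R * (weight_bound K k.+1 0 * sq ^+ k.+1).
Proof.
have -> : \sum_(s : k.+1.-tuple 'I_N) (reducible s)%:R * pair_weight (walk_pushes s) =
    \sum_x \sum_(s : k.+1.-tuple 'I_N) (run [:: x] s == [:: x])%:R * pair_weight (pushes pos [:: x] s).
  rewrite -(sum_reducible (fun st s => pair_weight (pushes pos st s))); apply: eq_bigr => s _.
  by case: s => -[|x s].
rewrite mulr_suml mulr_natl -[X in _ *+ X]card_ord -sumr_const; apply: ler_sum => x _.
apply: le_trans (@sum_run_weight k.+1 0 [:: x] x [::] erefl erefl).
apply: ler_wpM2r; first exact: exprn_ge0.
by apply: ler_sum => s _; rewrite /new_weight big_nil add0r.
Qed.

End CountWalks.

(** * Two linked walks *)

Lemma arcs_split (A : eqType) (w : seq (A * nat)) z e : e \in arcs w z ->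
  exists u1 x c u2, w = u1 ++ (x, c) :: u2 /\ e = ((x, head z (unzip1 u2)), c).
Proof.
elim: w => //= -[x c] u IH; rewrite inE => /orP[/eqP ->|/IH].
  by exists [::], x, c, u.
by case=> u1 [x' [c' [u2 [-> ->]]]]; exists ((x, c) :: u1), x', c', u2.
Qed.

(** A closed walk may be started at any of its arcs. *)
Lemma closed_arcs_rot (A : eqType) (w : seq (A * nat)) e : e \in closed_arcs w ->
  exists x c u, [/\ perm_eq w ((x, c) :: u), e = ((x, head x (unzip1 u)), c) &
    perm_eq (closed_arcs w) (e :: arcs u x)].
Proof.
case: w => // -[x0 c0] w0 e_in; set w := _ :: w0 in e_in *.
have [u1 [x [c [u2 [wE eE]]]]] := arcs_split (e_in : e \in arcs w x0).
exists x, c, (u2 ++ u1); have x0E : x0 = head x (unzip1 u1).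
  by case: (u1) wE => [|[? ?] ?] [] -> //.
split.
- by rewrite wE perm_catC.
- rewrite eE x0E; congr ((_, _), _).
  by case: (u2) => [|[? ?] ?]; case: (u1) => [|[? ?] ?].
- rewrite -[closed_arcs w]/(arcs w x0) wE arcs_cat /= -eE perm_catC /= perm_cons.
  by rewrite arcs_cat x0E.
Qed.

Section TwoWalks.
Context (R : realFieldType) (V : finType) (N : nat) (pos : 'I_N -> 'I_N -> nat).
Context (posC : forall x y, pos x y = pos y x).
Context (posI : forall x y x' y', pos x y = pos x' y' ->
  (x = x' /\ y = y') \/ (x = y' /\ y = x')).
Context (b : R) (b0 : 0 <= b) (b1 : b < 1).
Implicit Types (v : {ffun V -> 'I_N}) (u t : seq (V * nat)).

Local Notation K := (nbhd_mass b).
Local Notation q := (arc_cost N b).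
Local Notation wickE := (arcs_wick pos b).
Local Notation lpos := (lettered_pos pos).
Local Notation epos := (arc_pos pos).
Local Notation total := (#|{ffun V -> 'I_N}|%:R : R).

(** Both walks are rotated so as to start with the linked arcs [e] and [f]. Three
    arcs are discarded from the Wick weight: [e], [f], and the arc after [f].
    The rest of the second walk is explored first; then [f] has both ends free
    and is tied to [e] by the link, which costs a factor of order [q ^+ 2]; what
    remains of the first walk is an open path. Since there are at most [k]
    letters, at least [k - 1] factors [q] result. *)
Lemma linked_walks_sum k u t e f : (q <= 1) -> size u = k -> size t = k ->
  uniq (unzip1 (u ++ t)) -> balanced (unzip2 (u ++ t)) ->
  e \in closed_arcs u -> f \in closed_arcs t ->
  \sum_v b ^+ ndist (epos v e.1) (epos v f.1) *
     wickE v (closed_arcs u ++ closed_arcs t) <= 2 * q ^+ k.-1 * total.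
Proof.
move=> q1 su st uut but eu ft; have q0 : 0 <= q := arc_cost_ge0 N b0 b1.
have [x [c [u' [pu eE pcu]]]] := closed_arcs_rot eu.
have [y [d [t' [pt fE pct]]]] := closed_arcs_rot ft.
case: t' => [|[y' d'] t'] in pt fE pct *.
  have -> : k.-1 = 0%N by rewrite -st (perm_size pt).
  rewrite expr0 mulr1 -[2 * total]mulrC -[total * 2]sumE_const; apply: ler_sum => v _.
  apply: (@le_trans _ _ (1 * 1)); last by rewrite mulr1 ler1n.
  by apply: ler_pM; rewrite ?arcs_wick_ge0 ?wfactor_ge0 ?wfactor_le1 ?wick_le1.
have pall : perm_eq (u ++ t) (((x, c) :: u') ++ [:: (y, d), (y', d') & t']).
  by rewrite perm_cat.
have uall : uniq ((x :: unzip1 u') ++ [:: y, y' & unzip1 t']).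
  by move: uut; rewrite /unzip1 (perm_uniq (perm_map fst pall)) map_cat.
move: uall; rewrite cat_uniq => /and3P[xuu disj yyt].
have /andP[xu uu'] := xuu; have /and3P[yt y't ut'] := yyt.
have {yt yyt}/norP[yy' yt] : ~~ ((y == y') || (y \in unzip1 t')) by rewrite -in_cons.
have away z : z \in [:: y, y' & unzip1 t'] -> z != x /\ z \notin unzip1 u'.
  by move=> zt; move/hasPn/(_ z zt): disj; rewrite /= inE negb_or => /andP[].
have avo z : z \in [:: y, y' & unzip1 t'] -> all (avoids z) (arcs u' x).
  by move=> /away[zx zu]; apply: arcs_avoid.
have eavo z : z \in [:: y, y' & unzip1 t'] -> avoids z e.
  move=> /away[zx zu]; rewrite eE /avoids /= zx /=.
  by case: (u') zu => [|[a ?] ?] //=; rewrite inE negb_or => /andP[].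
have f1E : f.1 = (y, y') by rewrite fE.
pose G v := b ^+ ndist (epos v e.1) (epos v f.1).
have G0 v : 0 <= G v by apply: wfactor_ge0.
have fold_e z v w : avoids z e -> epos (relabel v z w) e.1 = epos v e.1.
  by move=> /(lettered_pos_relabel pos v w)/(congr1 fst).
apply: (@le_trans _ _ (\sum_v G v * wickE v (arcs t' y ++ arcs u' x))).
  apply: ler_sum => v _; apply: ler_wpM2l; first exact: G0.
  have pE : perm_eq (closed_arcs u ++ closed_arcs t)
      (e :: f :: (y', head y (unzip1 t'), d') :: arcs t' y ++ arcs u' x).
    apply: (perm_trans (perm_cat pcu pct)); rewrite /= perm_cons perm_catC /= !perm_cons.
    by [].
  rewrite (@arcs_wick_perm R V N pos b v _ _ pE).
  by do 3![apply: le_trans (@arcs_wick_cons R V N pos b b0 b1 v _ _) _].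
have uyt : uniq (y :: unzip1 t') by rewrite cons_uniq yt.
have step1 := @explore_path R V N pos posC posI b b0 b1 t' y (arcs u' x) G uyt.
apply: le_trans (step1 _ _ G0) _.
- by move=> z zt; apply: avo; rewrite !inE zt !orbT.
- move=> z zt v w; rewrite /G fold_e; last by apply: eavo; rewrite !inE zt !orbT.
  congr (b ^+ ndist _ _); rewrite f1E /arc_pos /= !relabel_other //.
    by apply: contraNneq y't => ->.
  by apply: contraNneq yt => ->.
have step2 : \sum_v G v * wickE v (arcs u' x) <= 2 * q ^+ 2 * \sum_v wickE v (arcs u' x).
  apply: (@le_trans _ _ (2 * K / N%:R ^+ 2 * \sum_v wickE v (arcs u' x))); last first.
    apply: ler_wpM2r; first by apply: sumr_ge0 => v _; apply: arcs_wick_ge0.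
    exact: arc_cost_sqr_ge.
  under eq_bigr do rewrite mulrC.
  apply: (@sum_peel2 _ _ _ _ _ y y').
  - by apply/arcs_wick_free/avo; rewrite mem_head.
  - by apply/arcs_wick_free/avo; rewrite !inE eqxx orbT.
  - by move=> v; apply: arcs_wick_ge0.
  move=> v; rewrite /G f1E.
  under eq_bigr => z _. under eq_bigr => z' _.
    rewrite fold_e; last by apply: eavo; rewrite mem_head.
    rewrite fold_e; last by apply: eavo; rewrite !inE eqxx orbT.
    rewrite ndistC.
    over.
  over.
  by apply: (arc_pos_relabel2_sum posI b0 b1); rewrite eq_sym.
have step3 : \sum_v wickE v (arcs u' x) <=
    q ^+ (size u' - size (undup (unzip2 u'))) * total.
  exact: explore_open.
rewrite arcs_letters.
set a := size (undup (unzip2 u')) in step3 *; set m := size (undup (_ ++ _)).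
apply: (@le_trans _ _ (q ^+ (size t' + a - m) * (2 * q ^+ 2 * (q ^+ (size u' - a) * total)))).
  apply: ler_wpM2l; first exact: exprn_ge0.
  by apply: le_trans step2 _; apply: ler_wpM2l step3; rewrite mulr_ge0 ?exprn_ge0.
have -> : q ^+ (size t' + a - m) * (2 * q ^+ 2 * (q ^+ (size u' - a) * total)) =
   2 * q ^+ (size t' + a - m + 2 + (size u' - a)) * total by rewrite !exprD; ring.
apply: ler_wpM2r; first exact: ler0n.
apply: ler_wpM2l => //; apply: ler_wiXn2l => //.
have ma : (m <= size t' + a)%N.
  by have := size_undup_cat (unzip2 t') (unzip2 u'); rewrite size_map.
have au : (a <= size u')%N by have := size_undup (unzip2 u'); rewrite size_map.
have mk : (m <= k)%N.
  have := balanced_size but; rewrite size_map size_cat su st addnn => /double_inj ->.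
  apply: uniq_leq_size; first exact: undup_uniq.
  move=> z; rewrite !mem_undup (perm_mem (perm_map snd pall)) map_cat /=.
  rewrite !mem_cat => h; rewrite inE mem_cat !inE.
  case/orP: h => h; apply/orP; right; apply/orP; [right|by left].
  by do 2![apply/orP; right].
have sk : size t' = k.-2 /\ size u' = k.-1 /\ (1 < k)%N.
  by rewrite -{1 3}st -{1}su (perm_size pt) (perm_size pu).
clear -ma au mk sk; case: sk => ->  [-> k1]; lia.
Qed.

End TwoWalks.

Section TupleSplit.
Context (R : nmodType) (T : finType).

Lemma sum_tuple_cat m n (F : seq T -> seq T -> R) :
  \sum_(w : (m + n).-tuple T) F (take m w) (drop m w) =
  \sum_(s : m.-tuple T) \sum_(t : n.-tuple T) F s t.
Proof.
elim: m F => [|m IH] F.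
  transitivity (\sum_(t : n.-tuple T) F [::] t).
    by apply: eq_bigr => w _; rewrite take0 drop0.
  rewrite [RHS](eq_bigr (fun=> \sum_(t : n.-tuple T) F [::] t)) => [|s _].
    by rewrite sumr_const card_tuple expn0.
  by rewrite tuple0.
rewrite (sum_tuple_cons _ (fun w => F (take m.+1 w) (drop m.+1 w))).
rewrite (sum_tuple_cons _ (fun s => \sum_(t : n.-tuple T) F s t)).
by apply: eq_bigr => y _; rewrite -(IH (fun s => F (y :: s))).
Qed.

End TupleSplit.


(** * Consequences of the filling condition *)

Section FillingPositions.
Context (N : nat) (phi : filling N).

Lemma fill_posC i j : fill_pos phi i j = fill_pos phi j i.
Proof.
rewrite /fill_pos; congr (nat_of_ord (fill_inv _ _)); apply: val_inj => /=.
rewrite /sort_pair; case: ltngtP => // /val_inj ->.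
by [].
Qed.

Lemma fill_posI i j i' j' : fill_pos phi i j = fill_pos phi i' j' ->
  (i = i' /\ j = j') \/ (i = j' /\ j = i').
Proof.
move=> /val_inj /(can_inj (fill_invK phi)) /(congr1 val) /=.
rewrite /sort_pair; case: ifP => _; case: ifP => _ [-> ->]; by [left | right].
Qed.

End FillingPositions.

Section Sparsity.
Context (R : realType) (phi : forall N, filling N).
Context (b : R) (b0 : 0 <= b) (b1 : b < 1).

Lemma near_forall_lt (Q : nat -> nat -> Prop) m :
  (forall n, (n < m)%N -> \forall N \near \oo, Q n N) ->
  \forall N \near \oo, forall n, (n < m)%N -> Q n N.
Proof.
elim: m => [|m IH] H; first by near=> N.
have h1 : \forall N \near \oo, forall n, (n < m)%N -> Q n N.
  by apply: IH => n nm; apply: H; rewrite ltnS ltnW.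
have h2 := H m (ltnSn m).
near=> N => n; rewrite ltnS leq_eqVlt => /orP[/eqP ->|].
  by near: N.
by move: n; near: N.
Unshelve. all: by end_near. Qed.

Lemma expr_small (e : R) : 0 < e -> exists n, b ^+ n <= e.
Proof.
move=> e0; have /cvgrPdist_le/(_ e e0) : b ^+ n @[n --> \oo] --> (0 : R).
  by apply: cvg_expr; rewrite ger0_norm.
case=> n _ /(_ n (leqnn n)) /=; rewrite sub0r normrN ger0_norm ?exprn_ge0 // => h.
by exists n.
Qed.

(** Terms at distance at least [n0] are at most [b ^+ n0] each, and each of the
    smaller distances is rare; distance 0 does not occur, since the two arcs
    have distinct positions. *)
Lemma filling_sparse (delta : R) : filling_condition R phi -> 0 < delta ->
  \forall N \near \oo, forall i j : 'I_N, i != j ->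
    \sum_x b ^+ ndist (fill_pos (phi N) i x) (fill_pos (phi N) x j) <= delta * N%:R.
Proof.
move=> F d0; have [n0 hn0] := expr_small (divr_gt0 d0 (ltr0n R 2)).
have e0 : 0 < delta / 2 / n0.+1%:R by rewrite !divr_gt0.
have [Q hQ] : exists Q : nat -> nat -> Prop, Q = fun n N => (1 <= n)%N -> forall i j : 'I_N,
      #|[pred x : 'I_N | fill_dist (phi N) (i, x) (x, j) == n]|%:R
        <= delta / 2 / n0.+1%:R * N%:R by eexists.
have : \forall N \near \oo, forall n, (n < n0)%N -> Q n N.
  apply: near_forall_lt => n _; rewrite hQ; case: n => [|n]; first by near=> N.
  have := F n.+1 isT _ e0; apply: filterS => N h _; exact: h.
apply: filterS => N; rewrite hQ => {Q hQ} cnt i j ij.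
pose D x := ndist (fill_pos (phi N) i x) (fill_pos (phi N) x j).
have D_pos x : (0 < D x)%N.
  rewrite lt0n; apply: contra_neq ij => D0.
  have : fill_pos (phi N) i x = fill_pos (phi N) x j by move: D0; rewrite /D /ndist; lia.
  by case/fill_posI => -[-> //]; move=> ->.
have bound x : b ^+ D x <= delta / 2 + \sum_(n < n0) (D x == n)%:R.
  case: (ltnP (D x) n0) => Dn.
    rewrite (bigD1 (Ordinal Dn)) //= eqxx addrCA ler_wpDr //.
      by rewrite addr_ge0 ?sumr_ge0 // divr_ge0 // ltW.
    by rewrite exprn_ile1 // ltW.
  apply: (@le_trans _ _ (delta / 2)); last by rewrite lerDl sumr_ge0.
  by apply: le_trans hn0; apply: ler_wiXn2l => //; apply: ltW.
apply: (@le_trans _ _ (\sum_x (delta / 2 + \sum_(n < n0) (D x == n)%:R))).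
  by apply: ler_sum => x _; exact: bound.
rewrite big_split /= sumr_const card_ord exchange_big /=.
rewrite [leRHS](_ : _ = delta / 2 * N%:R + delta / 2 * N%:R); last by field.
apply: lerD; first by rewrite mulr_natr.
apply: (@le_trans _ _ (\sum_(n < n0) delta / 2 / n0.+1%:R * N%:R)).
  apply: ler_sum => n _; case: (posnP n) => [n_0|n_pos].
    rewrite big1 ?mulr_ge0 ?divr_ge0 // ?ltW // => x _.
    by rewrite n_0; have := D_pos x; case: (D x).
  apply: le_trans (cnt n (ltn_ord n) n_pos i j).
  rewrite -sum1_card natr_sum [leRHS]big_mkcond /=; apply: ler_sum => x _.
  by rewrite inE /fill_dist /= -ndistE -/(D x); case: ifP.
rewrite sumr_const card_ord -[leLHS]mulr_natr.
have n0N : (n0.+1%:R : R) != 0 by rewrite pnatr_eq0.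
rewrite [leLHS](_ : _ = delta / 2 * (n0%:R / n0.+1%:R) * N%:R); last by field.
apply: ler_wpM2r; first exact: ler0n.
rewrite ler_piMr ?(ltW (divr_gt0 _ _)) // ler_pdivrMr ?ltr0n // mul1r ler_nat.
exact: leqnSn.
Unshelve. all: by end_near. Qed.

Lemma invn_cvg0 : (N%:R : R)^-1 @[N --> \oo] --> (0 : R).
Proof.
apply/cvgrPdist_le => e e0; near=> N.
rewrite sub0r normrN ger0_norm ?invr_ge0 //.
rewrite invf_ple ?posrE //; last by rewrite ltr0n; near: N; exact: nbhs_infty_gt.
by near: N; exact: nbhs_infty_ger.
Unshelve. all: by end_near. Qed.

Lemma arc_cost_cvg0 : arc_cost N b @[N --> \oo] --> (0 : R).
Proof. by rewrite -(mulr0 (nbhd_mass b)); apply: cvgMr; exact: invn_cvg0. Qed.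

End Sparsity.


(** * Limits of the normalised sums over walks *)

Section DeterministicLimits.
Context (R : realType) (phi : forall N, filling N).
Context (Fphi : filling_condition R phi).
Context (E : seq nat -> R).
Context (E_perm : forall s t, perm_eq s t -> E s = E t).
Context (E_odd : forall s, odd (size s) -> E s = 0).

(** The three consequences of the moment conditions that the combinatorics
    uses, for words of a fixed length. *)
Definition word_bound n (C b : R) := forall s, size s = n.*2 ->
  `|E s| <= C * \sum_(cs <- words n.*2) wick b (zip s cs).
Definition square_bound n (C b : R) := forall L, size L = n ->
  `|E (L ++ L) - 1| <= C * pair_weight b L.
Definition covariance_bound k (C b : R) := forall s t, size s = k -> size t = k ->
  `|E (s ++ t) - E s * E t| <=
    C * ((\sum_(p <- s) \sum_(r <- t) b ^+ ndist p r) *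
         \sum_(cs <- words (k + k)) wick b (zip (s ++ t) cs)).
Definition with_constants (H : R -> R -> Prop) :=
  exists C b : R, [/\ 0 <= C, 0 <= b, b < 1 & H C b].

Local Notation cpos N := (closed_pos (fill_pos (phi N))).
Local Notation sqn N := (Num.sqrt (N%:R : R)).

Lemma sqn2 N : sqn N ^+ 2 = N%:R.
Proof. by rewrite sqr_sqrtr. Qed.

Lemma sqn_double N n : sqn N ^+ n.*2 = N%:R ^+ n.
Proof. by rewrite -mul2n exprM sqn2. Qed.

Lemma total_card (V : finType) N : #|{ffun V -> 'I_N}|%:R = N%:R ^+ #|V| :> R.
Proof. by rewrite card_ffun card_ord natrX. Qed.

Lemma zip_enum_props k (cs : seq nat) : size cs = k ->
  let u := zip (enum 'I_k) cs in
  [/\ unzip1 u = enum 'I_k, unzip2 u = cs, size u = k & uniq (unzip1 u)].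
Proof.
move=> scs u; have se : size (enum 'I_k) = size cs by rewrite size_enum_ord.
have u1 : unzip1 u = enum 'I_k by rewrite unzip1_zip ?se.
split => //; first by rewrite unzip2_zip ?se.
  by rewrite size_zip se minnn.
by rewrite u1 enum_uniq.
Qed.

(** Irreducible walks are summed word by word. *)
Lemma irreducible_total n C b delta N : (0 < n)%N -> 0 <= C -> 0 <= b -> b < 1 ->
  word_bound n C b -> arc_cost N b <= delta ->
  (forall i j : 'I_N, i != j ->
    \sum_x b ^+ ndist (fill_pos (phi N) i x) (fill_pos (phi N) x j) <= delta * N%:R) ->
  \sum_(s : n.*2.-tuple 'I_N) (~~ reducible s)%:R * `|E (cpos N s)| <=
    C * (size (words n.*2))%:R *
      ((n.*2)%:R * delta * nbhd_mass b ^+ n.-1 * N%:R ^+ n.+1).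
Proof.
move=> n0 C0 b0 b1 wb qd sp.
have [->|N0] := posnP N.
  rewrite big_pred0 ?expr0n ?mulr0 // => s; exfalso.
  by case: s => -[|[? //] s]; case: (n) n0.
apply: (@le_trans _ _ (\sum_(s : n.*2.-tuple 'I_N) \sum_(cs <- words n.*2)
   C * ((~~ reducible s)%:R * wick b (zip (cpos N s) cs)))).
  apply: ler_sum => s _; rewrite -mulr_sumr -mulr_sumr mulrCA; apply: ler_wpM2l => //.
  by apply: wb; rewrite size_closed_pos size_tuple.
rewrite exchange_big /= -mulrA -sum1_size natr_sum mulr_suml mulr_sumr.
rewrite big_seq [leRHS]big_seq; apply: ler_sum => cs.
rewrite mem_words => /and3P[/eqP scs _ bcs].
rewrite -mulr_sumr mul1r; apply: ler_wpM2l => //.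
rewrite (sum_tuple_ffun _ (fun s => (~~ reducible s)%:R * wick b (zip (cpos N s) cs))).
have [u1 u2 su uu] := zip_enum_props scs; set u := zip _ _ in u1 u2 su uu.
have := irreducible_wick_sum (fill_posC (phi N)) (@fill_posI N (phi N)) b0 b1 qd sp uu su.
rewrite u2 => /(_ bcs).
rewrite (eq_bigr (fun v : {ffun 'I_n.*2 -> 'I_N} => (~~ reducible (map v (enum 'I_n.*2)))%:R *
     wick b (zip (cpos N (map v (enum 'I_n.*2))) cs))); last first.
  move=> v _; rewrite /irreducible_wick u1 mulrC; congr (_ * _).
  by rewrite /arcs_wick map_lettered_pos_closed u1 u2.
move=> /le_trans; apply.
rewrite total_card card_ord -!mulrA; do 2![apply: ler_wpM2l; rewrite ?ler0n //].
  exact: le_trans (arc_cost_ge0 N b0 b1) qd.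
rewrite /arc_cost expr_div_n -mulrA; apply: ler_wpM2l.
  by rewrite exprn_ge0 // (le_trans ler01) ?nbhd_mass_ge1.
rewrite ler_pdivrMl ?exprn_gt0 ?ltr0n // -exprD.
by rewrite -addSnnS prednK // addnn.
Qed.

Lemma reducible_total n C b N : 0 <= C -> 0 <= b -> b < 1 -> (0 < N)%N ->
  square_bound n.+1 C b ->
  `|\sum_(s : n.+1.*2.-tuple 'I_N) (reducible s)%:R * E (cpos N s)
     - N%:R * (walk_count N n.+1.*2 0)%:R| <=
  C * weight_bound (nbhd_mass b) n.+1.*2 0 * N%:R ^+ n.+1.
Proof.
move=> C0 b0 b1 N0 sb.
have N1 : 1 <= sqn N by rewrite -[leLHS]sqrtr1 ler_wsqrtr // ler1n.
have NR : (0 : R) < N%:R by rewrite ltr0n.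
rewrite -(count_reducible R N n.*2.+1) -sumrB.
apply: le_trans (ler_norm_sum _ _ _) _.
apply: (@le_trans _ _ (\sum_(s : n.+1.*2.-tuple 'I_N) C * ((reducible s)%:R *
    pair_weight b (walk_pushes (fill_pos (phi N)) s)))).
  apply: ler_sum => s _; have [red|nred] := boolP (reducible s); last first.
    by rewrite !mul0r subrr normr0 mulr0.
  rewrite !mul1r; have : size (tval s) = n.+1.*2 by rewrite size_tuple.
  case: (tval s) red => // x s' red ss.
  have pp := closed_pos_pushes (fill_posC (phi N)) red.
  rewrite (E_perm pp); apply: sb; apply: double_inj.
  by rewrite -ss -(size_closed_pos (fill_pos (phi N))) (perm_size pp) size_cat addnn.
rewrite -mulr_sumr -mulrA; apply: ler_wpM2l => //.
have := sum_reducible_weight (@fill_posI N (phi N)) b0 b1 N1 (sqn2 N) n.*2.+1.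
rewrite sqn2 -[_.+2]/(n.+1.*2) sqn_double mulrC ler_pM2l //.
Qed.

(** The limiting moments enter only through this recursion. *)
Context (m : nat -> nat -> R).
Context (m0 : forall h, m 0 h = (h == 0%N)%:R).
Context (mS0 : forall j, m j.+1 0 = m j 1).
Context (mSS : forall j h, m j.+1 h.+1 = m j h.+2 + m j h).

(** The recursion of [walk_count], with its [N.-1] against [N], becomes that of [m]
    in the limit. *)
Lemma walk_count_cvg j h :
  (walk_count N j h)%:R * sqn N ^+ h / sqn N ^+ j @[N --> \oo] --> m j h.
Proof.
elim: j h => [|j IH] h.
  rewrite m0; apply: cvg_near_cst; near=> N; rewrite expr0 divr1 /=.
  by case: h => [|h]; rewrite ?mul0r // expr0 mulr1.
have pos : \forall N \near \oo, (0 < N)%N by exact: nbhs_infty_gt.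
case: h => [|h].
  rewrite mS0; apply: cvg_trans (IH 1%N); apply: near_eq_cvg.
  apply: filterS pos => N N0 /=.
  have : sqn N != 0 by rewrite gt_eqF // sqrtr_gt0 ltr0n.
  move: (sqn N) (sqn2 N) => s sE s0; rewrite natrM -sE !exprS expr0.
  by field; rewrite s0 expf_neq0.
rewrite mSS.
have -> : m j h.+2 + m j h = (1 - 0) * m j h.+2 + m j h by rewrite subr0 mul1r.
have lim : (1 - N%:R^-1) * ((walk_count N j h.+2)%:R * sqn N ^+ h.+2 / sqn N ^+ j) +
    (walk_count N j h)%:R * sqn N ^+ h / sqn N ^+ j @[N --> \oo] -->
    (1 - 0) * m j h.+2 + m j h.
  apply: cvgD; last exact: IH.
  apply: cvgM; last exact: IH.
  by apply: cvgB; [exact: cvg_cst | exact: invn_cvg0].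
apply: cvg_trans lim; apply: near_eq_cvg.
apply: filterS pos => N N0 /=.
have : sqn N != 0 by rewrite gt_eqF // sqrtr_gt0 ltr0n.
have NE : (N.-1%:R : R) = N%:R - 1 by rewrite -subn1 natrB.
move: (sqn N) (sqn2 N) => s sE s0.
rewrite natrD natrM NE -sE !exprS expr0.
by field; rewrite s0 expf_neq0.
Unshelve. all: by end_near. Qed.

Lemma walk_count_odd N j h : odd (j + h) -> walk_count N j h = 0%N.
Proof.
elim: j h => [|j IH] [|h] //=.
  by rewrite addn0 => o; rewrite IH ?muln0 // addn1.
by rewrite addnS /= negbK => o; rewrite !IH ?muln0 ?addnS //= ?negbK.
Qed.

Lemma walk_mean_cvg k :
  (forall n, (0 < n)%N -> with_constants (word_bound n)) ->
  (forall n, (0 < n)%N -> with_constants (square_bound n)) ->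
  (0 < k)%N ->
  (\sum_(s : k.-tuple 'I_N) E (cpos N s)) / (N%:R * sqn N ^+ k) @[N --> \oo] --> m k 0.
Proof.
move=> WB SB k0.
have := @walk_count_cvg k 0; under eq_fun do rewrite expr0 mulr1.
move=> lim; suff diff : (\sum_(s : k.-tuple 'I_N) E (cpos N s)) / (N%:R * sqn N ^+ k)
    - (walk_count N k 0)%:R / sqn N ^+ k @[N --> \oo] --> (0 : R).
  rewrite -[m k 0]add0r; apply: cvg_trans (cvgD diff lim).
  by apply: near_eq_cvg; apply: nearW => N /=; rewrite subrK.
have [ok|ek] := boolP (odd k).
  apply: cvg_near_cst; near=> N.
  rewrite big1 => [|s _]; last by rewrite E_odd // size_closed_pos size_tuple.
  by rewrite walk_count_odd ?addn0 // !mul0r subrr.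
have [n kE] : exists n, k = n.+1.*2.
  clear -k0 ek; case: k k0 ek => [|[|k]] // _ ek; exists k./2.
  by rewrite -[LHS](even_halfK ek).
subst k; have [C1 [b [C10 b0 b1 wb]]] := WB n.+1 isT.
have [C2 [b' [C20 b'0 b'1 sb]]] := SB n.+1 isT.
pose A := C1 * (size (words n.+1.*2))%:R * ((n.+1.*2)%:R * nbhd_mass b ^+ n).
pose B := C2 * weight_bound (nbhd_mass b') n.+1.*2 0.
have A0 : 0 <= A.
  by rewrite !mulr_ge0 // exprn_ge0 // (le_trans ler01) ?nbhd_mass_ge1.
have B0 : 0 <= B by rewrite mulr_ge0 // weight_bound_ge0.
apply/cvgrPdist_le => e e0.
pose delta := e / 2 / (A + 1).
have A1 : 0 < A + 1 by rewrite ltr_wpDl.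
have d0 : 0 < delta by rewrite !divr_gt0.
have qd : \forall N \near \oo, arc_cost N b <= delta.
  have /cvgrPdist_le/(_ delta d0) := arc_cost_cvg0 b.
  by apply: filterS => N; rewrite sub0r normrN; apply: le_trans; exact: ler_norm.
have inv : \forall N \near \oo, B * N%:R^-1 <= e / 2.
  have : B * N%:R^-1 @[N --> \oo] --> B * 0 by apply: cvgMr; exact: invn_cvg0.
  rewrite mulr0 => /cvgrPdist_le/(_ _ (divr_gt0 e0 (ltr0n R 2))).
  by apply: filterS => N; rewrite sub0r normrN; apply: le_trans; exact: ler_norm.
have sp := filling_sparse b0 b1 Fphi d0.
near=> N.
have N0 : (0 < N)%N by near: N; exact: nbhs_infty_gt.
have NR : (0 : R) < N%:R by rewrite ltr0n.
rewrite sub0r normrN sqn_double.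
have den : 0 < N%:R * N%:R ^+ n.+1 :> R by rewrite mulr_gt0 ?exprn_gt0.
have -> : (\sum_(s : n.+1.*2.-tuple 'I_N) E (cpos N s)) / (N%:R * N%:R ^+ n.+1)
    - (walk_count N n.+1.*2 0)%:R / N%:R ^+ n.+1 =
  (\sum_(s : n.+1.*2.-tuple 'I_N) E (cpos N s) - N%:R * (walk_count N n.+1.*2 0)%:R)
     / (N%:R * N%:R ^+ n.+1).
  by field; rewrite expf_neq0 gt_eqF.
rewrite normrM normfV (gtr0_norm den) ler_pdivrMr //.
have -> : \sum_(s : n.+1.*2.-tuple 'I_N) E (cpos N s) =
  \sum_(s : n.+1.*2.-tuple 'I_N) (reducible s)%:R * E (cpos N s) +
  \sum_(s : n.+1.*2.-tuple 'I_N) (~~ reducible s)%:R * E (cpos N s).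
  rewrite -big_split /=; apply: eq_bigr => s _; rewrite -mulrDl.
  by case: (reducible s); rewrite ?addr0 ?add0r mul1r.
rewrite addrAC; apply: le_trans (ler_normD _ _) _.
apply: (@le_trans _ _ (B * N%:R ^+ n.+1 + A * delta * N%:R ^+ n.+2)).
  apply: lerD; first exact: reducible_total.
  apply: le_trans (ler_norm_sum _ _ _) _.
  under eq_bigr do rewrite normrM normr_nat.
  have h1 : arc_cost N b <= delta by near: N.
  have h2 : forall i j : 'I_N, i != j ->
    \sum_x b ^+ ndist (fill_pos (phi N) i x) (fill_pos (phi N) x j) <= delta * N%:R.
    by near: N.
  apply: le_trans (irreducible_total (ltn0Sn n) C10 b0 b1 wb h1 h2) _.
  by rewrite le_eqVlt; apply/orP; left; apply/eqP; rewrite /A; ring.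
rewrite -exprS [e]splitr mulrDl; apply: lerD.
  have hB : B * N%:R^-1 <= e / 2 by near: N.
  apply: (@le_trans _ _ (B * N%:R^-1 * N%:R ^+ n.+2)).
    by rewrite [N%:R ^+ n.+2]exprS mulrA mulfVK // gt_eqF.
  by apply: ler_wpM2r => //; rewrite exprn_ge0 // ler0n.
apply: ler_wpM2r; first by rewrite exprn_ge0 // ler0n.
rewrite /delta [A * _]mulrA ler_pdivrMr // [A * _]mulrC; apply: ler_wpM2l.
  by rewrite divr_ge0 // ltW.
by rewrite lerDl.
Unshelve. all: by end_near. Qed.

End DeterministicLimits.


Section CovarianceLimit.
Context (R : realType) (phi : forall N, filling N) (E : seq nat -> R).

Local Notation cpos N := (closed_pos (fill_pos (phi N))).
Local Notation sqn N := (Num.sqrt (N%:R : R)).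

Lemma covariance_total k C b N : 0 <= C -> 0 <= b -> b < 1 -> arc_cost N b <= 1 ->
  covariance_bound E k C b ->
  \sum_(s : k.-tuple 'I_N) \sum_(t : k.-tuple 'I_N)
     `|E (cpos N s ++ cpos N t) - E (cpos N s) * E (cpos N t)| <=
    C * (size (words (k + k)))%:R *
      ((k * k)%:R * (2 * arc_cost N b ^+ k.-1 * N%:R ^+ (k + k))).
Proof.
move=> C0 b0 b1 q1 cb.
pose pairs (s t : seq 'I_N) := \sum_(p <- cpos N s) \sum_(r <- cpos N t) b ^+ ndist p r.
pose F (s t : seq 'I_N) := \sum_(cs <- words (k + k))
   C * (pairs s t * wick b (zip (cpos N s ++ cpos N t) cs)).
apply: (@le_trans _ _ (\sum_(s : k.-tuple 'I_N) \sum_(t : k.-tuple 'I_N) F s t)).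
  apply: ler_sum => s _; apply: ler_sum => t _; rewrite /F -!mulr_sumr.
  by apply: cb; rewrite size_closed_pos size_tuple.
rewrite -(sum_tuple_cat k k F) exchange_big /= -mulrA -sum1_size natr_sum mulr_suml mulr_sumr.
rewrite big_seq [leRHS]big_seq; apply: ler_sum => cs.
rewrite mem_words => /and3P[/eqP scs _ bcs].
rewrite -mulr_sumr mul1r; apply: ler_wpM2l => //.
rewrite (sum_tuple_ffun _ (fun w : seq 'I_N => pairs (take k w) (drop k w) *
    wick b (zip (cpos N (take k w) ++ cpos N (drop k w)) cs))).
pose u := zip (take k (enum 'I_(k + k))) (take k cs).
pose t := zip (drop k (enum 'I_(k + k))) (drop k cs).
have se : size (take k (enum 'I_(k + k))) = k by rewrite size_takel // size_enum_ord leq_addr.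
have se' : size (drop k (enum 'I_(k + k))) = k by rewrite size_drop size_enum_ord addnK.
have sc : size (take k cs) = k by rewrite size_takel // scs leq_addr.
have sc' : size (drop k cs) = k by rewrite size_drop scs addnK.
have u1 : unzip1 u = take k (enum 'I_(k + k)) by rewrite unzip1_zip ?se ?sc.
have u2 : unzip2 u = take k cs by rewrite unzip2_zip ?se ?sc.
have t1 : unzip1 t = drop k (enum 'I_(k + k)) by rewrite unzip1_zip ?se' ?sc'.
have t2 : unzip2 t = drop k cs by rewrite unzip2_zip ?se' ?sc'.
have su : size u = k by rewrite size_zip se sc minnn.
have st : size t = k by rewrite size_zip se' sc' minnn.
have ut1 : unzip1 (u ++ t) = enum 'I_(k + k).
  by rewrite /unzip1 map_cat -/(unzip1 u) -/(unzip1 t) u1 t1 cat_take_drop.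
have ut2 : unzip2 (u ++ t) = cs.
  by rewrite /unzip2 map_cat -/(unzip2 u) -/(unzip2 t) u2 t2 cat_take_drop.
pose pos := fill_pos (phi N).
have wickE_ut (v : {ffun 'I_(k + k) -> 'I_N}) :
    wick b (zip (cpos N (map v (unzip1 u)) ++ cpos N (map v (unzip1 t))) cs) =
    arcs_wick pos b v (closed_arcs u ++ closed_arcs t).
  rewrite /arcs_wick map_cat !map_lettered_pos_closed -zip_cat ?u2 ?t2 ?cat_take_drop //.
  by rewrite size_closed_pos size_map u1 se sc.
have posE (v : {ffun 'I_(k + k) -> 'I_N}) w : size w = k ->
    cpos N (map v (unzip1 w)) = [seq arc_pos pos v e.1 | e <- closed_arcs w].
  move=> sw; transitivity (unzip1 (zip (cpos N (map v (unzip1 w))) (unzip2 w))).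
    by rewrite unzip1_zip // size_closed_pos !size_map.
  by rewrite -map_lettered_pos_closed /unzip1 -map_comp.
rewrite (eq_bigr (fun v : {ffun 'I_(k + k) -> 'I_N} =>
   \sum_(e <- closed_arcs u) \sum_(f <- closed_arcs t)
      b ^+ ndist (arc_pos pos v e.1) (arc_pos pos v f.1) *
        arcs_wick pos b v (closed_arcs u ++ closed_arcs t))); last first.
  move=> v _; rewrite -map_take -map_drop -u1 -t1 wickE_ut /pairs.
  rewrite !posE // big_map mulr_suml; apply: eq_bigr => e _.
  by rewrite big_map mulr_suml.
have s_arcs (w : seq ('I_(k + k) * nat)) : size (closed_arcs w) = size w.
  by case: w => // -[x c] w; rewrite /closed_arcs size_arcs.
rewrite exchange_big /=.
apply: (@le_trans _ _ (\sum_(e <- closed_arcs u) \sum_(f <- closed_arcs t)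
   2 * arc_cost N b ^+ k.-1 * N%:R ^+ (k + k))).
  rewrite big_seq [leRHS]big_seq; apply: ler_sum => e eu.
  rewrite exchange_big /= big_seq [leRHS]big_seq; apply: ler_sum => f ft.
  have uut : uniq (unzip1 (u ++ t)) by rewrite ut1 enum_uniq.
  have but : balanced (unzip2 (u ++ t)) by rewrite ut2.
  have := linked_walks_sum (fill_posC (phi N)) (@fill_posI N (phi N)) b0 b1 q1 su st uut but eu ft.
  by rewrite total_card card_ord.
rewrite le_eqVlt; apply/orP; left; apply/eqP.
rewrite !big_const_seq !count_predT !s_arcs su st !iter_addr_0 -mulrnA [RHS]mulr_natl.
by [].
Qed.

Lemma walk_covariance_cvg k : (0 < k)%N -> with_constants (covariance_bound E k) ->
  (\sum_(s : k.-tuple 'I_N) \sum_(t : k.-tuple 'I_N)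
     (E (cpos N s ++ cpos N t) - E (cpos N s) * E (cpos N t))) /
    (N%:R * sqn N ^+ k) ^+ 2 @[N --> \oo] --> (0 : R).
Proof.
move=> k0 [C [b [C0 b0 b1 cb]]].
pose A := C * (size (words (k + k)))%:R * ((k * k)%:R * (2 * nbhd_mass b ^+ k.-1)).
have K0 : 0 <= nbhd_mass b by rewrite (le_trans ler01) ?nbhd_mass_ge1.
have inv : A * N%:R^-1 @[N --> \oo] --> (0 : R).
  by rewrite -(mulr0 A); apply: cvgMr; exact: invn_cvg0.
have q1 : \forall N \near \oo, arc_cost N b <= 1.
  have /cvgrPdist_le/(_ 1 ltr01) := arc_cost_cvg0 b.
  by apply: filterS => N; rewrite sub0r normrN; apply: le_trans; exact: ler_norm.
apply/cvgrPdist_le => e e0.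
move/cvgrPdist_le/(_ e e0): inv => inv.
near=> N.
have N0 : (0 < N)%N by near: N; exact: nbhs_infty_gt.
have NR : (0 : R) < N%:R by rewrite ltr0n.
rewrite sub0r normrN exprMn -exprM mulnC mul2n sqn_double.
have den : 0 < N%:R ^+ 2 * N%:R ^+ k :> R by rewrite mulr_gt0 ?exprn_gt0.
rewrite normrM normfV (gtr0_norm den) ler_pdivrMr //.
apply: le_trans (ler_norm_sum _ _ _) _.
apply: (@le_trans _ _ (\sum_(s : k.-tuple 'I_N) \sum_(t : k.-tuple 'I_N)
     `|E (cpos N s ++ cpos N t) - E (cpos N s) * E (cpos N t)|)).
  by apply: ler_sum => s _; exact: ler_norm_sum.
apply: le_trans (covariance_total C0 b0 b1 _ cb) _; first by near: N.
have ANe : A * N%:R^-1 <= e.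
  apply: le_trans (ler_norm _) _; rewrite -normrN -sub0r.
  by near: N.
rewrite (_ : C * _ * _ = A * N%:R^-1 * (N%:R ^+ 2 * N%:R ^+ k)).
  by apply: ler_wpM2r => //; exact: ltW.
rewrite /A /arc_cost expr_div_n.
have -> : N%:R ^+ (k + k) = N%:R ^+ k * N%:R ^+ k.-1 * N%:R :> R.
  by rewrite -mulrA -exprSr prednK // exprD.
by field; rewrite gt_eqF ?expf_neq0 // gt_eqF.
Unshelve. all: by end_near. Qed.

End CovarianceLimit.

(** * Comparison of pairing weights *)

Section WickComparisons.
Context (R : realFieldType).

Lemma wick_sqr (b : R) L : wick (b ^+ 2) L = wick b L ^+ 2.
Proof.
rewrite /wick -prodrXl; apply: eq_bigr => x _; rewrite -prodrXl.
by apply: eq_bigr => y _; rewrite exprAC.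
Qed.

Lemma wick_relabel (b : R) (f : nat -> nat) s cs : injective f ->
  wick b (zip s (map f cs)) = wick b (zip s cs).
Proof.
move=> injf; pose g (x : nat * nat) := (x.1, f x.2).
have -> : zip s (map f cs) = map g (zip s cs).
  by elim: s cs => [|x s IH] [|c cs] //=; rewrite IH.
rewrite /wick big_map; apply: eq_bigr => x _; rewrite big_map.
by apply: eq_bigl => y; rewrite /g /= (inj_eq injf).
Qed.

Lemma wick_cat_disjoint (b : R) L1 L2 :
  (forall x y, x \in L1 -> y \in L2 -> x.2 != y.2) ->
  wick b (L1 ++ L2) = wick b L1 * wick b L2.
Proof.
move=> dis; have other (L : seq (nat * nat)) (x : nat * nat) :
    (forall y, y \in L -> y.2 != x.2) ->
    \prod_(y <- L | y.2 == x.2) b ^+ ndist x.1 y.1 = 1.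
  move=> h; rewrite big_seq_cond big_pred0 // => y.
  by apply/negP => /andP[/h /negPf ->].
rewrite /wick big_cat /=; congr (_ * _).
  rewrite big_seq [RHS]big_seq; apply: eq_bigr => x xL.
  rewrite big_cat /= [X in _ * X]other ?mulr1 // => y yL.
  by rewrite eq_sym dis.
rewrite big_seq [RHS]big_seq; apply: eq_bigr => x xL.
by rewrite big_cat /= [X in X * _]other ?mul1r // => y yL; rewrite dis.
Qed.

Context (b : R) (b0 : 0 <= b) (b1 : b < 1).

(** After a shift of the letters of one of them, the concatenation of two words is
    a word. *)
Lemma wick_words_mul k s t : size s = k -> size t = k ->
  (\sum_(cs <- words k) wick b (zip s cs)) * (\sum_(cs <- words k) wick b (zip t cs)) <=
  (size (words k) * size (words k))%:R * \sum_(cs <- words (k + k)) wick b (zip (s ++ t) cs).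
Proof.
move=> ss st; rewrite mulr_suml natrM -mulrA -[X in X%:R * _]sum1_size natr_sum mulr_suml.
rewrite big_seq [leRHS]big_seq; apply: ler_sum => c; rewrite mem_words => /and3P[/eqP sc lc bc].
rewrite mulr_sumr mul1r -[X in X%:R * _]sum1_size natr_sum mulr_suml.
rewrite big_seq [leRHS]big_seq; apply: ler_sum => c'; rewrite mem_words => /and3P[/eqP sc' lc' bc'].
rewrite mul1r -(wick_relabel b t c' (@addnI k)) -wick_cat_disjoint; last first.
  move=> [p d] [p' d'] /= h h'; have dc : d \in c.
    by rewrite -(@unzip2_zip _ _ s c) ?ss ?sc //; apply: (map_f snd h).
  have : d' \in map (addn k) c'.
    by rewrite -(@unzip2_zip _ _ t (map (addn k) c')) ?size_map ?st ?sc' //; apply: (map_f snd h').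
  case/mapP => d'' _ ->; move/allP/(_ _ dc): lc => dk.
  by rewrite neq_ltn (leq_trans dk) ?leq_addr.
rewrite -zip_cat ?ss ?sc //.
have w : c ++ map (addn k) c' \in words (k + k).
  rewrite mem_words size_cat size_map sc sc' eqxx all_cat all_map /= -andbA; apply/and3P; split.
  - by apply/allP => d /(allP lc) /leq_trans; apply; rewrite leq_addr.
  - by apply/allP => d /(allP lc'); rewrite /= ltn_add2l.
  have cm d : d \in c -> d \notin map (addn k) c'.
    move=> /(allP lc) dk; apply/mapP => -[d' _ e].
    by move: dk; rewrite e ltnNge leq_addr.
  rewrite /balanced all_cat; apply/andP; split; apply/allP => d dc.
    by rewrite count_cat (eqP (allP bc d dc)) (count_memPn (cm d dc)).
  have /count_memPn e : d \notin c by apply: contraL dc; apply: cm.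
  rewrite count_cat e; case/mapP: dc => d' d'c ->.
  rewrite count_map (eq_count (a2 := pred1 d')) ?(eqP (allP bc' _ d'c)) // => d''.
  by rewrite /= eqn_add2l.
by rewrite (big_rem _ w) /= lerDl; apply: sumr_ge0 => *; apply: wick_ge0.
Qed.

(** A list of odd length cannot be paired within itself, so that one of its
    positions is paired with one of the other list. *)
Lemma wick_linked s t cs : size cs = (size s + size t)%N -> odd (size s) ->
  balanced cs ->
  wick b (zip (s ++ t) cs) <= \sum_(p <- s) \sum_(r <- t) b ^+ ndist p r.
Proof.
move=> sc os bc; pose c1 := take (size s) cs; pose c2 := drop (size s) cs.
have csE : cs = c1 ++ c2 by rewrite cat_take_drop.
have s1 : size c1 = size s by rewrite size_takel // sc leq_addr.
have s2 : size c2 = size t by rewrite size_drop sc addKn.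
have [d d1 d2] : exists2 d, d \in c1 & d \in c2.
  apply/hasP; apply: contraLR os => nd; rewrite -s1.
  suff /balanced_size -> : balanced c1 by rewrite odd_double.
  apply/allP => d dc; have : d \in cs by rewrite csE mem_cat dc.
  move/(allP bc); rewrite /= csE count_cat (_ : count _ c2 = 0%N) ?addn0 //.
  by apply/count_memPn; apply: contra nd => d2; apply/hasP; exists d.
have link (s' c' : seq nat) : size c' = size s' -> d \in c' -> exists2 p, p \in s' & (p, d) \in zip s' c'.
  elim: s' c' => [|x s' IH] [|e c'] //= [h]; rewrite inE => /orP[/eqP ->|/(IH _ h)[p pp ppd]].
    by exists x; rewrite mem_head.
  by exists p; rewrite inE ?pp ?ppd orbT.
have [p ps pd] := link s c1 s1 d1; have [r rt rd] := link t c2 s2 d2.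
apply: (@le_trans _ _ (b ^+ ndist p r)).
  rewrite csE zip_cat ?s1 //.
  have pe : perm_eq (zip s c1 ++ zip t c2) ((p, d) :: (rem (p, d) (zip s c1) ++ zip t c2)).
    by rewrite -cat_cons perm_cat2r; apply: perm_to_rem.
  rewrite (wick_perm _ pe); have rL : (r, d) \in rem (p, d) (zip s c1) ++ zip t c2.
    by rewrite mem_cat rd orbT.
  apply: le_trans (@wick_match _ _ b0 b1 (p, d) (r, d) _ rL erefl) _.
  by rewrite ler_piMr ?exprn_ge0 // wick_le1.
rewrite (big_rem _ ps) /= (big_rem _ rt) /= -addrA lerDl.
by rewrite addr_ge0 // ?sumr_ge0 // => *; rewrite ?sumr_ge0 // => *; apply: exprn_ge0.
Qed.

(** The right-hand side is visibly invariant under permutations. *)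
Lemma pair_weight_double L :
  pair_weight b L *+ 2 + (size L)%:R = \sum_(p <- L) \sum_(r <- L) b ^+ ndist p r.
Proof.
elim: L => [|p L IH]; first by rewrite big_nil mul0rn addr0.
have e : \sum_(r <- L) \sum_(r' <- p :: L) b ^+ ndist r r' =
    \sum_(r <- L) b ^+ ndist p r + \sum_(r <- L) \sum_(r' <- L) b ^+ ndist r r'.
  by rewrite -big_split /=; apply: eq_bigr => r _; rewrite big_cons ndistC.
rewrite big_cons e -IH big_cons ndistnn expr0 /= -[(size L).+1%:R]natr1.
ring.
Qed.

Lemma pair_weight_perm L L' : perm_eq L L' -> pair_weight b L = pair_weight b L'.
Proof.
move=> p; have := pair_weight_double L.
rewrite (perm_big _ p) /=; under eq_bigr do rewrite (perm_big _ p) /=.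
rewrite -pair_weight_double (perm_size p) => /addIr.
rewrite -mulr_natl -[RHS]mulr_natl => /mulfI; apply.
by rewrite pnatr_eq0.
Qed.

Lemma pair_weight_nth L i j : (i < j < size L)%N ->
  b ^+ ndist (nth 0%N L i) (nth 0%N L j) <= pair_weight b L.
Proof.
elim: L i j => [|p L IH] i j; first by case/andP.
case: i j => [|i] [|j] //=; rewrite ltnS.
  move=> jL; rewrite (big_rem (nth 0%N L j)) ?mem_nth //= -addrA lerDl.
  by rewrite addr_ge0 ?pair_weight_ge0 // sumr_ge0 // => *; apply: exprn_ge0.
move=> ij; apply: le_trans (IH i j ij) _; rewrite lerDr.
by rewrite sumr_ge0 // => *; apply: exprn_ge0.
Qed.

End WickComparisons.

Section SequenceMinimum.

Lemma foldr_minn_mem x s : foldr minn x s \in x :: s.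
Proof.
elim: s => [|y s IH] /=; first by rewrite mem_head.
rewrite /minn; case: ifP => _; first by rewrite !inE eqxx orbT.
by move: IH; rewrite !inE => /orP[->|->]; rewrite ?orbT.
Qed.

Lemma seq_min_mem s : s != [::] -> seq_min s \in s.
Proof.
case: s => // x s _; have := foldr_minn_mem x (x :: s).
by rewrite /seq_min /= inE => /orP[/eqP ->|]; rewrite ?mem_head.
Qed.

End SequenceMinimum.

(** The list whose entries at the places 1, 3, 5, ... are those of [L]. *)
Fixpoint doubled (L : seq nat) : seq nat := if L is p :: L' then p :: p :: doubled L' else [::].

Lemma size_doubled L : size (doubled L) = (size L).*2.
Proof. by elim: L => //= p L ->. Qed.

Lemma nth_doubled L i : nth 0%N (doubled L) i.*2 = nth 0%N L i.
Proof. by elim: L i => [|p L IH] [|i] //=; rewrite nth_nil. Qed.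

Lemma sorted_doubled L : sorted leq L -> sorted leq (doubled L).
Proof.
case: L => //= p L; rewrite leqnn /=.
by elim: L p => //= q L IH p /andP[-> h]; rewrite leqnn /= IH.
Qed.

Lemma odd_entries_doubled L : odd_entries (doubled L) = L.
Proof.
rewrite /odd_entries size_doubled doubleK -[RHS](mkseq_nth 0%N).
by apply: eq_map => i; rewrite nth_doubled.
Qed.

Lemma odd_min_gap_doubled L : (1 < size L)%N -> exists2 i, (i.+1 < size L)%N &
  odd_min_gap (doubled L) = (nth 0%N L i.+1 - nth 0%N L i)%N.
Proof.
move=> L1; rewrite /odd_min_gap size_doubled doubleK.
set s := map _ _; have : s != [::].
  by rewrite -size_eq0 size_map size_iota -lt0n -subn1 subn_gt0.
move/seq_min_mem => /mapP[l]; rewrite mem_iota add0n => /andP[_ ll] ->.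
exists l; first by rewrite -(prednK (ltnW L1)) ltnS.
by rewrite -doubleS !nth_doubled.
Qed.


(** * Estimates from the moment conditions *)

Section MomentBounds.
Context (d : measure_display) (T : measurableType d) (R : realType).
Context (P : probability T R) (Z : nat -> {RV P >-> R}).
Context (mZ : moments_exist Z) (m1 : M1 Z) (m2 : M2 Z) (m3 : M3 Z).

Definition moment (s : seq nat) : R := fine 'E_P[prodZ Z s].

Lemma momentE s : 'E_P[prodZ Z s]%E = (moment s)%:E.
Proof.
rewrite /moment fineK // expectation.unlock.
by apply: integrable_fin_num => //; exact: mZ.
Qed.

Lemma prodZ_perm s t : perm_eq s t -> prodZ Z s = prodZ Z t.
Proof. by move=> st; apply/funext => w; apply: perm_big. Qed.

Lemma moment_perm s t : perm_eq s t -> moment s = moment t.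
Proof. by move=> st; rewrite /moment (prodZ_perm st). Qed.

Lemma moment_odd s : odd (size s) -> moment s = 0.
Proof. by move=> os; rewrite /moment m2. Qed.

Lemma expectation_squares L :
  'E_P[fun w => (\prod_(n <- L) Z n w ^+ 2)%R]%E = (moment (L ++ L))%:E.
Proof.
rewrite -momentE; congr expectation; apply/funext => w.
by rewrite /prodZ big_cat /= -big_split /=.
Qed.

Lemma moment_words k C beta b : 0 <= C -> 0 <= b -> b < 1 -> beta <= b ^+ 2 -> 0 <= beta ->
  ~~ odd k -> M3a Z k C beta ->
  forall s, size s = k ->
  `|moment s| <= C * \sum_(cs <- words k) wick b (zip s cs).
Proof.
move=> C0 b0 b1 bb beta0 ek ha s sk.
have := ha (sort leq s); rewrite size_sort => /(_ sk (sort_sorted leq_total s)).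
rewrite momentE /= lee_fin (moment_perm (permEl (perm_sort leq s))) => /le_trans; apply.
apply: ler_wpM2l => //; rewrite -(even_halfK ek) in sk *.
apply: le_trans (odd_gaps_le_words b0 b1 sk).
by apply: lerXn2r; rewrite ?nnegrE ?exprn_ge0.
Qed.

Lemma sqrt_base (beta : R) : 0 <= beta -> beta < 1 ->
  exists b, [/\ 0 <= b, b < 1 & b ^+ 2 = beta].
Proof.
move=> h0 h1; exists (Num.sqrt beta); split; rewrite ?sqrtr_ge0 ?sqr_sqrtr //.
by rewrite -[ltRHS]sqrtr1 ltr_sqrt.
Qed.

Lemma moment_word_bound n : (0 < n)%N -> with_constants (word_bound moment n).
Proof.
move=> n0; have [||C [beta [[C0 beta0 beta1] [ha _ _]]]] := m3 (k := n.*2).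
- by rewrite double_gt0.
- by rewrite odd_double.
have [b [b0 b1 bE]] := sqrt_base beta0 beta1.
exists C, b; split => //; first exact: ltW.
by apply: (moment_words (beta := beta)) => //; rewrite ?bE ?odd_double // ltW.
Qed.

(** The minimal gap is attained by some pair, whose weight is one of the terms of
    the pair weight. A single variable is the case of [M1]. *)
Lemma moment_square_bound n : (0 < n)%N -> with_constants (square_bound moment n).
Proof.
case: n => // -[|n] _.
  exists 0, 0; split => // -[|p [|? ?]] // _.
  rewrite mul0r; have := expectation_squares [:: p].
  rewrite (_ : (fun w => _) = (fun w => Z p w ^+ 2)); last first.
    by apply/funext => w; rewrite big_seq1.
  by rewrite m1 => -[<-]; rewrite subrr normr0.
have [||C [beta [[C0 beta0 beta1] [_ _ hc]]]] := m3 (k := n.+2.*2) => //.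
  by rewrite odd_double.
exists C, beta; split => //; first exact: ltW.
move=> L sL; have sS : size (sort leq L) = n.+2 by rewrite size_sort.
have := hc isT (doubled (sort leq L)); rewrite size_doubled sS => /(_ erefl).
rewrite sorted_doubled; last exact: (sort_sorted leq_total).
move=> /(_ isT); rewrite odd_entries_doubled expectation_squares -EFinB /= lee_fin.
have pL : perm_eq (sort leq L) L by rewrite perm_sort.
rewrite (moment_perm (perm_cat pL pL)) => /le_trans; apply.
apply: ler_wpM2l; first exact: ltW.
rewrite -(pair_weight_perm _ pL).
have [|i iL ->] := @odd_min_gap_doubled (sort leq L); first by rewrite sS.
apply: le_trans (@pair_weight_nth _ _ beta0 _ i i.+1 _); last by rewrite ltnSn.
have st : (nth 0 (sort leq L) i <= nth 0 (sort leq L) i.+1)%N.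
  apply: (sorted_leq_nth leq_trans leqnn 0%N (sort_sorted leq_total L)) => //.
  by rewrite inE; exact: ltn_trans iL.
by rewrite /ndist (eqP st).
Qed.

Lemma min_sqr_le (x y : R) : 0 <= x -> 0 <= y -> Num.min (x ^+ 2) (y ^+ 2) <= x * y.
Proof.
move=> x0 y0; have [xy|yx] := leP x y.
  by rewrite ge_min expr2 ler_wpM2l.
by rewrite ge_min [y ^+ 2]expr2 (ler_wpM2r y0 (ltW yx)) orbT.
Qed.

Lemma le_sum_min (I : Type) (r : seq I) (F : I -> R) (x a : R) :
  0 <= a -> (forall i, 0 <= F i) -> x <= a -> x <= \sum_(i <- r) F i ->
  x <= \sum_(i <- r) Num.min a (F i).
Proof.
move=> a0 F0 xa; elim: r x xa => [|i r IH] x xa; first by rewrite !big_nil.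
rewrite !big_cons => xs; have m0 : 0 <= \sum_(j <- r) Num.min a (F j).
  by apply: sumr_ge0 => j _; rewrite le_min a0 F0.
have [aF|Fa] := leP a (F i); first by apply: le_trans xa _; rewrite lerDl.
rewrite -lerBlDl; apply: IH; last by rewrite lerBlDl.
by apply: le_trans xa; rewrite gerBl.
Qed.

Lemma seq_min_le s (x : nat) : x \in s -> (seq_min s <= x)%N.
Proof.
rewrite /seq_min; move: (head _ _) => z; elim: s => //= y s IH.
rewrite inE geq_min => /orP[/eqP ->|/IH ->]; rewrite ?leqnn ?orbT //.
Qed.

Lemma seq_min_perm s t : perm_eq s t -> seq_min s = seq_min t.
Proof.
move=> st; have [s0|s0] := eqVneq s [::]; first by move: st; rewrite s0 => /perm_size; case: t.
have t0 : t != [::] by rewrite -size_eq0 -(perm_size st) size_eq0.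
apply/eqP; rewrite eqn_leq !seq_min_le //.
  by rewrite -(perm_mem st) seq_min_mem.
by rewrite (perm_mem st) seq_min_mem.
Qed.

Lemma seq_dist_perm s s' t t' : perm_eq s s' -> perm_eq t t' ->
  seq_dist s t = seq_dist s' t'.
Proof.
move=> ss tt; apply: seq_min_perm; apply: perm_allpairs => //.
Qed.

Lemma seq_dist_pow (b : R) (s t : seq nat) : 0 <= b -> s != [::] -> t != [::] ->
  b ^+ seq_dist s t <= \sum_(p <- s) \sum_(r <- t) b ^+ ndist p r.
Proof.
move=> b0 s0 t0; rewrite /seq_dist.
have /seq_min_mem/allpairsP[[p r] /= [ps rt ->]] :
    [seq `|a%:Z - b%:Z|%N | a <- s, b <- t] != [::].
  by rewrite -size_eq0 size_allpairs muln_eq0 !size_eq0 negb_or s0.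
rewrite -ndistE (big_rem _ ps) /= (big_rem _ rt) /= -addrA lerDl.
by rewrite addr_ge0 // ?sumr_ge0 // => *; rewrite ?sumr_ge0 // => *; apply: exprn_ge0.
Qed.

(** For odd [k] the two means vanish, and every word links the two lists. For even
    [k] the covariance has both a bound by mixing and a bound by words, and their
    geometric mean is taken for each word. This is why [b] is a fourth root of
    a constant in the moment conditions: one square root accounts for the
    ordered pairs in [wick], the other one for the mean. *)
Lemma moment_covariance_bound k : (0 < k)%N -> with_constants (covariance_bound moment k).
Proof.
move=> k0; have [||C2 [beta2 [[C20 beta20 beta21] [ha2 _ _]]]] := m3 (k := (k + k)%N).
- by rewrite addn_gt0 k0.
- by rewrite addnn odd_double.
have ekk : ~~ odd (k + k) by rewrite addnn odd_double.
have [ok|ek] := boolP (odd k).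
  have [b2 [b20 b21 b2E]] := sqrt_base beta20 beta21.
  have [b [b0 b1 bE]] := sqrt_base b20 b21.
  exists C2, b; split => //; first exact: ltW.
  move=> s t ss st; rewrite (moment_odd (s := s)) ?ss // mul0r subr0.
  have := moment_words (ltW C20) b20 b21 _ beta20 ekk ha2 (s := s ++ t).
  rewrite b2E size_cat ss st => /(_ (lexx _) erefl) /le_trans; apply.
  apply: ler_wpM2l; first exact: ltW.
  rewrite mulr_sumr big_seq [leRHS]big_seq; apply: ler_sum => cs.
  rewrite mem_words => /and3P[/eqP sc _ bc].
  rewrite -bE wick_sqr expr2; apply: ler_wpM2r; first exact: wick_ge0.
  by apply: wick_linked; rewrite ?ss ?st.
have [||C1 [beta1 [[C10 beta10 beta11] [ha1 hb1 _]]]] := m3 (k := k) => //.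
pose beta := Num.max beta1 beta2.
have beta0 : 0 <= beta by rewrite le_max beta10.
have betalt1 : beta < 1 by rewrite gt_max beta11.
have [b2 [b20 b21 b2E]] := sqrt_base beta0 betalt1.
have [b [b0 b1 bE]] := sqrt_base b20 b21.
have bb1 : beta1 <= b2 ^+ 2 by rewrite b2E le_max lexx.
have bb2 : beta2 <= b2 ^+ 2 by rewrite b2E le_max lexx orbT.
pose w := (size (words k) * size (words k))%:R : R.
pose C := C1 + (C2 + C1 ^+ 2 * w).
have C4 : 0 <= C2 + C1 ^+ 2 * w by rewrite addr_ge0 ?mulr_ge0 ?exprn_ge0 // ltW.
exists C, b; split => //; first by rewrite addr_ge0 // ltW.
move=> s t ss st.
have s0 : s != [::] by rewrite -size_eq0 ss -lt0n.
have t0 : t != [::] by rewrite -size_eq0 st -lt0n.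
pose cov := `|moment (s ++ t) - moment s * moment t|.
have b0' : 0 <= b ^+ seq_dist s t by apply: exprn_ge0.
pose W cs := wick b2 (zip (s ++ t) cs).
have mixing : cov <= C * (b ^+ seq_dist s t) ^+ 2.
  have [sS tS] : size (sort leq s) = k /\ size (sort leq t) = k by rewrite !size_sort.
  have := hb1 _ _ sS tS (sort_sorted leq_total s) (sort_sorted leq_total t).
  rewrite !momentE -EFinM -EFinB /= lee_fin.
  have ps : perm_eq (sort leq s) s by rewrite perm_sort.
  have pt : perm_eq (sort leq t) t by rewrite perm_sort.
  rewrite (moment_perm (perm_cat ps pt)) (moment_perm ps) (moment_perm pt) => h.
  apply: le_trans h _; apply: ler_pM => //; first exact: ltW.
  - exact: exprn_ge0.
  - by rewrite lerDl.
  rewrite (seq_dist_perm ps pt) -exprM mulnC exprM bE.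
  apply: lerXn2r; rewrite ?nnegrE //.
  apply: le_trans bb1 _; rewrite expr2; apply: ler_piMr => //; exact: ltW.
have pairing : cov <= C * \sum_(cs <- words (k + k)) W cs.
  apply: le_trans (ler_normB _ _) _; rewrite normrM mulrDl -[leLHS]add0r.
  apply: lerD; first by rewrite mulr_ge0 ?(ltW C10) // sumr_ge0 // => *; apply: wick_ge0.
  rewrite mulrDl; apply: lerD.
    by apply: (moment_words (ltW C20) b20 b21 bb2 beta20 ekk ha2); rewrite size_cat ss st.
  rewrite expr2 -!mulrA.
  apply: (@le_trans _ _ ((C1 * \sum_(cs <- words k) wick b2 (zip s cs)) *
     (C1 * \sum_(cs <- words k) wick b2 (zip t cs)))).
    by apply: ler_pM => //; apply: (moment_words (ltW C10) b20 b21 bb1 beta10 ek ha1).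
  rewrite mulrACA -!mulrA; do 2![apply: ler_wpM2l; rewrite ?(ltW C10) //].
  exact: wick_words_mul.
have C0 : 0 <= C by rewrite addr_ge0 // ltW.
have {mixing pairing} : cov <= C * \sum_(cs <- words (k + k)) Num.min ((b ^+ seq_dist s t) ^+ 2) (W cs).
  rewrite mulr_sumr; under eq_bigr do rewrite minr_pMr //.
  apply: le_sum_min => //; first by rewrite mulr_ge0 // exprn_ge0.
    by move=> cs; rewrite mulr_ge0 // wick_ge0.
  by rewrite -mulr_sumr.
move/le_trans; apply; apply: ler_wpM2l => //.
rewrite mulr_sumr; apply: ler_sum => cs _; rewrite /W -bE wick_sqr.
apply: le_trans (min_sqr_le _ (wick_ge0 b0 _)) _ => //.
by apply: ler_wpM2r; rewrite ?wick_ge0 // seq_dist_pow.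
Qed.

End MomentBounds.

(** * Eigenvalues and traces *)

Section TraceExpansion.
Context (R : realType) (N : nat) (pos : 'I_N -> 'I_N -> nat) (z : nat -> R).
Context (M : 'M[R]_N) (ME : forall i j, M i j = z (pos i j)).

Lemma mx_exp_walks k x y : (M ^+ k) x y =
  \sum_(s : k.-tuple 'I_N) (last x s == y)%:R * \prod_(p <- trail pos x s) z p.
Proof.
elim: k x => [|k IH] x.
  rewrite expr0 (eq_bigr (fun=> (x == y)%:R)) => [|s _].
    by rewrite sumr_const card_tuple expn0 mxE.
  by rewrite tuple0 /= big_nil mulr1.
rewrite exprS mxE (sum_tuple_cons _ (fun s => (last x s == y)%:R * \prod_(p <- trail pos x s) z p)).
apply: eq_bigr => a _; rewrite IH mulr_sumr; apply: eq_bigr => s _ /=.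
by rewrite big_cons -ME mulrCA.
Qed.

Lemma mxtrace_exp_walks k : (0 < k)%N -> \tr (M ^+ k) =
  \sum_(s : k.-tuple 'I_N) \prod_(p <- closed_pos pos s) z p.
Proof.
case: k => // k _.
rewrite (sum_tuple_cons _ (fun s => \prod_(p <- closed_pos pos s) z p)).
apply: eq_bigr => x _; rewrite mx_exp_walks.
rewrite (sum_tuple_rcons _ (fun s => (last x s == x)%:R * \prod_(p <- trail pos x s) z p)).
apply: eq_bigr => s _; rewrite (bigD1 x) //= last_rcons eqxx mul1r [X in _ + X]big1 ?addr0 // => y.
by rewrite last_rcons => /negPf ->; rewrite mul0r.
Qed.

End TraceExpansion.

Section SymmetricEigenvalues.
Context (R : realType) (N : nat) (A : 'M[R]_N) (Asym : A^T = A).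

Lemma char_poly_similar (F : fieldType) n (Q D : 'M[F]_n) : Q \in unitmx ->
  char_poly (invmx Q *m D *m Q) = char_poly D.
Proof.
move=> Qu; rewrite /char_poly /char_poly_mx.
have QQ : map_mx polyC (invmx Q) *m map_mx polyC Q = 1%:M.
  by rewrite -map_mxM mulVmx // map_mx1.
have -> : 'X%:M - map_mx polyC (invmx Q *m D *m Q) =
    map_mx polyC (invmx Q) *m ('X%:M - map_mx polyC D) *m map_mx polyC Q.
  by rewrite mulmxBr mulmxBl scalar_mxC -[_%:M *m _ *m _]mulmxA QQ mulmx1 !map_mxM.
by rewrite !det_mulmx mulrAC -det_mulmx QQ det1 mul1r.
Qed.

Lemma exp_similar (F : fieldType) n (Q D : 'M[F]_n) k : Q \in unitmx ->
  (invmx Q *m D *m Q) ^+ k = invmx Q *m (D ^+ k) *m Q.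
Proof.
move=> Qu; elim: k => [|k IH]; first by rewrite !expr0 mulmx1 mulVmx.
rewrite !exprS IH -[_ * (invmx Q *m _ *m _)]/(_ *m _) !mulmxA.
by rewrite -[X in X *m D ^+ k]mulmxA mulmxV // mulmx1.
Qed.

Lemma diag_mx_exp (F : fieldType) n (d : 'rV[F]_n) k :
  diag_mx d ^+ k = diag_mx (\row_i d 0 i ^+ k).
Proof.
elim: k => [|k IH].
  rewrite expr0; apply/matrixP => i j; rewrite !mxE; case: eqP => //.
rewrite exprS IH -[_ * _]/(_ *m _); apply/matrixP => i j.
rewrite mul_diag_mx !mxE; case: eqP => [->|_]; last by rewrite !mulr0n mulr0.
by rewrite !mulr1n exprS.
Qed.

Let toC : {rmorphism R -> R[i]} := real_complex R.

(** The spectral theorem is applied over the complex numbers; the eigenvalues being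
    real, the factorisation of the characteristic polynomial descends. *)
Lemma symmetric_spectrum : exists r : 'I_N -> R,
  char_poly A = \prod_(i < N) ('X - (r i)%:P) /\
  forall k, \tr (A ^+ k) = \sum_i r i ^+ k.
Proof.
pose B := map_mx toC A.
have Bherm : B \is hermsymmx.
  apply: realsym_hermsym.
    apply/is_hermitianmxP; apply/matrixP => i j.
    by rewrite expr0 scale1r !mxE -{1}Asym mxE.
  by apply/mxOverP => i j; rewrite mxE; apply/complex_realP; exists (A i j).
have Bn := hermitian_normalmx Bherm.
have /mxOverP sp_real := hermitian_spectral_diag_real Bherm.
have /orthomx_spectralP := Bn; set Q := spectralmx B; set sp := spectral_diag B => BE.
have Qu : Q \in unitmx := spectral_unit B.
exists (fun i => complex.Re (sp 0 i)).
have spE i : sp 0 i = toC (complex.Re (sp 0 i)).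
  by rewrite /toC /= RRe_real // sp_real.
split.
  apply: (@map_poly_inj _ _ toC); rewrite map_char_poly -/B BE char_poly_similar //.
  rewrite char_poly_trig ?diag_mx_is_trig // rmorph_prod; apply: eq_bigr => i _.
  by rewrite mxE eqxx mulr1n rmorphB /= map_polyX map_polyC /= -spE.
move=> k; apply: (fmorph_inj toC); rewrite -trace_map_mx [RHS]rmorph_sum.
have -> : map_mx toC (A ^+ k) = B ^+ k.
  elim: k => [|k IH]; first by rewrite !expr0 map_mx1.
  by rewrite !exprS -IH; exact: map_mxM.
rewrite BE exp_similar // diag_mx_exp mxtrace_mulC mulmxA mulmxV // mul1mx mxtrace_diag.
by apply: eq_bigr => i _; rewrite mxE rmorphXn -spE.
Qed.

Lemma eigenvalues_perm (r : 'I_N -> R) :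
  char_poly A = \prod_(i < N) ('X - (r i)%:P) ->
  perm_eq (eigenvalues A) [seq r i | i <- enum 'I_N].
Proof.
move=> pE; set s := [seq r i | i <- enum 'I_N].
have p_s : char_poly A = \prod_(x <- s) ('X - x%:P) by rewrite pE big_map enumT.
have p0 : char_poly A != 0 by rewrite monic_neq0 // char_poly_monic.
rewrite /eigenvalues; apply/allP => x _ /=; rewrite -(mu_prod_XsubC x s) -p_s.
rewrite count_flatten -map_comp sumnE big_map.
have rootsE y : (y \in rootsR (char_poly A)) = root (char_poly A) y.
  by have /(_ y) := roots_on_rootsR p0; rewrite in_itv /= => ->.
have [rx|nrx] := boolP (root (char_poly A) x).
  rewrite (bigD1_seq x) ?rootsE ?uniq_roots //= count_nseq /= eqxx mul1n.
  rewrite big1 ?addn0 // => y /negPf yx.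
  by rewrite count_nseq /= yx mul0n.
rewrite mupNroot // big_seq big1 // => y; rewrite rootsE => ry.
rewrite /= count_nseq /=; case: eqP => [yx|_]; last by rewrite mul0n.
by rewrite -yx ry in nrx.
Qed.

Lemma size_eigenvalues : size (eigenvalues A) = N.
Proof.
have [r [/eigenvalues_perm/perm_size -> _]] := symmetric_spectrum.
by rewrite size_map size_enum_ord.
Qed.

Lemma sum_eigenvalues_exp k : \sum_(x <- eigenvalues A) x ^+ k = \tr (A ^+ k).
Proof.
have [r [/eigenvalues_perm pE tE]] := symmetric_spectrum.
by rewrite (perm_big _ pE) /= big_map tE big_enum.
Qed.

End SymmetricEigenvalues.


(** * Moments of the semicircle law *)

Section SemicircleDensity.
Import HBNNSimple.
Context (R : realType).
Local Notation mu := (@lebesgue_measure R).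
Local Notation nu := (@semicircle R).
Local Notation pdf := (@semicircle_pdf R).

Lemma measurable_pdf_mul (f : R -> \bar R) : measurable_fun [set: R] f ->
  measurable_fun [set: R] (fun x => (f x * (pdf x)%:E)%E).
Proof.
move=> mf; apply: emeasurable_funM => //.
by apply/measurable_EFinP; exact: measurable_semicircle_pdf.
Qed.

Lemma semicircle_integral_indic (E : set (measurableTypeR R)) : measurable E ->
  (\int[nu]_x (\1_E x)%:E = \int[mu]_x ((\1_E x)%:E * (pdf x)%:E))%E.
Proof.
move=> mE; rewrite integral_indic // setIT [LHS]/(semicircle E) /semicircle.
rewrite [LHS]integral_mkcond; apply: eq_integral => x _.
by rewrite patchE indicE; case: ifP => _; rewrite ?mul1e ?mul0e.
Qed.

Lemma semicircle_integral_nnsfun (f : {nnsfun measurableTypeR R >-> R}) :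
  (\int[nu]_x (f x)%:E = \int[mu]_x ((f x)%:E * (pdf x)%:E))%E.
Proof.
under [LHS]eq_integral do rewrite fimfunE -fsumEFin//.
rewrite [LHS]ge0_integral_fsum//; last 2 first.
  - by move=> r; exact/measurable_EFinP/measurableT_comp.
  - by move=> n x _; rewrite EFinM nnfun_muleindic_ge0.
under [RHS]eq_integral.
  move=> x xD; rewrite fimfunE -fsumEFin// muleC ge0_mule_fsumr; last first.
    by move=> r; rewrite EFinM nnfun_muleindic_ge0.
  over.
rewrite [RHS]ge0_integral_fsum//; last 2 first.
  - move=> r; under eq_fun do rewrite muleC.
    apply: measurable_pdf_mul; apply/measurable_EFinP; apply: measurable_funM => //.
    by have mfr : measurable (f @^-1` [set r]) by []; exact: measurable_indic.
  - move=> n x _; rewrite mule_ge0 ?lee_fin ?semicircle_pdf_ge0 //.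
    by have := nnfun_muleindic_ge0 f n x; rewrite -EFinM lee_fin.
apply: eq_fsbigr => r _; rewrite integralZl_indic_nnsfun//.
rewrite semicircle_integral_indic//.
have [r0|/negP r0] := boolP (0 <= r); last first.
  have e : f @^-1` [set r] = set0.
    by apply/seteqP; split => x //= fx; apply: r0; rewrite -fx.
  rewrite [RHS]integral0_eq => [|x _]; last by rewrite e indicE in_set0 mulr0 mule0.
  by rewrite integral0_eq ?mule0 // => x _; rewrite e indicE in_set0 mul0e.
rewrite -ge0_integralZl//.
- by apply: eq_integral => x _; rewrite EFinM [RHS]muleC muleA.
- have mfr : measurable (f @^-1` [set r]) by [].
  by apply: measurable_pdf_mul; apply/measurable_EFinP; exact: measurable_indic.
- by move=> x _; rewrite mule_ge0 ?lee_fin ?semicircle_pdf_ge0.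
Qed.

(** The semicircle law has the density [semicircle_pdf]: first for simple functions,
    then by monotone convergence. *)
Lemma ge0_integral_semicircle (f : R -> \bar R) :
  measurable_fun [set: R] f -> (forall x, 0 <= f x)%E ->
  (\int[nu]_x f x = \int[mu]_x (f x * (pdf x)%:E))%E.
Proof.
move=> mf f0; pose f_ := @nnsfun_approx _ (measurableTypeR R) R setT measurableT f mf.
have cvf x : (EFin \o f_ ^~ x) n @[n --> \oo] --> f x by exact: cvg_nnsfun_approx.
have incr m n x : (m <= n)%N -> f_ m x <= f_ n x.
  by move=> mn; have /lefP := @nd_nnsfun_approx _ (measurableTypeR R) R setT measurableT f mf _ _ mn; apply.
transitivity (lim (\int[nu]_x (f_ n x)%:E @[n --> \oo])%E).
  rewrite -monotone_convergence//=.
  - by apply: eq_integral => x _; apply/esym/cvg_lim => //; exact: cvf.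
  - by move=> n; apply/measurable_EFinP; exact: (measurable_funPT (f_ n)).
  - by move=> n ? _; rewrite lee_fin.
  - by move=> x _ m n mn; rewrite lee_fin; exact: incr.
rewrite [RHS](_ : _ = lim (\int[mu]_x ((f_ n x)%:E * (pdf x)%:E) @[n --> \oo])%E).
  by congr (limn _); apply/funext => n; exact: semicircle_integral_nnsfun.
rewrite -monotone_convergence//=.
- apply: eq_integral => x _; apply/esym/cvg_lim => //.
  rewrite [X in _ --> X]muleC; under eq_fun do rewrite muleC.
  by apply: cvgeZl => //; exact: cvf.
- by move=> n; apply: measurable_pdf_mul; apply/measurable_EFinP; exact: (measurable_funPT (f_ n)).
- by move=> n x _; rewrite mule_ge0 ?lee_fin ?semicircle_pdf_ge0.
- move=> x _ m n mn; rewrite lee_wpmul2r ?lee_fin ?semicircle_pdf_ge0 //.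
  exact: incr.
Qed.

Definition semicircle_height (x : R) : R := (2 * pi)^-1 * Num.sqrt (4 - x ^+ 2).

Lemma pdf_patch (f : R -> R) :
  (fun x => f x * pdf x) = (fun x => f x * semicircle_height x) \_ `[-2, 2].
Proof.
apply/funext => x; rewrite patchE /semicircle_pdf -/(semicircle_height x) indicE.
have -> : (x \in [set y : R | `|y| <= 2]) = (x \in (`[-2, 2] : set R)).
  by apply/idP/idP; rewrite !inE /= in_itv /= ler_norml.
by case: ifP => _; rewrite ?mulr1 ?mulr0.
Qed.

Lemma Rintegral_semicircle (f : R -> R) : measurable_fun [set: R] f ->
  \int[nu]_x f x = \int[mu]_(x in `[-2, 2]) (f x * semicircle_height x).
Proof.
move=> mf; rewrite [RHS]Rintegral_mkcond -pdf_patch /Rintegral; congr fine.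
have mEf : measurable_fun [set: R] (EFin \o f) by apply/measurable_EFinP.
have key (g : R -> R) : measurable_fun [set: R] g ->
    (\int[nu]_x (EFin \o g)^\+ x = \int[mu]_x (EFin \o (fun x => (g x * pdf x)%R))^\+ x)%E.
  move=> mg; rewrite ge0_integral_semicircle //; last first.
    by apply: measurable_funepos; exact/measurable_EFinP.
  apply: eq_integral => x _; rewrite !funeposE /= -!EFin_max -EFinM; congr EFin.
  by rewrite maxr_pMl ?semicircle_pdf_ge0 // mul0r.
rewrite integralE [RHS]integralE; congr (_ - _)%E; first exact: key.
have := key (fun x => - f x) (measurable_funN mf).
have neg (h : R -> R) : ((EFin \o (fun x => - h x)%R)^\+ = (EFin \o h)^\-)%E.
  by rewrite -funeposN; congr funepos; apply/funext => x.
rewrite -!neg => ->; congr (integral _ _ (funepos _)); apply/funext => x /=.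
by rewrite mulNr.
Qed.

End SemicircleDensity.


Section ChebyshevMoments.
Context (R : realType).
Local Notation mu := (@lebesgue_measure R).
Local Notation height := (@semicircle_height R).

(** Chebyshev polynomials of the second kind, rescaled to [-2, 2]. *)
Fixpoint cheb (h : nat) (x : R) : R :=
  if h is h'.+1 then
    if h' is h''.+1 then x * cheb h' x - cheb h'' x else x
  else 1.

Lemma chebSS h x : cheb h.+2 x = x * cheb h.+1 x - cheb h x.
Proof. by []. Qed.

Lemma cheb_cos h t : cheb h (2 * cos t) * sin t = sin (h.+1%:R * t).
Proof.
suff : cheb h (2 * cos t) * sin t = sin (h.+1%:R * t) /\
       cheb h.+1 (2 * cos t) * sin t = sin (h.+2%:R * t) by case.
elim: h => [|h [IH1 IH2]].
  split; first by rewrite /= !mul1r.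
  by rewrite [cheb 1 _]/= [2%:R * t]mulr_natl mulr2n sinD; ring.
split => //; rewrite chebSS mulrBl -[_ * _ * sin t]mulrA IH2 IH1.
have e3 : h.+3%:R * t = h.+2%:R * t + t by rewrite -[h.+3%:R]natr1 mulrDl mul1r.
have e1 : h.+1%:R * t = h.+2%:R * t - t by rewrite -[h.+2%:R]natr1; ring.
by rewrite e3 e1 !sinD sinN cosN; ring.
Qed.

Lemma continuous_cheb h : continuous (cheb h).
Proof.
suff : continuous (cheb h) /\ continuous (cheb h.+1) by case.
elim: h => [|h [IH1 IH2]].
  by split=> x; [exact: cvg_cst | exact: cvg_id].
split => // x; apply: cvgB; last exact: IH1.
by apply: cvgM; [exact: cvg_id | exact: IH2].
Qed.

Lemma continuous_height : continuous height.
Proof.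
move=> x; apply: cvgM; first exact: cvg_cst.
apply: continuous_comp; last exact: sqrt_continuous.
by apply: cvgB; [exact: cvg_cst | exact: exprn_continuous].
Qed.

Definition sc_int (f : R -> R) : R := \int[mu]_(x in `[-2, 2]) (f x * height x).

Lemma continuous_itv_integrable (f : R -> R) (a b : R) : continuous f ->
  mu.-integrable `[a, b] (EFin \o f).
Proof.
move=> cf; apply: continuous_compact_integrable; first exact: segment_compact.
exact: continuous_subspaceT.
Qed.

Lemma continuous_mul_height (f : R -> R) : continuous f -> continuous (fun x => f x * height x).
Proof. by move=> cf x; apply: cvgM; [exact: cf | exact: continuous_height]. Qed.

Lemma sc_intD (f g : R -> R) : continuous f -> continuous g ->
  sc_int (fun x => f x + g x) = sc_int f + sc_int g.
Proof.
move=> cf cg; rewrite /sc_int -RintegralD //.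
- by apply: eq_Rintegral => x _; rewrite mulrDl.
- exact/continuous_itv_integrable/continuous_mul_height.
- exact/continuous_itv_integrable/continuous_mul_height.
Qed.

Lemma sc_intZ (c : R) (f : R -> R) : continuous f -> sc_int (fun x => c * f x) = c * sc_int f.
Proof.
move=> cf; rewrite /sc_int -RintegralZl //.
- by apply: eq_Rintegral => x _; rewrite mulrA.
- exact/continuous_itv_integrable/continuous_mul_height.
Qed.

Lemma height_ge0 x : 0 <= height x.
Proof. by rewrite /height mulr_ge0 ?invr_ge0 ?mulr_ge0 ?pi_ge0 ?sqrtr_ge0. Qed.

Lemma sc_int_le (f g : R -> R) : continuous f -> continuous g ->
  (forall x, `|x| <= 2 -> f x <= g x) -> sc_int f <= sc_int g.
Proof.
move=> cf cg fg; apply: le_Rintegral => //.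
- exact/continuous_itv_integrable/continuous_mul_height.
- exact/continuous_itv_integrable/continuous_mul_height.
by move=> x /=; rewrite in_itv /= -ler_norml => /fg h; rewrite ler_wpM2r ?height_ge0.
Qed.

Definition cos_primitive (h : nat) (t : R) : R :=
  if h is 0%N then t else h%:R^-1 * sin (h%:R * t).

Lemma is_derive_cos_primitive h (t : R) :
  is_derive t 1 (cos_primitive h) (cos (h%:R * t)).
Proof.
case: h => [|h] /=; first by rewrite mul0r cos0; exact: is_derive_id.
apply: is_derive_eq.
by rewrite /GRing.scale /= mulr1 mulrC mulfK // pnatr_eq0.
Qed.

Lemma sin_natpi n : sin (n%:R * pi) = 0 :> R.
Proof.
elim: n => [|n IH]; first by rewrite mul0r sin0.
by rewrite -natr1 mulrDl mul1r sinDpi IH oppr0.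
Qed.

Lemma cos_primitive0 h : cos_primitive h 0 = 0.
Proof. by case: h => //= h; rewrite mulr0 sin0 mulr0. Qed.

Lemma cos_primitive_pi h : cos_primitive h pi = (h == 0%N)%:R * pi.
Proof. by case: h => [|h] /=; rewrite ?mul1r // sin_natpi mulr0 mul0r. Qed.

Let angle (t : R) : R := 2 * cos t.

Let is_derive_angle (t : R) : is_derive t 1 angle (- (2 * sin t)).
Proof. by apply: is_derive_eq; rewrite /GRing.scale /= mulrN. Qed.

Let angle_derive1 : angle^`() = (fun t => - (2 * sin t)).
Proof. by apply/funext => t; rewrite derive1E; apply: derive_val. Qed.

Let continuous_angle : continuous angle.
Proof. by move=> t; apply: cvgM; [exact: cvg_cst | exact: continuous_cos]. Qed.

Let continuous_angle1 : continuous (fun t : R => - (2 * sin t)).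
Proof.
by move=> t; apply: cvgN; apply: cvgM; [exact: cvg_cst | exact: continuous_sin].
Qed.

Lemma height_cos t : 0 <= t <= pi -> height (2 * cos t) = pi^-1 * sin t.
Proof.
move=> t0pi; rewrite /height exprMn (_ : 4 - 2 ^+ 2 * cos t ^+ 2 = (2 * sin t) ^+ 2).
  rewrite sqrtr_sqr ger0_norm; last by rewrite mulr_ge0 // sin_ge0_pi.
  by move: (@pi R) (gt_eqF (pi_gt0 R)) => p p0; field; rewrite p0.
by rewrite exprMn sin2cos2; ring.
Qed.

Lemma derivable_LRcontinuous (F f : R -> R) (a b : R) :
  (forall x : R, is_derive x 1 F (f x)) -> derivable_oo_LRcontinuous F a b.
Proof.
move=> dF; have cF (x : R) : {for x, continuous F}.
  by apply/differentiable_continuous/derivable1_diffP; apply: (@ex_derive _ _ _ _ _ _ _ (dF x)).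
split.
- by move=> x _; apply: (@ex_derive _ _ _ _ _ _ _ (dF x)).
- by apply: cvg_at_right_filter; exact: cF.
- by apply: cvg_at_left_filter; exact: cF.
Qed.

Lemma continuous_cosM (c : R) : continuous (fun t : R => cos (c * t)).
Proof.
move=> t; apply: continuous_comp; last exact: continuous_cos.
by apply: cvgM; [exact: cvg_cst | exact: cvg_id].
Qed.

(** The substitution [x = 2 cos t] turns the orthogonality relation into the
    integral of a difference of two cosines. *)
Lemma sc_int_cheb h : sc_int (cheb h) = (h == 0%N)%:R.
Proof.
rewrite /sc_int /Rintegral.
have a0 : angle 0 = 2 by rewrite /angle cos0 mulr1.
have api : angle pi = -2 by rewrite /angle cospi mulrN1.
have p0 : (0 : R) < pi := pi_gt0 R.
have -> : `[-2, 2]%classic = `[angle pi, angle 0]%classic :> set R by rewrite a0 api.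
rewrite (@integration_by_substitution_decreasing R angle (fun x => cheb h x * height x)).
- transitivity (fine (\int[mu]_(t in `[0%R, pi]) (pi^-1 * (cos (h%:R * t) - cos (h.+2%:R * t)))%:E)%E).
    congr fine; apply: eq_integral => t; rewrite inE /= in_itv /= => t0pi; congr EFin.
    rewrite !fctE angle_derive1 opprK height_cos //.
    rewrite [LHS](_ : _ = pi^-1 * (2 * sin t * (cheb h (2 * cos t) * sin t))); last by ring.
    rewrite cheb_cos; congr (_ * _).
    have -> : h%:R * t = h.+1%:R * t - t by rewrite -natr1; ring.
    have -> : h.+2%:R * t = h.+1%:R * t + t by rewrite -[h.+2%:R]natr1; ring.
    by rewrite !cosD sinN cosN; ring.
  pose Q (t : R) := pi^-1 * (cos_primitive h t - cos_primitive h.+2 t).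
  have dQ (t : R) : is_derive t 1 Q (pi^-1 * (cos (h%:R * t) - cos (h.+2%:R * t))).
    have d1 := is_derive_cos_primitive h t; have d2 := is_derive_cos_primitive h.+2 t.
    exact: (@is_deriveZ _ _ _ _ pi^-1 _ _ _ (is_deriveB d1 d2)).
  rewrite (@continuous_FTC2 R _ Q _ _ p0).
  + rewrite -EFinB /= /Q !cos_primitive0 !cos_primitive_pi /= mul0r !subr0 mulr0 subr0.
    by rewrite mulrCA mulVf ?mulr1 // gt_eqF.
  + apply: continuous_subspaceT => t; apply: cvgM; first exact: cvg_cst.
    by apply: cvgB; exact: continuous_cosM.
  + exact: (derivable_LRcontinuous _ _ dQ).
  + by move=> t _; rewrite derive1E; apply: (@derive_val _ _ _ _ _ _ _ (dQ t)).
- exact: ltW.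
- move=> x y xI yI xy; rewrite ltr_pM2l // ltr_cos //.
- by rewrite angle_derive1 => t _; exact: continuous_angle1.
- rewrite angle_derive1; apply/cvg_ex; eexists; apply: cvg_at_right_filter.
  exact: continuous_angle1.
- rewrite angle_derive1; apply/cvg_ex; eexists; apply: cvg_at_left_filter.
  exact: continuous_angle1.
- exact: (derivable_LRcontinuous _ _ is_derive_angle).
- exact/continuous_subspaceT/continuous_mul_height/continuous_cheb.
Qed.

Definition sc_moment (k h : nat) : R := sc_int (fun x => x ^+ k * cheb h x).

Lemma continuous_moment k h : continuous (fun x : R => x ^+ k * cheb h x).
Proof. by move=> x; apply: cvgM; [exact: exprn_continuous | exact: continuous_cheb]. Qed.

Lemma sc_moment0 h : sc_moment 0 h = (h == 0%N)%:R.
Proof.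
rewrite -sc_int_cheb; apply: eq_Rintegral => x _; by rewrite expr0 mul1r.
Qed.

Lemma sc_momentS0 k : sc_moment k.+1 0 = sc_moment k 1.
Proof. by apply: eq_Rintegral => x _; rewrite /= mulr1 exprSr. Qed.

Lemma sc_momentSS k h : sc_moment k.+1 h.+1 = sc_moment k h.+2 + sc_moment k h.
Proof.
rewrite -sc_intD; [|exact: continuous_moment..].
by apply: eq_Rintegral => x _; rewrite chebSS exprSr; ring.
Qed.

Lemma sc_int_le_cst (f : R -> R) (c : R) : continuous f ->
  (forall x, `|x| <= 2 -> `|f x| <= c) -> `|sc_int f| <= c.
Proof.
move=> cf fc; have one : sc_int (fun x => c * cheb 0 x) = c.
  by rewrite sc_intZ ?sc_int_cheb ?mulr1 //; exact: continuous_cheb.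
have mone : sc_int (fun x => - c * cheb 0 x) = - c.
  by rewrite sc_intZ ?sc_int_cheb ?mulr1 //; exact: continuous_cheb.
have cc (a : R) : continuous (fun x => a * cheb 0 x).
  by move=> x; apply: cvgM; [exact: cvg_cst | exact: continuous_cheb].
rewrite ler_norml -{1}mone -{2}one; apply/andP; split; apply: sc_int_le => // x /fc;
  by rewrite ler_norml /= mulr1 => /andP[].
Qed.

End ChebyshevMoments.


(** * Polynomial approximation *)

Section BernsteinApproximation.
Context (R : realType).

(** The expectation of [g] under a binomial law with [n] trials and success
    probability ['X], computed one trial at a time so that its properties follow
    by induction on the number of trials. *)
Fixpoint bernstein (n : nat) (g : nat -> R) : {poly R} :=
  if n is n'.+1 then
    (1 - 'X) * bernstein n' g + 'X * bernstein n' (fun k => g k.+1)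
  else (g 0%N)%:P.

Lemma bernsteinS n g x : (bernstein n.+1 g).[x] =
  (1 - x) * (bernstein n g).[x] + x * (bernstein n (fun k => g k.+1)).[x].
Proof. by rewrite /= !hornerE. Qed.

Lemma bernsteinB n g h x : (bernstein n (fun k => g k - h k)).[x] =
  (bernstein n g).[x] - (bernstein n h).[x].
Proof.
elim: n g h => [|n IH] g h; first by rewrite /= !hornerC.
by rewrite !bernsteinS !IH; ring.
Qed.

Lemma bernstein_cst n c x : (bernstein n (fun=> c)).[x] = c.
Proof.
by elim: n => [|n IH]; rewrite ?bernsteinS ?IH /= ?hornerC //; ring.
Qed.

Lemma bernstein_affine n (e c : R) g x : (bernstein n (fun k => e + c * g k)).[x] =
  e + c * (bernstein n g).[x].
Proof.
elim: n g => [|n IH] g; first by rewrite /= !hornerC.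
by rewrite !bernsteinS !IH; ring.
Qed.

Lemma bernstein_le n g h x : 0 <= x <= 1 -> (forall k, (k <= n)%N -> g k <= h k) ->
  (bernstein n g).[x] <= (bernstein n h).[x].
Proof.
move=> /andP[x0 x1]; elim: n g h => [|n IH] g h gh; first by rewrite /= !hornerC gh.
rewrite !bernsteinS; apply: lerD; apply: ler_wpM2l; rewrite ?subr_ge0 //.
  by apply: IH => k kn; apply: gh; exact: leqW.
by apply: IH => k kn; apply: gh.
Qed.

Lemma bernstein_variance n a x : (bernstein n (fun k => (k%:R - a) ^+ 2)).[x] =
  (n%:R * x - a) ^+ 2 + n%:R * x * (1 - x).
Proof.
elim: n a => [|n IH] a; first by rewrite /= hornerC; ring.
rewrite bernsteinS IH.
rewrite (_ : (fun k => _) = (fun k : nat => (k%:R - (a - 1)) ^+ 2)); last first.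
  by apply/funext => k; rewrite -natr1; ring.
by rewrite IH -natr1; ring.
Qed.

Lemma uniform_continuity (F : R -> R) (a b e : R) : continuous F -> 0 < e ->
  exists2 d : R, 0 < d & forall x s, a <= x <= b -> `|s - x| < d -> `|F s - F x| <= e.
Proof.
move=> cF e0.
have := @segment_compact R a b; rewrite compact_near_coveringP => cov.
have := cov R (0 : R)^'+ (fun d x => forall s, `|s - x| < d -> `|F s - F x| <= e) _.
case=> [x _|].
  have : \forall y \near x, `|F x - F y| < e / 2.
    by move: (cF x) => /cvgrPdist_lt; apply; rewrite divr_gt0.
  case=> r /= r0 hr.
  exists (ball x (r / 2), `]0, (r / 2)[%classic) => /=.
    split; first by apply: nbhsx_ballx; rewrite divr_gt0.
    have r20 : 0 < r / 2 by rewrite divr_gt0.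
    by apply: filterS2 (nbhs_right_gt 0) (nbhs_right_lt r20) => d d0 dr; rewrite /= in_itv /= d0.
  move=> [y d] /= [xy]; rewrite in_itv /= => /andP[d0 dr] s sy.
  have hy : `|F x - F y| < e / 2.
    by apply: hr; rewrite /ball_ /=; apply: lt_le_trans xy _; rewrite ler_pdivrMr // ler_peMr ?(ltW r0) ?ler1n.
  have hs : `|F x - F s| < e / 2.
    apply: hr; rewrite /ball_ /= (_ : x - s = (x - y) - (s - y)); last by ring.
    rewrite [r]splitr; apply: le_lt_trans (ler_normB _ _) _.
    by apply: ltrD; [exact: xy | exact: lt_trans dr].
  rewrite (_ : F s - F y = (F x - F y) - (F x - F s)); last by ring.
  by rewrite [e]splitr; apply: le_trans (ler_normB _ _) _; apply: lerD; exact: ltW.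
move=> r /= r0 hr; exists (r / 2); first by rewrite divr_gt0.
move=> x s xab; apply: (hr (r / 2)) => //=.
  by rewrite sub0r normrN gtr0_norm ?divr_gt0 // ltr_pdivrMr // ltr_pMr // ltr1n.
by rewrite divr_gt0.
Qed.

(** Far from [x] the increment of [F] is bounded by a multiple of the squared
    distance, whose mean under the binomial law is a variance. *)
Lemma weierstrass01 (F : R -> R) (e : R) : continuous F -> 0 < e ->
  exists p : {poly R}, forall x, 0 <= x <= 1 -> `|F x - p.[x]| <= e.
Proof.
move=> cF e0; have e20 : 0 < e / 2 by rewrite divr_gt0.
have [d d0 hd] := @uniform_continuity F 0 1 _ cF e20.
have [M hM] : exists M, forall x, 0 <= x <= 1 -> `|F x| <= M.
  have cont : {within `[0 : R, 1], continuous (fun x => `|F x|)}.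
    by apply: continuous_subspaceT => x; apply: cvg_norm; exact: cF.
  have [c _ hc] := EVT_max ler01 cont.
  by exists `|F c| => x x01; apply: hc; rewrite in_itv.
have M0 : 0 <= M by apply: le_trans (hM 0 _); rewrite // lexx ler01.
pose c := 2 * M / d ^+ 2.
have c_ge0 : 0 <= c by apply: divr_ge0; [exact: mulr_ge0 | apply/exprn_ge0/ltW].
have key x s : 0 <= x <= 1 -> 0 <= s <= 1 -> `|F s - F x| <= e / 2 + c * (s - x) ^+ 2.
  move=> x01 s01; have c0 : 0 <= c * (s - x) ^+ 2.
    by rewrite mulr_ge0 // sqr_ge0.
  have [sx|sx] := ltP `|s - x| d; first by apply: le_trans (hd _ _ x01 sx) _; rewrite lerDl.
  apply: (@le_trans _ _ (2 * M)).
    by apply: le_trans (ler_normB _ _) _; rewrite mulr_natl mulr2n lerD ?hM.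
  apply: (@le_trans _ _ (c * (s - x) ^+ 2)); last by rewrite lerDr ltW.
  rewrite /c -mulrA; apply: ler_peMr; first by rewrite mulr_ge0.
  rewrite mulrC ler_pdivlMr ?exprn_gt0 // mul1r -[leRHS]real_normK ?num_real //.
  by apply: lerXn2r => //; rewrite nnegrE // ltW.
have [n hn] : exists n : nat, c <= e / 2 * n.+1%:R.
  exists (Num.truncn (c / (e / 2))); rewrite mulrC -ler_pdivrMr // ltW //.
  exact: truncnS_gt.
pose g (k : nat) := F (k%:R / n.+1%:R).
exists (bernstein n.+1 g) => x x01.
have n0 : (0 : R) < n.+1%:R by rewrite ltr0n.
pose h (k : nat) : R := e / 2 + c / n.+1%:R ^+ 2 * (k%:R - n.+1%:R * x) ^+ 2.
have gh k : (k <= n.+1)%N -> `|g k - F x| <= h k.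
  move=> kn; have s01 : 0 <= (k%:R / n.+1%:R : R) <= 1.
    by rewrite divr_ge0 //= ler_pdivrMr // mul1r ler_nat.
  apply: le_trans (key x _ x01 s01) _; rewrite /h le_eqVlt; apply/orP; left; apply/eqP.
  by field; rewrite gt_eqF.
have hE : (bernstein n.+1 h).[x] <= e.
  rewrite bernstein_affine bernstein_variance subrr expr0n add0r.
  rewrite [leRHS]splitr lerD2l.
  have -> : c / n.+1%:R ^+ 2 * (n.+1%:R * x * (1 - x)) = c * (x * (1 - x)) / n.+1%:R.
    by field; rewrite gt_eqF.
  rewrite ler_pdivrMr //; apply: le_trans hn; apply: ler_piMr.
    exact: c_ge0.
  by case/andP: x01 => x0 x1; rewrite mulr_ile1 ?subr_ge0 // gerBl.
have diff : (bernstein n.+1 g).[x] - F x = (bernstein n.+1 (fun k => g k - F x)).[x].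
  by rewrite bernsteinB bernstein_cst.
rewrite distrC diff ler_norml; apply/andP; split.
  rewrite lerNl; apply: le_trans hE.
  have -> : - (bernstein n.+1 (fun k => g k - F x)).[x] = (bernstein n.+1 (fun k => 0 - (g k - F x))).[x].
    by rewrite (bernsteinB _ (fun=> 0) (fun k => g k - F x)) bernstein_cst sub0r.
  by apply: bernstein_le => // k /gh; rewrite ler_norml sub0r lerNl => /andP[].
by apply: le_trans hE; apply: bernstein_le => // k /gh; rewrite ler_norml => /andP[].
Qed.

Lemma weierstrass (F : R -> R) (B e : R) : continuous F -> 0 < B -> 0 < e ->
  exists p : {poly R}, forall x, `|x| <= B -> `|F x - p.[x]| <= e.
Proof.
move=> cF B0 e0; pose G t := F (2 * B * t - B).
have cG : continuous G.
  move=> t; apply: continuous_comp; last exact: cF.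
  by apply: cvgB; [apply: cvgM; [exact: cvg_cst | exact: cvg_id] | exact: cvg_cst].
have [p hp] := weierstrass01 cG e0.
exists (p \Po ((2 * B)^-1 *: ('X + B%:P))) => x; rewrite ler_norml => /andP[x1 x2].
rewrite horner_comp !hornerE.
have := hp ((2 * B)^-1 * (x + B)); rewrite /G mulrA mulfV ?mul1r; last first.
  by rewrite gt_eqF // mulr_gt0.
rewrite addrK; apply; rewrite mulrC; apply/andP; split.
  by apply: divr_ge0; [rewrite -lerBlDr sub0r | rewrite mulr_ge0 // ltW].
by rewrite ler_pdivrMr ?mulr_gt0 // mul1r mulr_natl mulr2n lerD2r.
Qed.

End BernsteinApproximation.


(** * Mean square convergence of the spectral moments *)

Section SpectralDistributionIntegral.
Context (R : realType) (N : nat) (A : 'M[R]_N) (sA : size (eigenvalues A) = N).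

Lemma ge0_integral_esd (g : R -> \bar R) : measurable_fun [set: R] g ->
  (forall x, 0 <= g x)%E ->
  (\int[esd A]_x g x = (N%:R^-1)%:E * \sum_(k < N) g (eigenvalues A)`_k)%E.
Proof.
move=> mg g0; rewrite /esd ge0_integral_mscale //=.
congr (_ * _)%E; rewrite ge0_integral_measure_sum //.
by apply: eq_bigr => k _; rewrite integral_dirac //= diracT mul1e.
Qed.

Lemma Rintegral_esd (f : R -> R) : measurable_fun [set: R] f ->
  \int[esd A]_x f x = N%:R^-1 * \sum_(x <- eigenvalues A) f x.
Proof.
move=> mf; have mEf : measurable_fun [set: R] (EFin \o f) by apply/measurable_EFinP.
have part (g : R -> R) : measurable_fun [set: R] g ->
   (\int[esd A]_x (EFin \o g)^\+ x = (N%:R^-1 * \sum_(x <- eigenvalues A) Num.max (g x) 0)%:E)%E.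
  move=> mg; rewrite ge0_integral_esd //; last first.
    by apply: measurable_funepos; apply/measurable_EFinP.
  rewrite EFinM (big_nth 0) big_mkord sA -sumEFin; congr (_ * _)%E.
  by apply: eq_bigr => k _; rewrite funeposE /= EFin_max.
rewrite /Rintegral integralE part // -funeposN.
have -> : (\- (EFin \o f) = EFin \o (fun x => - f x)%R)%E by [].
rewrite part; last exact: measurable_funN.
rewrite -EFinB /= -mulrBr -sumrB; congr (_ * _); apply: eq_bigr => x _.
by rewrite /Num.max; case: ltP => h1; case: ltP => h2; lra.
Qed.

End SpectralDistributionIntegral.

Section RealExpectation.
Context (d : measure_display) (T : measurableType d) (R : realType).
Context (P : probability T R).

(** Integrability and the value of the expectation are kept together, so that sums
    and multiples carry no side condition. *)
Definition has_mean (X : T -> R) (a : R) :=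
  P.-integrable [set: T] (EFin \o X) /\ (\int[P]_w (X w)%:E = a%:E)%E.

Lemma has_mean_cst c : has_mean (fun=> c) c.
Proof.
split; first by apply: finite_measure_integrable_cst.
by have := @expectation_cst _ _ _ P c; rewrite expectation.unlock.
Qed.

Lemma has_meanD X Y a b : has_mean X a -> has_mean Y b ->
  has_mean (fun w => X w + Y w) (a + b).
Proof.
move=> [iX eX] [iY eY]; split.
  by apply: eq_integrable (integrableD _ iX iY).
by under eq_integral do rewrite EFinD; rewrite integralD // eX eY.
Qed.

Lemma has_meanZ c X a : has_mean X a -> has_mean (fun w => c * X w) (c * a).
Proof.
move=> [iX eX]; split.
  by apply: eq_integrable (integrableZl _ c iX).
by under eq_integral do rewrite EFinM; rewrite integralZl // eX.
Qed.

Lemma has_mean_sum I (r : seq I) (X : I -> T -> R) (a : I -> R) :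
  (forall i, has_mean (X i) (a i)) ->
  has_mean (fun w => \sum_(i <- r) X i w) (\sum_(i <- r) a i).
Proof.
move=> h; elim: r => [|i r IH].
  rewrite big_nil; have := has_mean_cst 0; congr has_mean.
  by apply/funext => w; rewrite big_nil.
rewrite big_cons; have := has_meanD (h i) IH; congr has_mean.
by apply/funext => w; rewrite big_cons.
Qed.

Lemma has_mean_eq X Y a b : has_mean X a -> X =1 Y -> a = b -> has_mean Y b.
Proof. by move=> h /funext <- <-. Qed.

Lemma markov_has_mean (S : set T) (G : T -> R) (c g : R) : measurable S -> 0 < c ->
  has_mean G g -> (forall w, 0 <= G w) -> (forall w, S w -> c <= G w) ->
  (P S <= (c^-1 * g)%:E)%E.
Proof.
move=> mS c0 [iG eG] G0 SG.
have mG : measurable_fun [set: T] (EFin \o G) := measurable_int _ iG.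
have := le_integral_abse P measurableT mG c0; rewrite setTI => markovG.
rewrite EFinM lee_pdivlMl // -eG; apply: le_trans (le_trans _ markovG) _.
  apply: lee_wpmul2l; first by rewrite lee_fin ltW.
  apply: le_measure; rewrite ?inE //.
    rewrite -[X in measurable X]setTI; apply: emeasurable_fun_c_infty => //.
    exact: measurableT_comp.
  by move=> w Sw /=; rewrite lee_fin ger0_norm ?SG.
apply: ge0_le_integral => //.
- exact: measurableT_comp.
- by move=> w _ /=; rewrite lee_fin ger0_norm.
Qed.

End RealExpectation.


Section SpectralMoments.
Context (d : measure_display) (T : measurableType d) (R : realType).
Context (P : probability T R) (Z : nat -> {RV P >-> R}).
Context (phi : forall N : nat, filling N).

Local Notation cpos N := (closed_pos (fill_pos (phi N))).
Local Notation sqn N := (Num.sqrt (N%:R : R)).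

Lemma scaled_matrix_sym N w : (scaled_matrix Z (phi N) w)^T = scaled_matrix Z (phi N) w.
Proof. by apply/matrixP => i j; rewrite !mxE fill_posC. Qed.

Definition spectral_moment (k N : nat) (w : T) : R :=
  N%:R^-1 * \sum_(x <- eigenvalues (scaled_matrix Z (phi N) w)) x ^+ k.

Lemma spectral_moment_walks k N w : (0 < k)%N ->
  spectral_moment k N w =
    (N%:R * sqn N ^+ k)^-1 * \sum_(s : k.-tuple 'I_N) prodZ Z (cpos N s) w.
Proof.
move=> k0; rewrite /spectral_moment sum_eigenvalues_exp ?scaled_matrix_sym //.
rewrite (@mxtrace_exp_walks _ _ (fill_pos (phi N)) (fun p => (sqn N)^-1 * Z p w)) //; last first.
  by move=> i j; rewrite !mxE.
rewrite invfM -mulrA; congr (_ * _); rewrite mulr_sumr; apply: eq_bigr => s _.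
rewrite big_split /= big_const_seq count_predT size_closed_pos size_tuple.
by rewrite iter_mulr_1 exprVn.
Qed.

Lemma spectral_moment0 N w : (0 < N)%N -> spectral_moment 0 N w = 1.
Proof.
move=> N0; rewrite /spectral_moment sum_eigenvalues_exp ?scaled_matrix_sym //.
by rewrite expr0 mxtrace1 mulVf // pnatr_eq0 -lt0n.
Qed.

Context (mZ : moments_exist Z) (m1 : M1 Z) (m2 : M2 Z) (m3 : M3 Z).
Context (Fphi : filling_condition R phi).

Lemma has_mean_prodZ s : has_mean P (prodZ Z s) (moment Z s).
Proof.
split; first exact: mZ.
by rewrite -momentE // expectation.unlock.
Qed.

(** The means converge and the variances vanish, whence convergence in mean
    square. *)
Lemma spectral_moment_error k : exists2 e : nat -> R,
  e N @[N --> \oo] --> (0 : R) &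
  forall N, (0 < N)%N ->
    has_mean P (fun w => (spectral_moment k N w - sc_moment R k 0) ^+ 2) (e N).
Proof.
have [->|k0] := posnP k.
  exists (fun=> 0) => [|N N0]; first exact: cvg_cst.
  apply: has_mean_eq (has_mean_cst P 0) _ erefl => w.
  by rewrite spectral_moment0 // sc_moment0 subrr expr0n.
set m := sc_moment R k 0.
pose a N : R := (N%:R * sqn N ^+ k)^-1.
pose mean N := \sum_(s : k.-tuple 'I_N) moment Z (cpos N s).
pose cov N := \sum_(s : k.-tuple 'I_N) \sum_(t : k.-tuple 'I_N)
  (moment Z (cpos N s ++ cpos N t) - moment Z (cpos N s) * moment Z (cpos N t)).
have mperm := @moment_perm _ _ _ P Z.
have meanL : mean N * a N @[N --> \oo] --> m.
  apply: (@walk_mean_cvg R phi Fphi (moment Z) mperm (moment_odd m2)) => //.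
  - exact: sc_moment0.
  - exact: sc_momentS0.
  - exact: sc_momentSS.
  - by move=> n n0; apply: moment_word_bound.
  - by move=> n n0; apply: moment_square_bound.
have covL : cov N * a N ^+ 2 @[N --> \oo] --> (0 : R).
  have := @walk_covariance_cvg R phi (moment Z) k k0 (moment_covariance_bound mZ m2 m3 k0).
  by under eq_fun do rewrite -exprVn.
exists (fun N => cov N * a N ^+ 2 + (mean N * a N - m) ^+ 2).
  rewrite -[0]addr0; apply: cvgD => //.
  have dev : mean N * a N - m @[N --> \oo] --> (0 : R).
    by rewrite -(subrr m); apply: cvgB; [exact: meanL | exact: cvg_cst].
  under eq_fun do rewrite expr2; rewrite -[0](mulr0 (0 : R)).
  by apply: cvgM; exact: dev.
move=> N N0.
pose X w := \sum_(s : k.-tuple 'I_N) \sum_(t : k.-tuple 'I_N)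
    prodZ Z (cpos N s ++ cpos N t) w.
have hX : has_mean P X (\sum_(s : k.-tuple 'I_N) \sum_(t : k.-tuple 'I_N) moment Z (cpos N s ++ cpos N t)).
  by do 2![apply: has_mean_sum => ?]; exact: has_mean_prodZ.
have hS : has_mean P (fun w => \sum_(s : k.-tuple 'I_N) prodZ Z (cpos N s) w) (mean N).
  by apply: has_mean_sum => s; exact: has_mean_prodZ.
apply: has_mean_eq (has_meanD (has_meanZ (a N ^+ 2) hX)
  (has_meanD (has_meanZ (- (2 * m * a N)) hS) (has_mean_cst P (m ^+ 2)))) _ _.
  move=> w; rewrite spectral_moment_walks // -/(a N).
  have -> : X w = (\sum_(s : k.-tuple 'I_N) prodZ Z (cpos N s) w) ^+ 2.
    rewrite expr2 mulr_suml; apply: eq_bigr => s _; rewrite mulr_sumr.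
    by apply: eq_bigr => t _; rewrite /prodZ big_cat.
  by ring.
have -> : cov N = \sum_(s : k.-tuple 'I_N) \sum_(t : k.-tuple 'I_N)
   moment Z (cpos N s ++ cpos N t) - mean N ^+ 2.
  rewrite /cov expr2 mulr_suml -sumrB; apply: eq_bigr => s _.
  by rewrite mulr_sumr -sumrB.
by ring.
Qed.

End SpectralMoments.


(** * Convergence of the integrals of test functions *)

Section MeanOverEigenvalues.
Context (d : measure_display) (T : measurableType d) (R : realType).
Context (P : probability T R) (Z : nat -> {RV P >-> R}).
Context (phi : forall N : nat, filling N).
Context (mZ : moments_exist Z).

Definition eigen_mean (f : R -> R) (N : nat) (w : T) : R :=
  N%:R^-1 * \sum_(x <- eigenvalues (scaled_matrix Z (phi N) w)) f x.

Lemma eigen_mean_poly (p : {poly R}) N w :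
  eigen_mean (fun x => p.[x]) N w = \sum_(i < size p) p`_i * spectral_moment Z phi i N w.
Proof.
rewrite /eigen_mean; under eq_bigr do rewrite horner_coef.
rewrite exchange_big mulr_sumr; apply: eq_bigr => i _.
by rewrite -mulr_sumr /spectral_moment mulrCA.
Qed.

Lemma measurable_spectral_moment k N : (0 < N)%N ->
  measurable_fun [set: T] (spectral_moment Z phi k N).
Proof.
move=> N0; have [->|k0] := posnP k.
  rewrite (_ : spectral_moment Z phi 0 N = cst 1); first exact: measurable_cst.
  by apply/funext => w; rewrite spectral_moment0.
rewrite (_ : spectral_moment Z phi k N = fun w => (N%:R * Num.sqrt N%:R ^+ k)^-1 *
   \sum_(s : k.-tuple 'I_N) prodZ Z (closed_pos (fill_pos (phi N)) s) w); last first.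
  by apply/funext => w; rewrite spectral_moment_walks.
apply: measurable_funM; first exact: measurable_cst.
apply: measurable_sum => s; apply/measurable_EFinP.
exact: (measurable_int _ (mZ _)).
Qed.

(** The eigenvalues are only known through polynomial symmetric functions, so
    measurability passes through polynomial approximation. *)
Lemma measurable_eigen_mean (f : R -> R) N : (0 < N)%N -> continuous f ->
  measurable_fun [set: T] (eigen_mean f N).
Proof.
move=> N0 cf.
have app (n : nat) : exists p : {poly R}, forall x, `|x| <= n.+1%:R -> `|f x - p.[x]| <= n.+1%:R^-1.
  by apply: weierstrass => //; rewrite ?invr_gt0 ltr0n.
have [p hp] := choice app.
apply: (@measurable_fun_cvg _ _ _ _ (fun n w => eigen_mean (fun x => (p n).[x]) N w)).
  move=> n; rewrite (_ : (fun w => _) =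
     fun w => \sum_(i < size (p n)) (p n)`_i * spectral_moment Z phi i N w); last first.
    by apply/funext => w; rewrite eigen_mean_poly.
  apply: measurable_sum => i; apply: measurable_funM; first exact: measurable_cst.
  exact: measurable_spectral_moment.
move=> w _; apply: cvgM; first exact: cvg_cst.
have pcvg x : (p n).[x] @[n --> \oo] --> f x.
  apply/cvgrPdist_le => e e0; near=> n.
  apply: le_trans (hp n x _) _.
    apply: (@le_trans _ _ n%:R); last by rewrite ler_nat.
    by near: n; exact: nbhs_infty_ger.
  rewrite invf_ple ?posrE // ?ltr0n //; apply: (@le_trans _ _ n%:R); last by rewrite ler_nat.
  by near: n; exact: nbhs_infty_ger.
elim: (eigenvalues _) => [|x s IH].
  by under eq_fun do rewrite big_nil; rewrite big_nil; exact: cvg_cst.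
by under eq_fun do rewrite big_cons; rewrite big_cons; apply: cvgD.
Unshelve. all: by end_near. Qed.

End MeanOverEigenvalues.

Section TestFunctions.
Context (R : realType).

(** Trades an error that is linear in [x] for a quadratic one, whose expectation is
    known. *)
Lemma abs_le_sqr (t x : R) : 0 < t -> `|x| <= t + t^-1 * x ^+ 2.
Proof.
move=> t0; have [xt|tx] := leP `|x| t.
  by apply: le_trans xt _; rewrite lerDl mulr_ge0 ?sqr_ge0 // invr_ge0 ltW.
apply: (@le_trans _ _ (t^-1 * x ^+ 2)); last by rewrite lerDr ltW.
rewrite ler_pdivlMl // -[x ^+ 2]real_normK ?num_real // expr2.
by apply: ler_wpM2r => //; exact: ltW.
Qed.

(** The polynomial approximates [f] on [-3, 3]. Outside this interval, both are
    bounded by a multiple of an even monomial, which becomes small on [-2, 2]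
    when its degree grows. *)
Lemma poly_approx_even_tail (f : R -> R) (M eta : R) : continuous f ->
  (forall x, `|f x| <= M) -> 0 < eta ->
  exists (p : {poly R}) (c : R) (K : nat), [/\ 0 <= c,
    forall x, `|f x - p.[x]| <= eta + c * x ^+ K,
    forall x, `|x| <= 2 -> `|c * x ^+ K| <= eta &
    forall x, `|x| <= 2 -> `|f x - p.[x]| <= eta].
Proof.
move=> cf fM eta0; have [p hp] := weierstrass cf (ltr0n R 3) eta0.
have M0 : 0 <= M by apply: le_trans (fM 0).
pose D := M + \sum_(i < size p) `|p`_i|.
have D0 : 0 <= D by rewrite addr_ge0 // sumr_ge0.
pose deg := size p.
have outside x : 3 <= `|x| -> `|f x - p.[x]| <= D * `|x| ^+ deg.*2.
  move=> x3; have x1 : 1 <= `|x| by apply: le_trans x3; rewrite ler1n.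
  apply: le_trans (ler_normB _ _) _; rewrite mulrDl; apply: lerD.
    by apply: le_trans (fM x) _; rewrite ler_peMr // exprn_ege1.
  rewrite horner_coef mulr_suml; apply: le_trans (ler_norm_sum _ _ _) _.
  apply: ler_sum => i _; rewrite normrM normrX; apply: ler_wpM2l => //.
  apply: ler_weXn2l => //; rewrite -addnn; apply: leq_trans (ltnW (ltn_ord i)) _.
  exact: leq_addr.
(* The ratio 4 / 9 compares [x ^+ 2] at 2 and at 3: raising the degree makes the
   monomial small on [-2, 2] while it still dominates beyond 3. *)
have [r hr] : exists r, (4 / 9 : R) ^+ r <= eta / (D * 4 ^+ deg + 1).
  by apply: expr_small; rewrite ?divr_gt0 ?ltr_wpDl ?mulr_ge0 ?exprn_ge0 //; lra.
pose c := D / 9 ^+ r; have c0 : 0 <= c by rewrite divr_ge0 ?exprn_ge0.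
exists p, c, (deg + r).*2.
have even_ge0 (x : R) n : 0 <= x ^+ n.*2 by rewrite -mul2n exprM exprn_ge0 // sqr_ge0.
split => //.
- move=> x; have [x3|x3] := leP `|x| 3.
    by apply: le_trans (hp x x3) _; rewrite lerDl mulr_ge0.
  apply: le_trans (outside x (ltW x3)) _.
  apply: (@le_trans _ _ (c * x ^+ (deg + r).*2)); last by rewrite lerDr ltW.
  rewrite doubleD exprD -[x ^+ r.*2]ger0_norm // -[x ^+ deg.*2]ger0_norm // !normrX.
  rewrite /c mulrAC mulrA -mulrA ler_peMr ?mulr_ge0 ?exprn_ge0 //.
  rewrite ler_pdivlMr ?exprn_gt0 // mul1r -mul2n exprM.
  apply: lerXn2r; rewrite ?nnegrE ?sqr_ge0 //.
  rewrite (_ : 9 = 3 ^+ 2); last by rewrite -natrX.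
  by apply: lerXn2r; rewrite ?nnegrE //; exact: ltW.
- move=> x x2; rewrite normrM (ger0_norm c0) normrX.
  apply: (@le_trans _ _ (c * 2 ^+ (deg + r).*2)).
    by apply: ler_wpM2l => //; apply: lerXn2r; rewrite ?nnegrE.
  have -> : c * 2 ^+ (deg + r).*2 = D * 4 ^+ deg * (4 / 9) ^+ r.
    rewrite /c doubleD exprD -!mul2n !exprM (_ : 2 ^+ 2 = 4); last by rewrite -natrX.
    by rewrite expr_div_n; ring.
  have B1 : 0 < D * 4 ^+ deg + 1 by rewrite ltr_wpDl ?mulr_ge0 ?exprn_ge0.
  apply: (@le_trans _ _ ((D * 4 ^+ deg + 1) * (4 / 9) ^+ r)).
    by apply: ler_wpM2r; rewrite ?exprn_ge0 ?divr_ge0 // lerDl.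
  by rewrite mulrC -ler_pdivlMr.
- by move=> x x2; apply: hp; apply: le_trans x2 _; rewrite ler_nat.
Qed.

End TestFunctions.


Section WeakLimit.
Context (d : measure_display) (T : measurableType d) (R : realType).
Context (P : probability T R) (Z : nat -> {RV P >-> R}).
Context (phi : forall N : nat, filling N).

Local Notation error k N w := (spectral_moment Z phi k N w - sc_moment R k 0).

Lemma sc_int_poly (p : {poly R}) :
  sc_int (fun x => p.[x]) = \sum_(i < size p) p`_i * sc_moment R i 0.
Proof.
have cX (i : nat) : continuous (fun x : R => p`_i * (x ^+ i * cheb 0 x)).
  by move=> x; apply: cvgM; [exact: cvg_cst | exact: continuous_moment].
have -> : (fun x => p.[x]) = (fun x => \sum_(i < size p) p`_i * (x ^+ i * cheb 0 x)).
  by apply/funext => x; rewrite horner_coef; apply: eq_bigr => i _; rewrite /= mulr1.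
elim: (size p) => [|n IH].
  rewrite big_ord0; apply/eqP; rewrite -normr_le0; apply: sc_int_le_cst.
    by under eq_fun do rewrite big_ord0; move=> x; exact: cvg_cst.
  by move=> x _; rewrite big_ord0 normr0.
have csum : continuous (fun x : R => \sum_(i < n) p`_i * (x ^+ i * cheb 0 x)).
  elim: (n) => [|n' IH'].
    by under eq_fun do rewrite big_ord0; move=> x; exact: cvg_cst.
  by under eq_fun do rewrite big_ord_recr /=; move=> x; apply: cvgD; [exact: IH' | exact: cX].
under eq_fun do rewrite big_ord_recr /=; rewrite big_ord_recr /=.
rewrite (sc_intD csum (cX n)) IH; congr (_ + _).
by rewrite sc_intZ //; exact: continuous_moment.
Qed.

Lemma continuous_horner (p : {poly R}) : continuous (fun x : R => p.[x]).
Proof.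
elim/poly_ind: p => [|p c IH] x.
  by under eq_fun do rewrite horner0; exact: cvg_cst.
under eq_fun do rewrite hornerMXaddC.
apply: cvgD; last exact: cvg_cst.
by apply: cvgM; [exact: IH | exact: cvg_id].
Qed.

(** The monomial that controls the error is integrated like the terms of [p], so
    that only errors of spectral moments occur in the bound. *)
Lemma eigen_mean_deviation (f : R -> R) (p : {poly R}) (c eta : R) (K N : nat) w :
  (0 < N)%N -> continuous f -> 0 <= c ->
  (forall x, `|f x - p.[x]| <= eta + c * x ^+ K) ->
  (forall x, `|x| <= 2 -> `|c * x ^+ K| <= eta) ->
  (forall x, `|x| <= 2 -> `|f x - p.[x]| <= eta) ->
  `|eigen_mean Z phi f N w - sc_int f| <=
    eta *+ 3 + (\sum_(i < size p) `|p`_i| * `|error i N w| + c * `|error K N w|).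
Proof.
move=> N0 cf c0 close tail inside.
have NR : N%:R != 0 :> R by rewrite pnatr_eq0 -lt0n.
have sE := size_eigenvalues (scaled_matrix_sym Z phi N w).
have part1 : `|eigen_mean Z phi f N w - eigen_mean Z phi (fun x => p.[x]) N w| <=
    eta + c * spectral_moment Z phi K N w.
  rewrite -mulrBr -sumrB normrM ger0_norm ?invr_ge0 //.
  apply: (@le_trans _ _ (N%:R^-1 *
     \sum_(x <- eigenvalues (scaled_matrix Z (phi N) w)) (eta + c * x ^+ K))).
    apply: ler_wpM2l; first by rewrite invr_ge0.
    by apply: le_trans (ler_norm_sum _ _ _) _; apply: ler_sum => x _; exact: close.
  rewrite big_split /= big_const_seq count_predT sE iter_addr_0 -mulr_sumr mulrDr.
  by rewrite -[eta *+ N]mulr_natl mulKf // mulrCA.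
have part2 : c * spectral_moment Z phi K N w <= eta + c * `|error K N w|.
  have mK : c * sc_moment R K 0 <= eta.
    rewrite -sc_intZ; last exact: continuous_moment.
    apply: le_trans (ler_norm _) _; apply: sc_int_le_cst => [x|x x2].
      by apply: cvgM; [exact: cvg_cst | exact: continuous_moment].
    by rewrite /= mulr1; exact: tail.
  rewrite [leLHS](_ : _ = c * sc_moment R K 0 + c * error K N w); last by ring.
  by apply: lerD => //; apply: ler_wpM2l => //; exact: ler_norm.
have part3 : `|eigen_mean Z phi (fun x => p.[x]) N w - sc_int (fun x => p.[x])| <=
    \sum_(i < size p) `|p`_i| * `|error i N w|.
  rewrite eigen_mean_poly sc_int_poly -sumrB; apply: le_trans (ler_norm_sum _ _ _) _.
  by apply: ler_sum => i _; rewrite -mulrBr normrM.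
have part4 : `|sc_int (fun x => p.[x]) - sc_int f| <= eta.
  have -> : sc_int (fun x => p.[x]) - sc_int f = - sc_int (fun x => f x + -1 * p.[x]).
    have cNp : continuous (fun x : R => -1 * p.[x]).
      by move=> x; apply: cvgM; [exact: cvg_cst | exact: continuous_horner].
    by rewrite (sc_intD cf cNp) sc_intZ; [ring | exact: continuous_horner].
  rewrite normrN; apply: sc_int_le_cst => [x|x x2].
    apply: cvgD; first exact: cf.
    by apply: cvgM; [exact: cvg_cst | exact: continuous_horner].
  by rewrite mulN1r; exact: inside.
rewrite (_ : _ - sc_int f = (eigen_mean Z phi f N w - eigen_mean Z phi (fun x => p.[x]) N w) +
  ((eigen_mean Z phi (fun x => p.[x]) N w - sc_int (fun x => p.[x])) +
   (sc_int (fun x => p.[x]) - sc_int f))); last by ring.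
have := le_trans (ler_normD _ _) (lerD part1 (le_trans (ler_normD _ _) (lerD part3 part4))).
move=> /le_trans; apply; rewrite !mulrS mulr0n.
by move: part2; lra.
Qed.

End WeakLimit.

Theorem theorem2p5 (R : realType) (d : measure_display) (T : measurableType d)
    (P : probability T R) (Z : nat -> {RV P >-> R})
    (phi : forall N : nat, filling N) :
  moments_exist Z -> M1 Z -> M2 Z -> M3 Z ->
  filling_condition R phi ->
  weak_cvg_in_probability P
    (fun N w => esd (scaled_matrix Z (phi N) w)) (@semicircle R).
Proof.
move=> mZ m1 m2 m3 F f cf [M fM] eps eps0.
have eta0 : 0 < eps / 8 by rewrite divr_gt0.
have [p [c [K [c0 close tail inside]]]] := poly_approx_even_tail cf fM eta0.
have mf : measurable_fun [set: R] f := continuous_measurable_fun cf.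
have sizes N w := size_eigenvalues (scaled_matrix_sym Z phi N w).
under eq_fun do under eq_set do
  rewrite (Rintegral_esd (sizes _ _) mf) Rintegral_semicircle //.
pose err k N w := spectral_moment Z phi k N w - sc_moment R k 0.
have /choice[e he] k : exists e : nat -> R, e N @[N --> \oo] --> (0 : R) /\
    (forall N, (0 < N)%N -> has_mean P (fun w => err k N w ^+ 2) (e N)).
  by have [e e1 e2] := spectral_moment_error mZ m1 m2 m3 F k; exists e.
pose G N w := \sum_(i < size p) `|p`_i| * err i N w ^+ 2 + c * err K N w ^+ 2.
pose g N := \sum_(i < size p) `|p`_i| * e i N + c * e K N.
pose A := \sum_(i < size p) `|p`_i| + c.
have A0 : 0 <= A by rewrite addr_ge0 // sumr_ge0.
(* The constant terms of the quadratic errors then add up to at most [eps / 4]. *)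
pose t := eps / 4 / (A + 1).
have A1 : 0 < A + 1 by rewrite ltr_wpDl.
have t0 : 0 < t by rewrite !divr_gt0.
have tA : A * t <= eps / 4.
  rewrite /t mulrA ler_pdivrMr // mulrC ler_wpM2l ?lerDl // ltW //.
  by rewrite divr_gt0.
pose c1 := t * (eps / 4).
have c10 : 0 < c1 by rewrite mulr_gt0 // divr_gt0.
have scaled_cvg (a : R) (u : nat -> R) : u N @[N --> \oo] --> (0 : R) ->
    a * u N @[N --> \oo] --> (0 : R).
  by move=> u0; rewrite -(mulr0 a); apply: cvgM => //; exact: cvg_cst.
have sum_cvg (u v : nat -> R) : u N @[N --> \oo] --> (0 : R) ->
    v N @[N --> \oo] --> (0 : R) -> u N + v N @[N --> \oo] --> (0 : R).
  by move=> u0 v0; rewrite -(addr0 0); exact: cvgD.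
have greal : c1^-1 * g N @[N --> \oo] --> (0 : R).
  apply/scaled_cvg/sum_cvg; last exact: scaled_cvg (he K).1.
  elim: (size p) => [|n IH].
    by under eq_fun do rewrite big_ord0; exact: cvg_cst.
  under eq_fun do rewrite big_ord_recr /=.
  by apply/sum_cvg => //; exact: scaled_cvg (he n).1.
have g0 : (c1^-1 * g N)%:E @[N --> \oo] --> 0%E.
  by apply: cvg_EFin; [exact: nearW | exact: greal].
apply: (@squeeze_cvge _ _ _ _ (cst 0%E) _ (fun N => (c1^-1 * g N)%:E)) => //; last exact: cvg_cst.
near=> N; have N0 : (0 < N)%N by near: N; exact: nbhs_infty_gt.
rewrite measure_ge0 /=.
apply: (@markov_has_mean _ _ _ P _ (G N)) => //.
- have mE : measurable_fun [set: T] (fun w => `|eigen_mean Z phi f N w - sc_int f|).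
    apply: measurableT_comp => //; apply: measurable_funB; last exact: measurable_cst.
    exact: measurable_eigen_mean.
  have := mE measurableT `]eps, +oo[%classic (measurable_itv _); rewrite setTI.
  by congr measurable; apply/seteqP; split => w /=; rewrite in_itv /= andbT.
- apply: has_meanD; last by apply: has_meanZ; exact: (he K).2.
  by apply: has_mean_sum => i; apply: has_meanZ; exact: (he i).2.
- move=> w; apply: addr_ge0; last by rewrite mulr_ge0 // sqr_ge0.
  by apply: sumr_ge0 => i _; rewrite mulr_ge0 // sqr_ge0.
move=> w /= dev.
have := @eigen_mean_deviation _ _ _ P Z phi f p c (eps / 8) K N w N0 cf c0 close tail inside.
rewrite -/(err K N w) => bound.
have sum_bound : \sum_(i < size p) `|p`_i| * `|err i N w| + c * `|err K N w| <=
    A * t + t^-1 * G N w.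
  have -> : A * t + t^-1 * G N w = \sum_(i < size p) `|p`_i| * (t + t^-1 * err i N w ^+ 2)
      + c * (t + t^-1 * err K N w ^+ 2).
    rewrite /A /G; under [in RHS]eq_bigr do rewrite mulrDr.
    by rewrite big_split /= -mulr_suml mulrDr mulr_sumr;
      under [in RHS]eq_bigr do rewrite mulrCA; ring.
  apply: lerD; last by apply: ler_wpM2l => //; exact: abs_le_sqr.
  by apply: ler_sum => i _; apply: ler_wpM2l => //; exact: abs_le_sqr.
have : eps / 4 <= t^-1 * G N w.
  have := lt_le_trans dev (le_trans bound (lerD (lexx _) sum_bound)).
  by rewrite -[_ *+ 3]mulr_natr; move: tA; lra.
by rewrite ler_pdivlMl.
Unshelve. all: by end_near. Qed.
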